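(* Let $r\in\mathbb{N}=\{1,2,3,\dots\}$, $t_r=\frac{2^{r+1}}{2^{r+1}-1}\pi$, $J_r=[2^{r+1}\pi,\,2^{r+1}t_r]$, and let $\epsilon$ satisfy $0<\epsilon<\frac{2^r-1}{2^{r+1}-1}\pi$. Put $$S_1=\Bigl[\tfrac{t_r}{2}+\tfrac{\epsilon}{2^{r+1}},\ \tfrac{t_r}{2}+\epsilon\Bigr],\quad S_2=[t_r+2\epsilon,\ 2\pi],\quad S_3=[2^{r+1}t_r,\ 2^{r+1}t_r+2\epsilon],$$ and define recursively $$E_0=S_1+2^{r+1}\pi,\quad F_0=2^{-(r+2)}E_0,\qquad E_n=F_{n-1}+2^{r+1}\pi,\quad F_n=2^{-(n+r+2)}E_n\quad(n\ge1).$$ Then the set $$K_{r,\epsilon}=\Bigl(J_r\setminus\bigcup_{n=0}^\infty E_n\Bigr)\cup\Bigl(\bigcup_{n=0}^\infty F_n\Bigr)\cup(S_1\cup S_2\cup S_3)$$ is an $H^2$-wavelet set.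
   Context: The Fourier transform is $\hat f(\xi)=\int_{\mathbb{R}} f(x)e^{-i\xi x}\,dx$ (extended to $L^2(\mathbb{R})$ as usual). The Hardy space is $H^2(\mathbb{R})=\{f\in L^2(\mathbb{R}):\hat f(\xi)=0\text{ for a.e. }\xi\le 0\}$. A function $\psi\in H^2(\mathbb{R})$ is an $H^2$-wavelet if $\{\psi_{j,k}=2^{j/2}\psi(2^j\cdot-k):j,k\in\mathbb{Z}\}$ is an orthonormal basis of $H^2(\mathbb{R})$. A measurable set $K\subset\mathbb{R}^+=(0,\infty)$ is an $H^2$-wavelet set if there is an $H^2$-wavelet $\psi$ with $|\hat\psi|=\chi_K$ a.e. For a set $S\subset\mathbb{R}$ and reals $c,a$, $cS+a=\{cs+a:s\in S\}$. *)

(* Defs.v *)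
From HB Require Import structures.
From mathcomp Require Import all_boot all_order all_algebra.
From mathcomp Require Import complex.
From mathcomp Require Import all_classical all_reals all_analysis measurable_realfun.
Import Order.TTheory GRing.Theory Num.Theory.
Import numFieldNormedType.Exports.

Set Implicit Arguments.
Unset Strict Implicit.
Unset Printing Implicit Defensive.

Local Open Scope classical_set_scope.
Local Open Scope ring_scope.

Section ComplexFunctions.
Context {R : realType}.
Local Notation C := R[i].
Local Notation mu := (@lebesgue_measure R).

(* [complex.Re] and [complex.Im] are real-valued, as is the modulus
   [ComplexField.Normc.normc]; the generic [`|z|] would live in [R[i]]. *)
Definition cmod (z : C) : R := ComplexField.Normc.normc z.

Definition cexpi (t : R) : C := Complex (cos t) (sin t).

Definition Cmeasurable (f : R -> C) : Prop :=
  measurable_fun setT (fun x => complex.Re (f x)) /\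
  measurable_fun setT (fun x => complex.Im (f x)).

Definition CLnorm (p : \bar R) (f : R -> C) : \bar R :=
  Lnorm mu p (fun x => (cmod (f x))%:E).

(* Elements of L^p are represented by Borel functions, every class having such
   a representative; functions equal a.e. are not identified. *)
Definition CLp (p : \bar R) (f : R -> C) : Prop :=
  Cmeasurable f /\ (CLnorm p f < +oo)%E.

(* Meaningful for f in L^1. *)
Definition Cintegral (f : R -> C) : C :=
  Complex (Rintegral mu setT (fun x => complex.Re (f x)))
          (Rintegral mu setT (fun x => complex.Im (f x))).

Definition fourier1 (f : R -> C) (xi : R) : C :=
  Cintegral (fun x => f x * cexpi (- (xi * x))).

Definition CL2cvg (u : nat -> R -> C) (f : R -> C) : Prop :=
  CLnorm 2%:E (fun x => u n x - f x) @[n --> \oo] --> (0 : \bar R).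

(* g is (a representative of) the Fourier transform of f in L^2: the extension
   by continuity to L^2 of [fourier1], defined on the dense subspace
   L^1 \cap L^2. By Plancherel's theorem g exists and is unique a.e. *)
Definition is_fourier (f g : R -> C) : Prop :=
  [/\ CLp 2%:E f, CLp 2%:E g &
    exists u : nat -> R -> C,
      [/\ forall n, CLp 1%:E (u n) /\ CLp 2%:E (u n),
          CL2cvg u f &
          CL2cvg (fun n => fourier1 (u n)) g]].

Definition hardy2 (f : R -> C) : Prop :=
  CLp 2%:E f /\
  exists2 g, is_fourier f g & {ae mu, forall xi, xi <= 0 -> g xi = 0}.

Definition Cinner (f g : R -> C) : C :=
  Cintegral (fun x => f x * conjc (g x)).

(* Complete orthonormal system: the finite linear combinations are dense. *)
Definition hardy2_orthonormal_basis (I : eqType) (e : I -> R -> C) : Prop :=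
  [/\ forall i, hardy2 (e i),
      forall i j, Cinner (e i) (e j) = (i == j)%:R &
      forall f, hardy2 f -> forall d : R, 0 < d ->
        exists (s : seq I) (c : I -> C),
          (CLnorm 2%:E (fun x => f x - \sum_(i <- s) c i * e i x)%R
             < d%:E)%E].

Definition wavelet_system (psi : R -> C) (jk : int * int) (x : R) : C :=
  (2 `^ (jk.1%:~R / 2))%:C%C * psi (2 ^ jk.1 * x - jk.2%:~R).

Definition hardy2_wavelet (psi : R -> C) : Prop :=
  hardy2 psi /\ hardy2_orthonormal_basis (wavelet_system psi).

(* [completed_algebra_gen lebesgue_measure] consists of the Lebesgue measurable
   sets, [measurable] only of the Borel ones. *)
Definition hardy2_wavelet_set (K : set R) : Prop :=
  [/\ completed_algebra_gen mu K, K `<=` [set x | 0 < x] &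
    exists2 psi, hardy2_wavelet psi &
      exists2 psihat, is_fourier psi psihat &
        {ae mu, forall xi, cmod (psihat xi) = \1_K xi}].

End ComplexFunctions.

Section TheSet.
Context {R : realType}.

Definition affine_image (c a : R) (S : set R) : set R :=
  [set c * s + a | s in S].

Definition t_ (r : nat) : R := 2 ^+ r.+1 / (2 ^+ r.+1 - 1) * pi.

Definition J_ (r : nat) : set R :=
  `[2 ^+ r.+1 * pi, 2 ^+ r.+1 * t_ r]%classic.

Definition S1 (r : nat) (eps : R) : set R :=
  `[t_ r / 2 + eps / 2 ^+ r.+1, t_ r / 2 + eps]%classic.

Definition S2 (r : nat) (eps : R) : set R :=
  `[t_ r + 2 * eps, 2 * pi]%classic.

Definition S3 (r : nat) (eps : R) : set R :=
  `[2 ^+ r.+1 * t_ r, 2 ^+ r.+1 * t_ r + 2 * eps]%classic.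

(* The mutual recursion between E_n and F_n, with F_n inlined. *)
Fixpoint E_ (r : nat) (eps : R) (n : nat) : set R :=
  match n with
  | 0%N => affine_image 1 (2 ^+ r.+1 * pi) (S1 r eps)
  | m.+1 => affine_image 1 (2 ^+ r.+1 * pi)
              (affine_image (2 ^- (m + r + 2)) 0 (E_ r eps m))
  end.

Definition F_ (r : nat) (eps : R) (n : nat) : set R :=
  affine_image (2 ^- (n + r + 2)) 0 (E_ r eps n).

Definition K_ (r : nat) (eps : R) : set R :=
  (J_ r `\` \bigcup_n E_ r eps n) `|` (\bigcup_n F_ r eps n)
  `|` (S1 r eps `|` S2 r eps `|` S3 r eps).

End TheSet.

(* Main.v *)
Require Import Defs.
From mathcomp Require Import all_boot all_order all_algebra.
From mathcomp Require Import complex.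
From mathcomp Require Import all_classical all_reals all_analysis measurable_realfun.
From mathcomp Require Import ring lra.
Import Order.TTheory GRing.Theory Num.Theory.
Import numFieldNormedType.Exports.

Set Implicit Arguments.
Unset Strict Implicit.
Unset Printing Implicit Defensive.

Local Open Scope classical_set_scope.
Local Open Scope ring_scope.

(** A function psi whose transform is the indicator of K has
  (psi_{j,k})^(xi) = 2^(-j/2) e^(-i k 2^(-j) xi) 1_K(2^(-j) xi), so the wavelet
  system is an orthonormal basis of H^2 as soon as K tiles twice: modulo 2 pi it
  covers [0, 2 pi) once, and its dilates 2^j K cover (0, oo) once.  The second
  tiling separates the scales; by the first one, the exponentials of one scale
  are a Fourier basis of [0, 2 pi) cut in two and moved.  This criterion is
  [tiling_hardy2_wavelet_set], stated for the union K of A and B + 2 pi m,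
  where A and B partition [0, 2 pi).

  The set K_{r,eps} is of this form up to countably many end points.  Let
  c = 2^(r+1) pi, t = t_r, and let U be the union of S_1 and all the F_n.  As
  E_0 = S_1 + c and E_{n+1} = F_n + c, the union of the E_n is U + c: what is
  removed from c + [0, t + 2 eps], the union of J_r and S_3, is the translate of
  what is put back near the origin.  Hence A is the union of U and S_2, and B is
  [0, t + 2 eps) without U.  For the dilations, each piece is moved into the
  octave [pi, 2 pi).  Since F_n is a dilate of E_n, the dilates of J_r without the E_n, together with the F_n, fill
  [pi, t]; those of S_3, S_1 and S_2 fill [t, t + eps / 2^r],
  [t + eps / 2^r, t + 2 eps] and [t + 2 eps, 2 pi] ([Koctave]).

  The transform on L^2 is handled through the squared norm, called the energy.
  Inserting the weight e^(-d |x|), whose transform is the Poisson kernel, into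
  the multiplication formula gives half of Plancherel's identity on L^1 cap L^2
  ([fourier_energy_le]).  The other half and the inversion formula hold for
  indicators of intervals, since their Poisson integrals are differences of
  arctangents ([plancherel_inv_itv]); a density argument extends them to
  functions of compact support ([plancherel_inv_compact]), and then Plancherel
  and Parseval to L^2 ([plancherel], [parseval]).

  For completeness of the exponentials on a bounded set, consider the bounded
  functions that multiply their closed span into itself.  They form an algebra
  which contains the trigonometric polynomials and is closed under bounded
  pointwise limits, hence contains the indicators of arcs, through Newton's
  iteration for the sign ([multiplier_pos], [exp_span_dense]).  Indicators of Borel
  sets follow by Dynkin's lemma and all of L^2 by simple functions ([cs_dense]). *)

(** * Integration of real functions on the line *)
Notation cRe := (@complex.Re _).
Notation cIm := (@complex.Im _).

Section RealIntegral.
Context {R : realType}.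
Local Notation mu := (@lebesgue_measure R).
Implicit Types f g h : R -> R.

Definition integrableR f : Prop := mu.-integrable setT (EFin \o f).
Definition integR f : R := \int[mu]_x f x.
Local Notation meas f := (measurable_fun [set: R] f).

Lemma meas_EFin f : meas f ->
  @measurable_fun _ _ (measurableTypeR R) _ setT (EFin \o f).
Proof. by move=> mf; apply/measurable_EFinP. Qed.

Lemma integrableR_meas f : integrableR f -> meas f.
Proof. by move=> /integrableP[/measurable_EFinP]. Qed.

Lemma integrableR_D f g : integrableR f -> integrableR g -> integrableR (fun x => f x + g x).
Proof. by move=> hf hg; exact: (integrableD measurableT hf hg). Qed.

Lemma integrableR_Z c f : integrableR f -> integrableR (fun x => c * f x).
Proof. by move=> hf; exact: (integrableZl measurableT c hf). Qed.

Lemma integrableR_N f : integrableR f -> integrableR (fun x => - f x).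
Proof. by move=> hf; exact: (integrableN hf). Qed.

Lemma integrableR_B f g : integrableR f -> integrableR g -> integrableR (fun x => f x - g x).
Proof. by move=> hf hg; exact: (integrableB measurableT hf hg). Qed.

Lemma integrableR_le f g : meas f -> (forall x, `|f x| <= g x) -> integrableR g -> integrableR f.
Proof.
move=> mf fg; apply: le_integrable => //; first exact/measurable_EFinP.
by move=> x _; rewrite /= lee_fin (le_trans (fg x))// ler_norm.
Qed.

Lemma integrableR_0 : integrableR (fun=> 0).
Proof. exact: integrable0. Qed.

Lemma integrableR_abs f : integrableR f -> integrableR (fun x => `|f x|).
Proof. by move=> /integrable_abse. Qed.

Lemma integrableR_bounded M f h : meas h -> (forall x, `|h x| <= M) ->
  integrableR f -> integrableR (fun x => f x * h x).
Proof.
move=> mh hM hf; have /integrableR_abs/(integrableR_Z M) hf' := hf.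
apply: integrableR_le hf'; first by apply: measurable_funM => //; exact: integrableR_meas.
by move=> x; rewrite normrM mulrC ler_wpM2r.
Qed.

Lemma integrableR_indic (A : set R) : measurable A -> (mu A < +oo)%E ->
  integrableR (\1_A : R -> R).
Proof. move=> mA fA; apply/integrableP; split.
  by apply/measurable_EFinP; exact: measurable_indic.
rewrite (@eq_integral _ _ _ mu setT (fun x => (\1_A x)%:E)).
  by rewrite integral_indic// setIT.
by move=> t _; rewrite /= ger0_norm. Qed.

Lemma integR_D f g : integrableR f -> integrableR g -> integR (fun x => f x + g x) = integR f + integR g.
Proof. exact: RintegralD. Qed.

Lemma integR_B f g : integrableR f -> integrableR g -> integR (fun x => f x - g x) = integR f - integR g.
Proof. exact: RintegralB. Qed.

Lemma integR_Z c f : integrableR f -> integR (fun x => c * f x) = c * integR f.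
Proof. exact: RintegralZl. Qed.

Lemma integR_N f : integrableR f -> integR (fun x => - f x) = - integR f.
Proof.
move=> hf; rewrite -mulN1r -integR_Z//; apply: eq_Rintegral => x _.
by rewrite mulN1r.
Qed.

Lemma integR_ge0 f : (forall x, 0 <= f x) -> 0 <= integR f.
Proof. by move=> f0; apply: Rintegral_ge0. Qed.

Lemma integR_le f g : integrableR f -> integrableR g -> (forall x, f x <= g x) -> integR f <= integR g.
Proof. by move=> hf hg fg; exact: le_Rintegral. Qed.

Lemma integR_abs_le f g : integrableR f -> integrableR g -> (forall x, `|f x| <= g x) ->
  `|integR f| <= integR g.
Proof.
move=> hf hg fg; apply: le_trans (le_normr_Rintegral measurableT hf) _.
by apply: integR_le => //; exact: integrableR_abs.
Qed.

Lemma integR_EFin f : integrableR f -> ((integR f)%:E = \int[mu]_x (f x)%:E)%E.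
Proof. by move=> hf; rewrite fineK//; exact: integrable_fin_num. Qed.

Lemma integrableR_ge0P f : meas f -> (forall x, 0 <= f x) ->
  integrableR f <-> (\int[mu]_x (f x)%:E < +oo)%E.
Proof.
move=> mf f0; split=> [/integrableP[_]|h].
  by congr (_ < _)%E; apply: eq_integral => x _ /=; rewrite ger0_norm.
apply/integrableP; split; first exact/measurable_EFinP.
move: h; congr (_ < _)%E; apply: eq_integral => x _ /=.
by rewrite ger0_norm.
Qed.

Lemma ae_imply (P Q : R -> Prop) : (forall x, P x -> Q x) ->
  {ae mu, forall x, P x} -> {ae mu, forall x, Q x}.
Proof.
by move=> PQ; apply: filterS => //; exact: (ae_filter_ringOfSetsType mu).
Qed.

Lemma ae_and (P Q : R -> Prop) : {ae mu, forall x, P x} ->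
  {ae mu, forall x, Q x} -> {ae mu, forall x, P x /\ Q x}.
Proof.
move=> hP hQ; rewrite /prop_near1 /nbhs /= /almost_everywhere.
have -> : ~` (fun x => P x /\ Q x) = ~` P `|` ~` Q by rewrite -setCI.
by apply: negligibleU; [exact: hP|exact: hQ].
Qed.

Lemma integR_ae f g : meas f -> integrableR g -> {ae mu, forall x, f x = g x} ->
  integrableR f /\ integR f = integR g.
Proof.
move=> mf hg fg.
have mg := integrableR_meas hg.
have E2 (phi : R -> \bar R) : measurable_fun [set: R] phi ->
    (\int[mu]_x phi (f x) = \int[mu]_x phi (g x))%E.
  move=> mphi; apply: ae_eq_integral => //.
  - exact: measurableT_comp.
  - exact: measurableT_comp.
  - by apply: (ae_imply _ fg) => x -> _.
split; last by rewrite /integR /Rintegral (E2 EFin)//; exact: measurable_EFin.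
apply/integrableP; split; first exact/measurable_EFinP.
have /integrableP[_] := hg.
by rewrite /= -(E2 (fun x => `|x%:E|)%E)//; apply: measurableT_comp.
Qed.

Lemma integR_dominated (f_ : nat -> R -> R) f g :
  (forall n, meas (f_ n)) -> meas f ->
  {ae mu, forall x, f_ ^~ x @ \oo --> f x} ->
  integrableR g -> (forall n x, `|f_ n x| <= g x) ->
  integrableR f /\ (fun n => integR (f_ n)) @ \oo --> integR f.
Proof.
move=> mf_ mf cf ig fg.
have Igf n : integrableR (f_ n) by apply: integrableR_le (fg n) ig.
have [] := @dominated_convergence _ _ _ mu setT measurableT
  (fun n => EFin \o f_ n) (EFin \o f) (EFin \o g) _ _ _ ig _.
- by move=> n; exact: meas_EFin.
- exact: meas_EFin.
- by apply: (ae_imply _ cf) => x cx _; apply: cvg_EFin => //; exact: nearW.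
- by apply/nearW => x n _ /=; rewrite lee_fin.
move=> If _ cv; split=> //.
apply: fine_cvg; rewrite fineK; last exact: integrable_fin_num.
exact: cv.
Qed.

(** Fatou's lemma in the shape used to bound the energy of a limit: the bound on
    the integrals has to hold eventually only. *)
Lemma integR_fatou (f_ : nat -> R -> R) f (B : R) :
  (forall n, integrableR (f_ n)) -> (forall n x, 0 <= f_ n x) -> meas f ->
  {ae mu, forall x, f_ ^~ x @ \oo --> f x} -> (forall x, 0 <= f x) ->
  (exists N, forall n, (N <= n)%N -> integR (f_ n) <= B) ->
  integrableR f /\ integR f <= B.
Proof.
move=> If_ f_0 mf cf f0 bB.
have mf_ n := integrableR_meas (If_ n).
have h : (\int[mu]_x (f x)%:E <= B%:E)%E.
  have -> : (\int[mu]_x (f x)%:E = \int[mu]_x limn_einf (fun n => (f_ n x)%:E))%E.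
    apply: ae_eq_integral => //.
    - exact/measurable_EFinP.
    - have -> : (fun x => limn_einf (fun n => (f_ n x)%:E)) =
          (fun x => - limn_esup (fun n => (- f_ n x)%:E))%E.
        apply/funext => x; rewrite -limn_einfN; congr limn_einf.
        by apply/funext => n /=; rewrite opprK.
      apply: measurableT_comp => //.
      apply: (@measurable_fun_limn_esup _ _ _ _ (fun n x => (- f_ n x)%:E)) => n.
      by apply: meas_EFin; apply: measurableT_comp.
    - apply: (ae_imply _ cf) => x cx _.
      have /cvg_limn_einf_sup[-> //] : (fun n => (f_ n x)%:E) @ \oo --> (f x)%:E.
      by apply: cvg_EFin => //; exact: nearW.
  apply: le_trans (fatou mu measurableT _ _) _.
  - by move=> n; exact: meas_EFin.
  - by move=> n x _; rewrite lee_fin.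
  have [N hN] := bB.
  rewrite limn_einf_lim; apply: lime_le.
    exact: is_cvg_einfs.
  exists N => // n /= Nn; apply: ereal_inf_le; exists (integR (f_ n))%:E.
    by exists n => //=; rewrite integR_EFin.
  by rewrite lee_fin; exact: hN.
have If : integrableR f by apply/integrableR_ge0P => //; apply: le_lt_trans h _; rewrite ltry.
by split=> //; rewrite -lee_fin integR_EFin.
Qed.

End RealIntegral.

(** * Complex-valued functions *)
Section ComplexBasics.
Context {R : realType}.
Local Notation C := R[i].
Local Notation mu := (@lebesgue_measure R).
Implicit Types (f g h : R -> C) (z w : C).

Definition sqmod z : R := complex.Re z ^+ 2 + complex.Im z ^+ 2.

Lemma complex_ext z w : cRe z = cRe w -> cIm z = cIm w -> z = w.
Proof. by case: z w => [a b] [c d] /= -> ->. Qed.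

Lemma cReD z w : cRe (z + w) = cRe z + cRe w. Proof. by case: z w => [a b] []. Qed.
Lemma cImD z w : cIm (z + w) = cIm z + cIm w. Proof. by case: z w => [a b] []. Qed.
Lemma cReN z : cRe (- z) = - cRe z. Proof. by case: z. Qed.
Lemma cImN z : cIm (- z) = - cIm z. Proof. by case: z. Qed.
Lemma cReM z w : cRe (z * w) = cRe z * cRe w - cIm z * cIm w.
Proof. by case: z w => [a b] []. Qed.
Lemma cImM z w : cIm (z * w) = cRe z * cIm w + cIm z * cRe w.
Proof. by case: z w => [a b] [c d]. Qed.
Lemma cReC (a : R) : cRe (a%:C)%C = a. Proof. by []. Qed.
Lemma cImC (a : R) : cIm (a%:C)%C = 0. Proof. by []. Qed.
Lemma cReJ z : cRe (conjc z) = cRe z. Proof. by case: z. Qed.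
Lemma cImJ z : cIm (conjc z) = - cIm z. Proof. by case: z. Qed.
Lemma cRee (t : R) : cRe (cexpi t) = cos t. Proof. by []. Qed.
Lemma cIme (t : R) : cIm (cexpi t) = sin t. Proof. by []. Qed.
Lemma cRe0 : cRe (0 : C) = 0. Proof. by []. Qed.
Lemma cIm0 : cIm (0 : C) = 0. Proof. by []. Qed.
Lemma cRe1 : cRe (1 : C) = 1. Proof. by []. Qed.
Lemma cIm1 : cIm (1 : C) = 0. Proof. by []. Qed.
Lemma Re_CI f : cRe (Cintegral f) = integR (fun x => cRe (f x)). Proof. by []. Qed.
Lemma Im_CI f : cIm (Cintegral f) = integR (fun x => cIm (f x)). Proof. by []. Qed.
(** Computes real and imaginary parts, which reduces identities between complex
    numbers to [ring] over the reals. *)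
Definition cReImE := (Re_CI, Im_CI, cReD, cImD, cReN, cImN, cReM, cImM, cReC, cImC, cReJ, cImJ, cRee, cIme,
  cRe0, cIm0, cRe1, cIm1).

Lemma sqmod_ge0 z : 0 <= sqmod z. Proof. by rewrite addr_ge0 ?sqr_ge0. Qed.
Lemma sqmodM z w : sqmod (z * w) = sqmod z * sqmod w.
Proof. rewrite /sqmod !cReImE; ring. Qed.
Lemma sqmodN z : sqmod (- z) = sqmod z. Proof. rewrite /sqmod !cReImE; ring. Qed.
Lemma sqmodJ z : sqmod (conjc z) = sqmod z. Proof. rewrite /sqmod !cReImE; ring. Qed.
Lemma sqmodR (a : R) : sqmod (a%:C)%C = a ^+ 2. Proof. rewrite /sqmod !cReImE; ring. Qed.
Lemma sqmod0 : sqmod 0 = 0. Proof. rewrite /sqmod !cReImE; ring. Qed.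
Lemma sqmode (t : R) : sqmod (cexpi t) = 1.
Proof. by rewrite /sqmod !cReImE cos2Dsin2. Qed.
Lemma sqmodD z w : sqmod (z + w) <= 2 * sqmod z + 2 * sqmod w.
Proof.
rewrite /sqmod !cReImE.
have := sqr_ge0 (cRe z - cRe w); have := sqr_ge0 (cIm z - cIm w); nra.
Qed.
Lemma sqmod_parallelogram z w :
  sqmod (z + w) + sqmod (z - w) = 2 * sqmod z + 2 * sqmod w.
Proof. rewrite /sqmod !cReImE; ring. Qed.
Lemma sqmod_Re z : cRe z ^+ 2 <= sqmod z.
Proof. by rewrite lerDl sqr_ge0. Qed.
Lemma sqmod_Im z : cIm z ^+ 2 <= sqmod z.
Proof. by rewrite lerDr sqr_ge0. Qed.

Lemma cexpiD (s t : R) : cexpi (s + t) = cexpi s * cexpi t.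
Proof. by apply: complex_ext; rewrite !cReImE ?cosD ?sinD; ring. Qed.
Lemma cexpiN (t : R) : cexpi (- t) = conjc (cexpi t).
Proof. by apply: complex_ext; rewrite !cReImE ?cosN ?sinN. Qed.
Lemma cexpi0 : cexpi 0 = 1 :> C.
Proof. by apply: complex_ext; rewrite !cReImE ?cos0 ?sin0. Qed.

Lemma cmodE z : cmod z = Num.sqrt (sqmod z).
Proof. by case: z. Qed.
Lemma cmod_sq z : cmod z ^+ 2 = sqmod z.
Proof. by rewrite cmodE sqr_sqrtr// sqmod_ge0. Qed.
Lemma cmod_ge0 z : 0 <= cmod z.
Proof. by rewrite cmodE sqrtr_ge0. Qed.
Lemma Re_le_cmod z : `|cRe z| <= cmod z.
Proof. by rewrite -sqrtr_sqr cmodE ler_wsqrtr// sqmod_Re. Qed.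
Lemma Im_le_cmod z : `|cIm z| <= cmod z.
Proof. by rewrite -sqrtr_sqr cmodE ler_wsqrtr// sqmod_Im. Qed.
Lemma cmod_le z : cmod z <= `|cRe z| + `|cIm z|.
Proof.
rewrite -(ler_pXn2r (n:=2))// ?nnegrE ?cmod_ge0 ?addr_ge0// cmod_sq /sqmod.
rewrite -[_ ^+ 2 in leLHS]real_normK ?num_real//.
rewrite -[X in _ + X <= _]real_normK ?num_real//.
by rewrite sqrrD -addrA lerD2l ler_wpDl// ?mulrn_wge0// mulr_ge0.
Qed.

Local Notation meas f := (measurable_fun [set: R] f).

Lemma Cmeas_ext f g : f =1 g -> Cmeasurable f -> Cmeasurable g.
Proof. by move=> /funext ->. Qed.

Lemma CmeasD f g : Cmeasurable f -> Cmeasurable g ->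
  Cmeasurable (fun x => f x + g x).
Proof.
move=> [f1 f2] [g1 g2]; split.
- under eq_fun do rewrite cReD; exact: measurable_funD.
- under eq_fun do rewrite cImD; exact: measurable_funD.
Qed.

Lemma CmeasN f : Cmeasurable f -> Cmeasurable (fun x => - f x).
Proof.
move=> [f1 f2]; split.
- under eq_fun do rewrite cReN; exact: measurableT_comp.
- under eq_fun do rewrite cImN; exact: measurableT_comp.
Qed.

Lemma CmeasM f g : Cmeasurable f -> Cmeasurable g ->
  Cmeasurable (fun x => f x * g x).
Proof.
move=> [f1 f2] [g1 g2]; split.
- under eq_fun do rewrite cReM.
  by apply: measurable_funB; exact: measurable_funM.
- under eq_fun do rewrite cImM.
  by apply: measurable_funD; exact: measurable_funM.
Qed.

Lemma CmeasJ f : Cmeasurable f -> Cmeasurable (fun x => conjc (f x)).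
Proof.
move=> [f1 f2]; split.
- by under eq_fun do rewrite cReJ.
- under eq_fun do rewrite cImJ; exact: measurableT_comp.
Qed.

Lemma CmeasR (f : R -> R) : meas f -> Cmeasurable (fun x => (f x)%:C%C).
Proof. by move=> mf; split => //=; exact: measurable_cst. Qed.

Lemma Cmeas_cst z : Cmeasurable (fun=> z).
Proof. by split; exact: measurable_cst. Qed.

Lemma meas_sin : meas (@sin R).
Proof. by apply: continuous_measurable_fun; exact: continuous_sin. Qed.
Lemma meas_cos : meas (@cos R).
Proof. by apply: continuous_measurable_fun; exact: continuous_cos. Qed.

Lemma Cmeas_expi (h : R -> R) : meas h -> Cmeasurable (fun x => cexpi (h x)).
Proof.
move=> mh; split => /=; first by apply: measurableT_comp mh; exact: meas_cos.
by apply: measurableT_comp mh; exact: meas_sin.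
Qed.

Lemma meas_sqmod f : Cmeasurable f -> meas (fun x => sqmod (f x)).
Proof.
move=> [f1 f2]; apply: measurable_funD.
- exact: (measurable_funX 2 f1).
- exact: (measurable_funX 2 f2).
Qed.

Lemma meas_cmod f : Cmeasurable f -> meas (fun x => cmod (f x)).
Proof.
move=> mf; rewrite (_ : (fun x => _) = Num.sqrt \o (fun x => sqmod (f x))).
  2: by apply/funext => x; rewrite cmodE.
have ms : meas (@Num.sqrt R).
  by apply: continuous_measurable_fun; exact: (@sqrt_continuous R).
by apply: measurableT_comp; [exact: ms|exact: meas_sqmod].
Qed.

Lemma meas_indic (A : set R) : measurable A -> meas (\1_A : R -> R).
Proof. by move=> mA; exact: measurable_indic. Qed.

Definition cind (A : set R) (x : R) : C := (\1_A x)%:C%C.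

Lemma Cmeas_ind A : measurable A -> Cmeasurable (cind A).
Proof. by move=> mA; apply: CmeasR; exact: meas_indic. Qed.

End ComplexBasics.

(** * Integrable and square-integrable functions *)
Section LSpaces.
Context {R : realType}.
Local Notation C := R[i].
Local Notation mu := (@lebesgue_measure R).
Local Notation meas f := (measurable_fun [set: R] f).
Implicit Types (f g h : R -> C) (z w : C).

(** Componentwise integrability amounts to integrability of the modulus
    ([L1P]) and is what the rules for real integrals produce. *)
Definition L1 f := integrableR (fun x => cRe (f x)) /\ integrableR (fun x => cIm (f x)).
Definition L2 f := Cmeasurable f /\ integrableR (fun x => sqmod (f x)).
(** The square of the L^2 norm.  It avoids square roots, at the price of a
    factor 2 in the triangle inequality ([energyD], [energyB_tri]). *)
Definition energy f : R := integR (fun x => sqmod (f x)).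

Lemma L1_meas f : L1 f -> Cmeasurable f.
Proof. by move=> [/integrableR_meas ? /integrableR_meas]. Qed.

Lemma L1P f : L1 f <-> Cmeasurable f /\ integrableR (fun x => cmod (f x)).
Proof.
split=> [lf|[mf If]].
  have mf := L1_meas lf; split=> //; have [If1 If2] := lf.
  apply: integrableR_le (integrableR_D (integrableR_abs If1) (integrableR_abs If2)); first exact: meas_cmod.
  by move=> x; rewrite ger0_norm ?cmod_ge0 ?cmod_le.
split; apply: integrableR_le If; [exact: mf.1| |exact: mf.2|] => x.
- exact: Re_le_cmod.
- exact: Im_le_cmod.
Qed.

Lemma L1_cmod f : L1 f -> integrableR (fun x => cmod (f x)).
Proof. by move=> /L1P[]. Qed.

Lemma CLp1P f : CLp 1%:E f <-> L1 f.
Proof.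
have e : Cmeasurable f ->
    integrableR (fun x => cmod (f x)) <-> (CLnorm 1%:E f < +oo)%E.
  move=> mf; rewrite /CLnorm Lnorm1 integrableR_ge0P; last 2 first.
  - exact: meas_cmod.
  - by move=> x; exact: cmod_ge0.
  rewrite (@eq_integral _ _ _ mu setT (fun x => (cmod (f x))%:E))//.
  by move=> x _ /=; rewrite ger0_norm ?cmod_ge0.
by rewrite L1P; split=> -[mf h]; split=> //; apply/e.
Qed.

Lemma CLnorm2E f : CLnorm 2%:E f =
  ((\int[mu]_x (sqmod (f x))%:E) `^ 2^-1)%E.
Proof.
rewrite /CLnorm unlock /=; congr (_ `^ _)%E; apply: eq_integral => x _.
by rewrite /= ger0_norm ?cmod_ge0// powR_mulrn ?cmod_ge0// cmod_sq.
Qed.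

Lemma CLp2P f : CLp 2%:E f <-> L2 f.
Proof.
have e : Cmeasurable f ->
    integrableR (fun x => sqmod (f x)) <-> (CLnorm 2%:E f < +oo)%E.
  move=> mf; rewrite CLnorm2E integrableR_ge0P; last 2 first.
  - exact: meas_sqmod.
  - by move=> x; exact: sqmod_ge0.
  have : (0 <= \int[mu]_x (sqmod (f x))%:E)%E.
    by apply: integral_ge0 => x _; rewrite lee_fin sqmod_ge0.
  case: (\int[mu]_x _)%E => [r|//|//] _ /=; first by rewrite !ltry.
  by rewrite (_ : (_ == _) = false)//; apply/negbTE; rewrite invr_eq0 pnatr_eq0.
by split=> -[mf h]; split=> //; apply/e.
Qed.

Lemma CLnorm2_energy f : L2 f -> CLnorm 2%:E f = (Num.sqrt (energy f))%:E.
Proof.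
move=> [mf If]; rewrite CLnorm2E -(integR_EFin If) poweR_EFin.
by rewrite powR12_sqrt// integR_ge0// => x; exact: sqmod_ge0.
Qed.

Lemma L1D f g : L1 f -> L1 g -> L1 (fun x => f x + g x).
Proof.
move=> [f1 f2] [g1 g2]; split.
- under eq_fun do rewrite cReD; exact: integrableR_D.
- under eq_fun do rewrite cImD; exact: integrableR_D.
Qed.

Lemma L1_bM M f h : Cmeasurable h -> (forall x, sqmod (h x) <= M) -> L1 f ->
  L1 (fun x => f x * h x).
Proof.
move=> mh hM lf; apply/L1P; split; first by apply: CmeasM => //; exact: L1_meas.
apply: integrableR_le (integrableR_Z (Num.sqrt M) (L1_cmod lf)).
  by apply: meas_cmod; apply: CmeasM => //; exact: L1_meas.
move=> x; rewrite ger0_norm ?cmod_ge0// !cmodE sqmodM sqrtrM ?sqmod_ge0// mulrC.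
by rewrite ler_wpM2r ?sqrtr_ge0// ler_wsqrtr.
Qed.

Lemma L1Z z f : L1 f -> L1 (fun x => z * f x).
Proof.
move=> lf; under eq_fun do rewrite mulrC.
by apply: (@L1_bM (sqmod z)) => //; exact: Cmeas_cst.
Qed.

Lemma L1N f : L1 f -> L1 (fun x => - f x).
Proof. by move=> /(L1Z (-1)); under eq_fun do rewrite mulN1r. Qed.

Lemma L1B f g : L1 f -> L1 g -> L1 (fun x => f x - g x).
Proof. by move=> lf lg; apply: L1D => //; exact: L1N. Qed.

Lemma L1J f : L1 f -> L1 (fun x => conjc (f x)).
Proof.
move=> [f1 f2]; split.
- by under eq_fun do rewrite cReJ.
- under eq_fun do rewrite cImJ; exact: integrableR_N.
Qed.

Lemma L1_ae f g : Cmeasurable f -> L1 g -> {ae mu, forall x, f x = g x} ->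
  L1 f /\ Cintegral f = Cintegral g.
Proof.
move=> [mf1 mf2] [g1 g2] fg.
have [e1 e2] := integR_ae mf1 g1 (ae_imply (fun x (h : f x = g x) => congr1 _ h) fg).
have [e3 e4] := integR_ae mf2 g2 (ae_imply (fun x (h : f x = g x) => congr1 _ h) fg).
by split=> //; congr Complex.
Qed.

Lemma L2D f g : L2 f -> L2 g -> L2 (fun x => f x + g x).
Proof.
move=> [mf f2] [mg g2]; have mfg := CmeasD mf mg; split=> //.
apply: integrableR_le (integrableR_D (integrableR_Z 2 f2) (integrableR_Z 2 g2)); first exact: meas_sqmod.
by move=> x; rewrite ger0_norm ?sqmod_ge0// sqmodD.
Qed.

Lemma L2_bM M f h : Cmeasurable h -> (forall x, sqmod (h x) <= M) -> L2 f ->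
  L2 (fun x => h x * f x).
Proof.
move=> mh hM [mf f2]; have mfh := CmeasM mh mf; split=> //.
apply: integrableR_le (integrableR_Z M f2); first exact: meas_sqmod.
by move=> x; rewrite ger0_norm ?sqmod_ge0// sqmodM ler_wpM2r ?sqmod_ge0.
Qed.

Lemma L2Z z f : L2 f -> L2 (fun x => z * f x).
Proof. by move=> lf; apply: (@L2_bM (sqmod z)) => //; exact: Cmeas_cst. Qed.

Lemma L2N f : L2 f -> L2 (fun x => - f x).
Proof. by move=> /(L2Z (-1)); under eq_fun do rewrite mulN1r. Qed.

Lemma L2B f g : L2 f -> L2 g -> L2 (fun x => f x - g x).
Proof. by move=> lf lg; apply: L2D => //; exact: L2N. Qed.

Lemma L2_0 : L2 (fun=> 0).
Proof.
split; first exact: Cmeas_cst.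
by under eq_fun do rewrite sqmod0; exact: integrableR_0.
Qed.

Lemma L2_sum (I : Type) (s : seq I) (F : I -> R -> C) :
  (forall i, L2 (F i)) -> L2 (fun x => \sum_(i <- s) F i x).
Proof.
move=> lF; elim: s => [|i s IH].
  by under eq_fun do rewrite big_nil; exact: L2_0.
by under eq_fun do rewrite big_cons; exact: L2D.
Qed.

Lemma L2J f : L2 f -> L2 (fun x => conjc (f x)).
Proof.
move=> [mf f2]; split; first exact: CmeasJ.
by under eq_fun do rewrite sqmodJ.
Qed.

Lemma cmodM_le z w : cmod (z * w) <= sqmod z + sqmod w.
Proof.
rewrite -(ler_pXn2r (n:=2))// ?nnegrE ?cmod_ge0 ?(addr_ge0 (sqmod_ge0 _) (sqmod_ge0 _))//.
rewrite cmod_sq sqmodM sqrrD -mulr_natl.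
have := sqmod_ge0 z; have := sqmod_ge0 w.
move: (sqmod z) (sqmod w) => a b a0 b0.
have := mulr_ge0 a0 b0; have := sqr_ge0 a; have := sqr_ge0 b; lra.
Qed.

Lemma L2M_L1 f g : L2 f -> L2 g -> L1 (fun x => f x * g x).
Proof.
move=> [mf f2] [mg g2]; apply/L1P; split; first exact: CmeasM.
apply: integrableR_le (integrableR_D f2 g2); first by apply: meas_cmod; exact: CmeasM.
by move=> x; rewrite ger0_norm ?cmod_ge0// cmodM_le.
Qed.

Lemma L2_ind A : measurable A -> (mu A < +oo)%E -> L2 (cind A).
Proof.
move=> mA fA; split; first exact: Cmeas_ind.
rewrite (_ : (fun _ => _) = (\1_A : R -> R)); first exact: integrableR_indic.
by apply/funext => x; rewrite sqmodR indicE; case: (_ \in _); rewrite ?expr1n ?expr0n.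
Qed.

Lemma sqmod_cind (A : set R) x : sqmod (cind A x) <= 1.
Proof.
by rewrite sqmodR indicE; case: (_ \in _); rewrite ?expr1n ?expr0n.
Qed.

Lemma L2_supp_L1 f A : measurable A -> (mu A < +oo)%E ->
  (forall x, ~ A x -> f x = 0) -> L2 f -> L1 f.
Proof.
move=> mA fA fA0 lf.
rewrite (_ : f = fun x => f x * cind A x).
  by apply: L2M_L1 => //; exact: L2_ind.
apply/funext => x; rewrite /cind indicE; case: (boolP (x \in A)) => xA.
  by rewrite mulr1.
by rewrite fA0 ?mul0r//; move: xA; rewrite notin_setE.
Qed.

Lemma energy_ge0 f : 0 <= energy f.
Proof. by apply: integR_ge0 => x; exact: sqmod_ge0. Qed.

Lemma energyD f g : L2 f -> L2 g -> energy (fun x => f x + g x) <= 2 * energy f + 2 * energy g.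
Proof.
move=> lf lg; have [_ lfg] := L2D lf lg; have [_ f2] := lf; have [_ g2] := lg.
rewrite /energy -!integR_Z// -integR_D; [|exact: integrableR_Z..].
by apply: integR_le => // [|x]; [apply: integrableR_D; exact: integrableR_Z|exact: sqmodD].
Qed.

Lemma energy_bM M f h : Cmeasurable h -> (forall x, sqmod (h x) <= M) -> L2 f ->
  energy (fun x => h x * f x) <= M * energy f.
Proof.
move=> mh hM lf; have [_ lfh] := L2_bM mh hM lf; have [_ f2] := lf.
rewrite /energy -integR_Z//; apply: integR_le => // [|x]; first exact: integrableR_Z.
by rewrite sqmodM ler_wpM2r ?sqmod_ge0.
Qed.

Lemma energyZ z f : L2 f -> energy (fun x => z * f x) = sqmod z * energy f.
Proof.
move=> [_ f2]; rewrite /energy -integR_Z//; apply: eq_Rintegral => x _.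
by rewrite sqmodM.
Qed.

Lemma energyBC f g : energy (fun x => f x - g x) = energy (fun x => g x - f x).
Proof. by apply: eq_Rintegral => x _; rewrite -sqmodN opprB. Qed.

Lemma energyB_tri g f h : L2 f -> L2 g -> L2 h ->
  energy (fun x => f x - h x) <=
    2 * energy (fun x => f x - g x) + 2 * energy (fun x => g x - h x).
Proof.
move=> lf lg lh; have := energyD (L2B lf lg) (L2B lg lh).
by under [X in energy X <= _ -> _]eq_fun do rewrite addrA subrK.
Qed.

Lemma energy0 : energy (fun=> 0) = 0.
Proof.
by rewrite /energy; under eq_fun do rewrite sqmod0; rewrite /integR Rintegral_cst// mul0r.
Qed.

Lemma energy_ae f g : Cmeasurable f -> L2 g -> {ae mu, forall x, f x = g x} ->
  L2 f /\ energy f = energy g.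
Proof.
move=> mf [mg g2] fg.
have [e1 e2] := integR_ae (meas_sqmod mf) g2 (ae_imply (fun x (h : f x = g x) => congr1 sqmod h) fg).
by split.
Qed.

(** With this identity the defect in Plancherel's inequality is shown to be a
    quadratic form, and inner products are recovered from energies. *)
Lemma energy_parallelogram f g : L2 f -> L2 g ->
  energy (fun x => f x + g x) + energy (fun x => f x - g x) = 2 * energy f + 2 * energy g.
Proof.
move=> lf lg; have [_ l1] := L2D lf lg; have [_ l2] := L2B lf lg.
have [_ f2] := lf; have [_ g2] := lg.
rewrite /energy -integR_D// -!integR_Z// -integR_D; [|exact: integrableR_Z..].
by apply: eq_Rintegral => x _; rewrite sqmod_parallelogram.
Qed.

Lemma energy_dominated (u : nat -> R -> C) f (G : R -> R) :
  (forall n, Cmeasurable (u n)) -> Cmeasurable f ->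
  {ae mu, forall x, (fun n => sqmod (u n x - f x)) @ \oo --> (0 : R)} ->
  integrableR G -> (forall n x, sqmod (u n x - f x) <= G x) ->
  (fun n => energy (fun x => u n x - f x)) @ \oo --> (0 : R).
Proof.
move=> mu_ mf cv iG uG.
have [|||//||_] := @integR_dominated _ (fun n x => sqmod (u n x - f x)) (fun=> 0) G.
- by move=> n; apply: meas_sqmod; apply: CmeasD => //; exact: CmeasN.
- exact: measurable_cst.
- exact: cv.
- by move=> n x; rewrite ger0_norm ?sqmod_ge0.
by rewrite {2}/integR Rintegral_cst// mul0r.
Qed.

Lemma CL2cvgP (u : nat -> R -> C) f : (forall n, L2 (fun x => u n x - f x)) ->
  CL2cvg u f <-> (fun n => energy (fun x => u n x - f x)) @ \oo --> (0 : R).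
Proof.
move=> lu; rewrite /CL2cvg.
rewrite (_ : (fun n => _) =
    EFin \o (fun n => Num.sqrt (energy (fun x => u n x - f x)))); last first.
  by apply/funext => n; rewrite /= CLnorm2_energy.
split=> [h|h].
  have {}h : (fun n => Num.sqrt (energy (fun x => u n x - f x))) @ \oo --> (0 : R).
    by move/fine_cvgP : h => [].
  have := cvgM h h; rewrite mulr0; move/(_ _).
  rewrite (_ : _ \* _ = fun n => energy (fun x => u n x - f x)); first exact.
  by apply/funext => n /=; rewrite -expr2 sqr_sqrtr ?energy_ge0.
apply: cvg_EFin; first exact: nearW.
rewrite -[X in _ --> X]sqrtr0.
by apply: continuous_cvg => //; exact: sqrt_continuous.
Qed.

Lemma CI_D f g : L1 f -> L1 g ->
  Cintegral (fun x => f x + g x) = Cintegral f + Cintegral g.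
Proof.
move=> [f1 f2] [g1 g2]; apply: complex_ext; rewrite !cReImE ?Re_CI ?Im_CI.
- by under eq_fun do rewrite cReD; exact: integR_D.
- by under eq_fun do rewrite cImD; exact: integR_D.
Qed.

Lemma CI_Z z f : L1 f -> Cintegral (fun x => z * f x) = z * Cintegral f.
Proof.
move=> [f1 f2]; apply: complex_ext; rewrite !cReImE.
- transitivity (integR (fun x => cRe z * cRe (f x) - cIm z * cIm (f x))).
    by congr integR; apply/funext => x; rewrite cReM.
  by rewrite integR_B ?integR_Z//; exact: integrableR_Z.
- transitivity (integR (fun x => cRe z * cIm (f x) + cIm z * cRe (f x))).
    by congr integR; apply/funext => x; rewrite cImM.
  by rewrite integR_D ?integR_Z//; exact: integrableR_Z.
Qed.

Lemma CI_J f : L1 f -> Cintegral (fun x => conjc (f x)) = conjc (Cintegral f).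
Proof.
move=> [f1 f2]; apply: complex_ext; rewrite !cReImE ?Re_CI ?Im_CI.
- by under eq_fun do rewrite cReJ.
- under eq_fun do rewrite cImJ; exact: integR_N.
Qed.

Lemma CI_bound f : L1 f -> sqmod (Cintegral f) <= 2 * integR (fun x => cmod (f x)) ^+ 2.
Proof.
move=> lf; have /L1P[mf If] := lf; have [f1 f2] := lf.
have h1 : `|cRe (Cintegral f)| <= integR (fun x => cmod (f x)).
  by apply: integR_abs_le => // x; exact: Re_le_cmod.
have h2 : `|cIm (Cintegral f)| <= integR (fun x => cmod (f x)).
  by apply: integR_abs_le => // x; exact: Im_le_cmod.
have := sqmod_ge0 (Cintegral f); rewrite /sqmod => _.
rewrite -[cRe _ ^+ 2]real_normK ?num_real// -[cIm _ ^+ 2]real_normK ?num_real//.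
rewrite mulr_natl mulr2n lerD// ler_pXn2r// ?nnegrE//.
- by apply: integR_ge0 => x; exact: cmod_ge0.
- by apply: integR_ge0 => x; exact: cmod_ge0.
Qed.

End LSpaces.

(** * Fubini's theorem and affine changes of variable *)
Section Fubini.
Context {R : realType}.
Local Notation C := R[i].
Local Notation mu := (@lebesgue_measure R).
Local Notation meas f := (measurable_fun [set: R] f).
Local Notation meas2 f := (measurable_fun [set: R * R] f).

(** Joint integrability is replaced by a bound, integrable in [y], of the inner
    integral of the modulus; by Tonelli the bound implies it. *)
Lemma integR_fubini (F : R * R -> R) (G : R -> R) : meas2 F ->
  (forall x, integrableR (fun y => F (x, y))) -> (forall y, integrableR (fun x => F (x, y))) ->
  integrableR G -> (forall y, integR (fun x => `|F (x, y)|) <= G y) ->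
  [/\ integrableR (fun x => integR (fun y => F (x, y))),
      integrableR (fun y => integR (fun x => F (x, y))) &
      integR (fun x => integR (fun y => F (x, y))) = integR (fun y => integR (fun x => F (x, y)))].
Proof.
move=> mF i1 i2 iG FG.
have mF' : @measurable_fun _ _ (measurableTypeR R * measurableTypeR R)%type _
    setT (EFin \o F).
  by apply/measurable_EFinP.
have mFa : @measurable_fun _ _ (measurableTypeR R * measurableTypeR R)%type _
    setT (abse \o (EFin \o F)).
  by apply: measurableT_comp.
have iF : (mu \x mu)%E.-integrable setT (EFin \o F).
  apply/(integrable21ltyP mu mu mF').
  have /integrableP[_] := iG; apply: le_lt_trans.
  apply: ge0_le_integral => //.
  - by move=> y _; exact: integral_ge0.
  - exact: (measurable_fun_fubini_tonelli_G _ mFa (fun x => abse_ge0 _)).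
  - by apply: meas_EFin; apply: measurableT_comp => //; exact: integrableR_meas.
  - move=> y _; rewrite -[leLHS](integR_EFin (integrableR_abs (i2 y))) lee_fin.
    by apply: le_trans (FG y) _; exact: ler_norm.
have e1 : (fun x => (integR (fun y => F (x, y)))%:E) = fubini_F mu (EFin \o F).
  by apply/funext => x; rewrite integR_EFin.
have e2 : (fun y => (integR (fun x => F (x, y)))%:E) = fubini_G mu (EFin \o F).
  by apply/funext => y; rewrite integR_EFin.
have I1 : integrableR (fun x => integR (fun y => F (x, y))).
  by rewrite /integrableR /comp e1; exact: integrable_fubini_F.
have I2 : integrableR (fun y => integR (fun x => F (x, y))).
  rewrite /integrableR /comp e2.
  apply/integrableP; split; first exact: (measurable_fubini_G iF).
  have /integrableP[_] := iG; apply: le_lt_trans.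
  apply: ge0_le_integral => //.
  - by apply: measurableT_comp => //; exact: (measurable_fubini_G iF).
  - by apply: meas_EFin; apply: measurableT_comp => //; exact: integrableR_meas.
  - move=> y _; rewrite -[X in `|X y|%E]e2 /= lee_fin.
    apply: (le_trans (le_normr_Rintegral measurableT (i2 y))).
    by apply: le_trans (FG y) _; exact: ler_norm.
split; [exact: I1|exact: I2|apply: EFin_inj; rewrite (integR_EFin I1) (integR_EFin I2)].
transitivity (\int[mu]_x fubini_F mu (EFin \o F) x)%E.
  by apply: eq_integral => x _; rewrite -e1.
rewrite (integral12_prod_meas1 iF) -(integral21_prod_meas1 iF).
by apply: eq_integral => x _; exact: (esym (congr1 (fun h : R -> \bar R => h x) e2)).
Qed.

Definition Cmeas2 (F : R * R -> C) :=
  meas2 (fun z => cRe (F z)) /\ meas2 (fun z => cIm (F z)).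

Lemma CI_fubini (F : R * R -> C) (G : R -> R) : Cmeas2 F ->
  (forall x, L1 (fun y => F (x, y))) -> (forall y, L1 (fun x => F (x, y))) ->
  integrableR G -> (forall y, integR (fun x => cmod (F (x, y))) <= G y) ->
  [/\ L1 (fun x => Cintegral (fun y => F (x, y))),
      L1 (fun y => Cintegral (fun x => F (x, y))) &
      Cintegral (fun x => Cintegral (fun y => F (x, y))) =
      Cintegral (fun y => Cintegral (fun x => F (x, y)))].
Proof.
move=> [mF1 mF2] i1 i2 iG FG.
have [|||r1 r2 r3] := @integR_fubini (fun z => cRe (F z)) G mF1 _ _ iG.
- by move=> x; case: (i1 x).
- by move=> y; case: (i2 y).
- move=> y; apply: le_trans (FG y); apply: integR_le.
  + by apply: integrableR_abs; case: (i2 y).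
  + exact: L1_cmod.
  + by move=> x; exact: Re_le_cmod.
have [|||s1 s2 s3] := @integR_fubini (fun z => cIm (F z)) G mF2 _ _ iG.
- by move=> x; case: (i1 x).
- by move=> y; case: (i2 y).
- move=> y; apply: le_trans (FG y); apply: integR_le.
  + by apply: integrableR_abs; case: (i2 y).
  + exact: L1_cmod.
  + by move=> x; exact: Im_le_cmod.
by split; [split|split|apply: complex_ext; [exact: r3|exact: s3]].
Qed.

Lemma Cmeas2_fst (f : R -> C) : Cmeasurable f -> Cmeas2 (fun z => f z.1).
Proof.
by move=> [m1 m2]; split; [exact: (measurableT_comp m1)|exact: (measurableT_comp m2)].
Qed.
Lemma Cmeas2_snd (f : R -> C) : Cmeasurable f -> Cmeas2 (fun z => f z.2).
Proof.
by move=> [m1 m2]; split; [exact: (measurableT_comp m1)|exact: (measurableT_comp m2)].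
Qed.
Lemma Cmeas2_expi (h : R * R -> R) : meas2 h -> Cmeas2 (fun z => cexpi (h z)).
Proof.
move=> mh; split => /=; first by apply: measurableT_comp mh; exact: meas_cos.
by apply: measurableT_comp mh; exact: meas_sin.
Qed.
Lemma Cmeas2M F G : Cmeas2 F -> Cmeas2 G -> Cmeas2 (fun z => F z * G z).
Proof.
move=> [f1 f2] [g1 g2]; split.
- rewrite (_ : (fun z => _) = fun z => cRe (F z) * cRe (G z) - cIm (F z) * cIm (G z)).
    by apply: measurable_funB; exact: measurable_funM.
  by apply/funext => z; rewrite cReM.
- rewrite (_ : (fun z => _) = fun z => cRe (F z) * cIm (G z) + cIm (F z) * cRe (G z)).
    by apply: measurable_funD; exact: measurable_funM.
  by apply/funext => z; rewrite cImM.
Qed.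
End Fubini.

Section Affine.
Context {R : realType}.
Local Notation C := R[i].
Local Notation mu := (@lebesgue_measure R).
Local Notation meas f := (measurable_fun [set: R] f).

Definition affine (c a : R) (x : R) : R := c * x + a.

Lemma meas_affine c a : meas (affine c a).
Proof.
apply: measurable_funD; last exact: measurable_cst.
by apply: measurable_funM; [exact: measurable_cst|exact: measurable_id].
Qed.

(** After multiplication by [`|c|] the left-hand side is a measure in [A], and it is
    determined by its values on half-open intervals. *)
Lemma lebesgue_affine c a (A : set R) : c != 0 -> measurable A ->
  mu (affine c a @^-1` A) = ((`|c|^-1)%:E * mu A)%E.
Proof.
move=> c0 mA.
have c1 : 0 < `|c| by rewrite normr_gt0.
have maff : @measurable_fun _ _ (measurableTypeR R) (measurableTypeR R) setT (affine c a).
  exact: meas_affine.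
pose m := mscale (NngNum (ltW c1))
  (measure_function_pushforward__canonical__measure_function_Measure mu maff).
have h (X : set R) : ocitv X -> mu X = m X.
  case=> -[x y] /= xy <-; rewrite /m /mscale /= /pushforward.
  have [cp|cn] := ltP 0 c.
    have -> : affine c a @^-1` `]x, y]%classic = `](x - a) / c, (y - a) / c]%classic.
      apply/seteqP; split => z /=; rewrite /affine !in_itv /=.
        by rewrite ltr_pdivrMr// ler_pdivlMr// ltrBlDr lerBrDr mulrC.
      by rewrite ltr_pdivrMr// ler_pdivlMr// ltrBlDr lerBrDr mulrC.
    rewrite !lebesgue_measure_itv /= !lte_fin ltr_pM2r ?invr_gt0// ltrD2r.
    case: ifPn => _; last by rewrite mule0.
    rewrite -!EFinB -EFinM gtr0_norm//; congr EFin; by field.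
  have {}cn : c < 0 by rewrite lt_neqAle c0.
  have -> : affine c a @^-1` `]x, y]%classic = `[(y - a) / c, (x - a) / c[%classic.
    apply/seteqP; split => z /=; rewrite /affine !in_itv /=.
      by rewrite ltr_ndivlMr// ler_ndivrMr// ltrBlDr lerBrDr mulrC andbC.
    by rewrite ltr_ndivlMr// ler_ndivrMr// ltrBlDr lerBrDr mulrC andbC.
  rewrite !lebesgue_measure_itv /= !lte_fin ltr_nM2r ?invr_lt0// ltrD2r.
  case: ifPn => _; last by rewrite mule0.
  rewrite -!EFinB -EFinM ltr0_norm//; congr EFin; by field.
have -> : mu A = m A by exact: lebesgue_measure_unique h A mA.
rewrite /m /mscale /= /pushforward muleA -EFinM mulVf ?mul1e//.
by rewrite gt_eqF.
Qed.

Lemma integrableR_affine c a (f : R -> R) : c != 0 -> integrableR f ->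
  integrableR (fun x => f (affine c a x)) /\ integR (fun x => f (affine c a x)) = `|c|^-1 * integR f.
Proof.
move=> c0 If.
have c1 : 0 < `|c|^-1 by rewrite invr_gt0 normr_gt0.
have maff : @measurable_fun _ _ (measurableTypeR R) (measurableTypeR R) setT (affine c a).
  exact: meas_affine.
pose m := mscale (NngNum (ltW c1)) mu.
pose pm := measure_function_pushforward__canonical__measure_function_Measure mu maff.
have e0 (g : R -> \bar R) : @measurable_fun _ _ (measurableTypeR R) _ setT g ->
    (forall x, 0 <= g x)%E ->
    (\int[mu]_x g (affine c a x) = (`|c|^-1)%:E * \int[mu]_x g x)%E.
  move=> mg g0.
  have := @ge0_integral_pushforward _ _ _ _ _ _ maff mu setT g measurableT mg
    (fun x _ => g0 x).
  rewrite preimage_setT => <-.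
  rewrite (@eq_measure_integral _ _ _ _ m pm); last first.
    by move=> A mA _; rewrite /m /mscale /= /pushforward lebesgue_affine.
  by rewrite ge0_integral_mscale.
have mf := meas_EFin (integrableR_meas If).
have mfa : meas (fun x => f (affine c a x)).
  by apply: measurableT_comp; [exact: integrableR_meas|exact: meas_affine].
have Ifa : integrableR (fun x => f (affine c a x)).
  apply/integrableP; split; first exact: meas_EFin.
  have /integrableP[_ h] := If.
  rewrite (e0 (fun x => `|(f x)%:E|)%E).
  - by rewrite lte_mul_pinfty// lee_fin ltW.
  - exact: measurableT_comp.
  - by move=> x; exact: abse_ge0.
split=> //; apply: EFin_inj; rewrite EFinM (integR_EFin Ifa) (integR_EFin If).
rewrite integralE [in RHS]integralE muleBr//; last first.
  by apply: integrable_add_def.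
congr (_ - _)%E.
- rewrite -[RHS](e0 _ (measurable_funepos mf) (fun x => funepos_ge0 _ x)).
  by apply: eq_integral => x _; rewrite !funeposE.
- rewrite -[RHS](e0 _ (measurable_funeneg mf) (fun x => funeneg_ge0 _ x)).
  by apply: eq_integral => x _; rewrite !funenegE.
Qed.

Lemma L1_affine c a (f : R -> C) : c != 0 -> L1 f ->
  L1 (fun x => f (affine c a x)) /\
  Cintegral (fun x => f (affine c a x)) = (`|c|^-1)%:C%C * Cintegral f.
Proof.
move=> c0 [f1 f2]; have [h1 h2] := integrableR_affine a c0 f1; have [h3 h4] := integrableR_affine a c0 f2.
split=> //; apply: complex_ext; rewrite !cReImE ?h2 ?h4; ring.
Qed.
End Affine.

(** * The Abel weight and the Poisson kernel *)
Section PoissonKernel.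
Context {R : realType}.
Local Notation C := R[i].
Local Notation mu := (@lebesgue_measure R).
Local Notation meas f := (measurable_fun [set: R] f).

(** The weight of Abel summation, and its Fourier transform. *)
Definition abel_wt (d x : R) : R := expR (- (d * `|x|)).
Definition poisson (d t : R) : R := 2 * d / (d ^+ 2 + t ^+ 2).

Lemma abel_wt_gt0 d x : 0 < abel_wt d x. Proof. exact: expR_gt0. Qed.
Lemma abel_wt_le1 d x : 0 < d -> abel_wt d x <= 1.
Proof. by move=> d0; rewrite expR_le1 oppr_le0 mulr_ge0// ltW. Qed.
Lemma abel_wtN d x : abel_wt d (- x) = abel_wt d x. Proof. by rewrite /abel_wt normrN. Qed.

Lemma continuous_abel_wt d : continuous (abel_wt d).
Proof.
move=> x; apply: (@continuous_comp _ _ _ (fun x => - (d * `|x|)) expR).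
  apply: cvgN; apply: cvgM; first exact: cvg_cst.
  exact: norm_continuous.
exact: continuous_expR.
Qed.

Lemma meas_abel_wt d : meas (abel_wt d).
Proof. by apply: continuous_measurable_fun; exact: continuous_abel_wt. Qed.

(* The summand 1 makes the integrand nonnegative, as the fundamental theorem of
   calculus on an unbounded interval requires; it is the case [t = 0] of the
   cosine term and is subtracted in [fourier_abel_wt]. *)
Section halfline.
Variables (d t : R).
Hypothesis d0 : 0 < d.
Let f x := expR (- (d * x)) * (1 + cos (t * x)).
Let F x := expR (- (d * x)) * ((t * sin (t * x) - d * cos (t * x)) / (d ^+ 2 + t ^+ 2) - d^-1).

Let den : d ^+ 2 + t ^+ 2 != 0.
Proof. by rewrite gt_eqF// ltr_wpDr ?sqr_ge0// exprn_gt0. Qed.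

Let dF (x : R) : is_derive x 1 F (f x).
Proof.
have de : is_derive x 1 (fun x => expR (- (d * x))) (expR (- (d * x)) * - d).
  apply: (@is_derive1_comp _ expR (fun x => - (d * x))).
  by apply: is_derive_eq; rewrite /GRing.scale /=; ring.
have ds : is_derive x 1 (fun x => sin (t * x)) (cos (t * x) * t).
  apply: (@is_derive1_comp _ sin (fun x => t * x)).
  by apply: is_derive_eq; rewrite /GRing.scale /=; ring.
have dc : is_derive x 1 (fun x => cos (t * x)) (- sin (t * x) * t).
  apply: (@is_derive1_comp _ cos (fun x => t * x)).
  by apply: is_derive_eq; rewrite /GRing.scale /=; ring.
rewrite /F /f; apply: is_derive_eq; rewrite /GRing.scale /=; field.
by rewrite den gt_eqF.
Qed.

Let cf : continuous f.
Proof.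
move=> x; apply: cvgM.
  apply: (@continuous_comp _ _ _ (fun x : R => - (d * x)) expR); last exact: continuous_expR.
  apply: cvgN; apply: cvgM; [exact: cvg_cst|exact: cvg_id].
apply: cvgD; first exact: cvg_cst.
apply: (@continuous_comp _ _ _ (fun x : R => t * x) cos); last exact: continuous_cos.
by apply: cvgM; [exact: cvg_cst|exact: cvg_id].
Qed.

Let Foo : F x @[x --> +oo] --> (0 : R).
Proof.
pose M := (`|t| + d) / (d ^+ 2 + t ^+ 2) + d^-1.
have A0 : (fun x => M * expR (- (d * x))) x @[x --> +oo] --> (0 : R).
  rewrite -[X in _ --> X](mulr0 M); apply: cvgM; first exact: cvg_cst.
  apply: (@cvg_comp _ _ _ (fun x : R => d * x) (fun y => expR (- y)) _ +oo).
    by apply: gt0_cvgMry => //; exact: cvg_id.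
  exact: cvgr_expR.
have FM x : `|F x| <= M * expR (- (d * x)).
  rewrite /F normrM (ger0_norm (expR_ge0 _)) mulrC ler_wpM2r ?expR_ge0//.
  apply: le_trans (ler_normB _ _) _; rewrite (gtr0_norm (_ : 0 < d^-1)) ?invr_gt0//.
  rewrite lerD2r normrM (@gtr0_norm _ (_^-1)); last first.
    by rewrite invr_gt0 ltr_wpDr ?sqr_ge0// exprn_gt0.
  rewrite ler_wpM2r ?invr_ge0 ?addr_ge0 ?sqr_ge0//.
  apply: le_trans (ler_normB _ _) _; rewrite !normrM (gtr0_norm d0); apply: lerD.
    by rewrite ler_piMr// ler_norml sin_geN1 sin_le1.
  by rewrite ler_piMr ?(ltW d0)// ler_norml cos_geN1 cos_le1.
apply: (@squeeze_cvgr _ _ _ _ (fun x => - (M * expR (- (d * x)))) (fun x => M * expR (- (d * x)))).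
- by apply: nearW => x; rewrite -ler_norml.
- by rewrite -[X in _ --> X]oppr0; exact: cvgN.
- exact: A0.
Qed.

Lemma int_halfline : (\int[mu]_(x in `[0%R, +oo[) (f x)%:E)%E = (d^-1 + d / (d ^+ 2 + t ^+ 2))%:E.
Proof.
rewrite (@ge0_continuous_FTC2y _ _ F _ 0).
- rewrite -EFinB; congr EFin; rewrite /F !mulr0 oppr0 expR0 sin0 cos0; field.
  by rewrite den gt_eqF.
- move=> x _; rewrite mulr_ge0 ?expR_ge0// -lerBlDl sub0r cos_geN1.
- exact: continuous_subspaceT.
- exact: Foo.
- by move=> x _; exact: ex_derive.
- apply: cvg_at_right_filter; apply: differentiable_continuous.
  by apply/derivable1_diffP; exact: ex_derive.
- by move=> x _; rewrite derive1E; exact: derive_val.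
Qed.
End halfline.

Lemma int_abel_wt_cos d t : 0 < d -> (\int[mu]_x (abel_wt d x * (1 + cos (t * x)))%:E)%E =
  (2 * (d^-1 + d / (d ^+ 2 + t ^+ 2)))%:E.
Proof.
move=> d0; rewrite ge0_symfun_integralT.
- rewrite EFinM -(int_halfline t d0) set_itvE; congr (_ * _)%E.
  apply: eq_integral => x; rewrite inE /= => x0.
  by rewrite /abel_wt ger0_norm.
- move=> x; rewrite mulr_ge0 ?expR_ge0// -lerBlDl sub0r cos_geN1.
- move=> x; apply: cvgM; first exact: continuous_abel_wt.
  apply: cvgD; first exact: cvg_cst.
  apply: (@continuous_comp _ _ _ (fun x => t * x) cos); last exact: continuous_cos.
  apply: cvgM; first exact: cvg_cst. exact: cvg_id.
- by move=> x /=; rewrite abel_wtN mulrN cosN.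
Qed.

Lemma meas_cosM t : meas (fun x => cos (t * x)).
Proof.
apply: measurableT_comp; first exact: meas_cos.
by apply: measurable_funM; [exact: measurable_cst|exact: measurable_id].
Qed.
Lemma meas_sinM t : meas (fun x => sin (t * x)).
Proof.
apply: measurableT_comp; first exact: meas_sin.
by apply: measurable_funM; [exact: measurable_cst|exact: measurable_id].
Qed.

Lemma integrableR_abel_wt_cos d t : 0 < d -> integrableR (fun x => abel_wt d x * (1 + cos (t * x))).
Proof.
move=> d0; apply/integrableR_ge0P.
- apply: measurable_funM; first exact: meas_abel_wt.
  by apply: measurable_funD; [exact: measurable_cst|exact: meas_cosM].
- move=> x; rewrite mulr_ge0 ?expR_ge0// -lerBlDl sub0r cos_geN1.
- by rewrite int_abel_wt_cos// ltry.
Qed.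

Lemma integrableR_abel_wt d : 0 < d -> integrableR (abel_wt d).
Proof.
move=> d0; have := integrableR_Z 2^-1 (integrableR_abel_wt_cos 0 d0).
congr integrableR; apply/funext => x; by rewrite mul0r cos0; field.
Qed.

(** The sine part vanishes by parity; the cosine part is [int_abel_wt_cos]. *)
Lemma fourier_abel_wt d t : 0 < d ->
  Cintegral (fun x => (abel_wt d x)%:C%C * cexpi (- (t * x))) = (poisson d t)%:C%C.
Proof.
move=> d0; have Iw := integrableR_abel_wt d0.
have Ic : integrableR (fun x => abel_wt d x * cos (t * x)).
  by apply: (@integrableR_bounded _ 1) => //; [exact: meas_cosM|move=> x; rewrite ler_norml cos_geN1 cos_le1].
have Is : integrableR (fun x => abel_wt d x * sin (t * x)).
  by apply: (@integrableR_bounded _ 1) => //; [exact: meas_sinM|move=> x; rewrite ler_norml sin_geN1 sin_le1].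
have e2 : integR (abel_wt d) = 2 / d.
  have := int_abel_wt_cos 0 d0; rewrite -(integR_EFin (integrableR_abel_wt_cos 0 d0)) => -[].
  rewrite (_ : (fun x => _) = (fun x => 2 * abel_wt d x)); last first.
    by apply/funext => x; rewrite mul0r cos0; ring.
  rewrite integR_Z// => h; apply: (@mulfI _ 2) => //; rewrite h; field.
  by rewrite gt_eqF.
have e3 : integR (fun x => abel_wt d x * cos (t * x)) = poisson d t.
  have := int_abel_wt_cos t d0; rewrite -(integR_EFin (integrableR_abel_wt_cos t d0)) => -[].
  rewrite (_ : (fun x => _) = (fun x => abel_wt d x + abel_wt d x * cos (t * x))); last first.
    by apply/funext => x; ring.
  rewrite integR_D// e2 /poisson => h.
  rewrite -[LHS](addKr (2 / d)) h; ring.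
have e4 : integR (fun x => abel_wt d x * sin (t * x)) = 0.
  have m1 : (-1 : R) != 0 by rewrite oppr_eq0 oner_eq0.
  have [_] := integrableR_affine 0 m1 Is.
  rewrite normrN normr1 invr1 mul1r.
  rewrite (_ : (fun x => _) = fun x => - (abel_wt d x * sin (t * x))); last first.
    by apply/funext => x; rewrite /affine mulN1r addr0 abel_wtN mulrN sinN mulrN.
  by rewrite integR_N//; lra.
apply: complex_ext; rewrite !cReImE.
- rewrite -e3; congr integR; apply/funext => x; rewrite !cReImE cosN; ring.
- rewrite -[RHS]oppr0 -e4 -integR_N//; congr integR; apply/funext => x.
  rewrite !cReImE sinN; ring.
Qed.

Lemma poisson_ge0 d t : 0 < d -> 0 <= poisson d t.
Proof. by move=> d0; rewrite divr_ge0 ?addr_ge0 ?sqr_ge0// mulr_ge0// ltW. Qed.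

Lemma poisson_le d t : 0 < d -> poisson d t <= 2 / d.
Proof.
move=> d0; rewrite /poisson ler_pdivrMr ?ltr_wpDr ?sqr_ge0 ?exprn_gt0//.
rewrite mulrDr (_ : 2 / d * d ^+ 2 = 2 * d); last by field; rewrite gt_eqF.
by rewrite lerDl mulr_ge0 ?sqr_ge0// divr_ge0// ltW.
Qed.

Lemma poissonN d t : poisson d (- t) = poisson d t. Proof. by rewrite /poisson sqrrN. Qed.

Lemma continuous_poisson d : 0 < d -> continuous (poisson d).
Proof.
move=> d0 t; apply: cvgM; first exact: cvg_cst.
apply: cvgV; first by rewrite gt_eqF// ltr_wpDr ?sqr_ge0 ?exprn_gt0.
apply: cvgD; first exact: cvg_cst.
exact: exprn_continuous.
Qed.

Lemma meas_poisson d : 0 < d -> meas (poisson d).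
Proof. by move=> d0; apply: continuous_measurable_fun; exact: continuous_poisson. Qed.

Let dens (x : R) := (oneDsqr x)^-1.
Let integrableR_dens : integrableR dens /\ integR dens = pi.
Proof.
have d0 x : 0 <= dens x by rewrite invr_ge0 (le_trans ler01)// oneDsqr_ge1.
have e : (\int[mu]_x (dens x)%:E)%E = pi%:E.
  rewrite ge0_symfun_integralT //.
  - rewrite -set_itvcy integral0y_oneDsqr -EFinM; congr EFin; by field.
  - exact: continuous_oneDsqrV.
  - by move=> x; rewrite /dens /oneDsqr /= sqrrN.
have i : integrableR dens.
  apply/integrableR_ge0P => //; last by rewrite e ltry.
  apply: continuous_measurable_fun; exact: continuous_oneDsqrV.
by split=> //; apply: EFin_inj; rewrite integR_EFin.
Qed.

(** A rescaling of the integral of 1 / (1 + x^2). *)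
Lemma integR_poisson d y : 0 < d -> integrableR (fun x => poisson d (y - x)) /\
  integR (fun x => poisson d (y - x)) = 2 * pi.
Proof.
move=> d0; have [i e] := integrableR_dens.
have c0 : - d^-1 != 0 by rewrite oppr_eq0 invr_eq0 gt_eqF.
have [i2 e2] := integrableR_affine (y / d) c0 i.
have E : (fun x => poisson d (y - x)) = (fun x => 2 / d * dens (affine (- d^-1) (y / d) x)).
  apply/funext => x; rewrite /poisson /dens /affine /oneDsqr; field.
  rewrite (gt_eqF d0) /=.
  have h : 0 < d ^+ 2 + (y - x) ^+ 2 by rewrite ltr_wpDr ?sqr_ge0 ?exprn_gt0.
  have -> : -1 * x + y = y - x by ring.
  by rewrite gt_eqF.
rewrite E; split; first exact: integrableR_Z.
rewrite integR_Z// e2 e normrN (@gtr0_norm _ (d^-1)) ?invr_gt0// invrK; field.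
by rewrite gt_eqF.
Qed.

Lemma integR_itv_derive (f F : R -> R) a b : a < b -> continuous f ->
  (forall x : R, is_derive x 1 F (f x)) ->
  integR (fun x => \1_`[a, b] x * f x) = F b - F a.
Proof.
move=> ab cf dF.
have -> : integR (fun x => \1_`[a, b] x * f x) = \int[mu]_(x in `[a, b]) f x.
  rewrite Rintegral_mkcond; apply: eq_Rintegral => y _.
  by rewrite /patch indicE; case: ifPn => _; rewrite ?mul1r ?mul0r.
have cF : continuous F.
  move=> y; apply: differentiable_continuous; apply/derivable1_diffP.
  exact: (@ex_derive _ _ _ _ _ _ _ (dF y)).
rewrite /Rintegral (@continuous_FTC2 _ f F a b ab) //.
- exact: continuous_subspaceT.
- split.
  + by move=> y _; exact: (@ex_derive _ _ _ _ _ _ _ (dF y)).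
  + by apply: cvg_at_right_filter; exact: cF.
  + by apply: cvg_at_left_filter; exact: cF.
- by move=> y _; rewrite derive1E; exact: (@derive_val _ _ _ _ _ _ _ (dF y)).
Qed.

Lemma integR_poisson_itv d a b xi : 0 < d -> a < b ->
  integR (fun y => \1_`[a, b] y * poisson d (y - xi)) =
  2 * (atan ((b - xi) / d) - atan ((a - xi) / d)).
Proof.
move=> d0 ab; rewrite mulrBr.
apply: (integR_itv_derive (F := fun y => 2 * atan ((y - xi) / d)) ab).
  move=> y; apply: (@continuous_comp _ _ _ (fun y : R => y - xi) (poisson d)); last exact: continuous_poisson.
  by apply: cvgB; [exact: cvg_id|exact: cvg_cst].
move=> y.
have da : is_derive y 1 (fun y => atan ((y - xi) / d)) ((1 + ((y - xi) / d) ^+ 2)^-1 * d^-1).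
  apply: (@is_derive1_comp _ atan (fun y => (y - xi) / d)).
  by apply: is_derive_eq; rewrite /GRing.scale /=; ring.
apply: is_derive_eq; rewrite /GRing.scale /= /poisson; field.
have h : 0 < d ^+ 2 + (y - xi) ^+ 2 by rewrite ltr_wpDr ?sqr_ge0 ?exprn_gt0.
by rewrite (gt_eqF d0) (gt_eqF h).
Qed.
End PoissonKernel.

(** * The Fourier transform does not increase the energy by more than 2 pi *)
Section Plancherel_le.
Context {R : realType}.
Local Notation C := R[i].
Local Notation mu := (@lebesgue_measure R).
Local Notation meas f := (measurable_fun [set: R] f).
Local Notation meas2 f := (measurable_fun [set: R * R] f).
Implicit Types (u v f g : R -> C).

Lemma cmodM (z w : C) : cmod (z * w) = cmod z * cmod w.
Proof. by rewrite !cmodE sqmodM sqrtrM ?sqmod_ge0. Qed.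
Lemma cmode (t : R) : cmod (cexpi t) = 1.
Proof. by rewrite cmodE sqmode sqrtr1. Qed.
Lemma cmodR (a : R) : cmod (a%:C)%C = `|a|.
Proof. by rewrite !cmodE sqmodR sqrtr_sqr. Qed.

Lemma meas_linM (c : R) : meas (fun x => - (c * x)).
Proof. by apply: measurableT_comp => //; exact: measurable_funM. Qed.
Lemma meas_linP (c : R) : meas (fun x => c * x).
Proof. by apply: measurable_funM; [exact: measurable_cst|exact: measurable_id]. Qed.

Lemma L1_expi u (h : R -> R) : meas h -> L1 u -> L1 (fun x => u x * cexpi (h x)).
Proof.
move=> mh; apply: (@L1_bM _ 1); first exact: Cmeas_expi.
by move=> x; rewrite sqmode.
Qed.

Lemma L1_R (f : R -> R) : integrableR f -> L1 (fun x => (f x)%:C%C).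
Proof. by move=> If; split => //; exact: integrableR_0. Qed.

(** The multiplication formula.  The other facts on the transform of integrable
    functions come from it by a suitable choice of [v]. *)
Lemma fourier_fubini u v : L1 u -> L1 v ->
  L1 (fun xi => fourier1 u xi * v xi) /\
  Cintegral (fun xi => fourier1 u xi * v xi) =
  Cintegral (fun x => u x * fourier1 v x).
Proof.
move=> lu lv.
pose F (z : R * R) := u z.1 * v z.2 * cexpi (- (z.1 * z.2)).
have e1 x : (fun xi => F (x, xi)) = (fun xi => u x * (v xi * cexpi (- (x * xi)))).
  by apply/funext => y; rewrite /F mulrA.
have e2 xi : (fun x => F (x, xi)) = (fun x => v xi * (u x * cexpi (- (xi * x)))).
  by apply/funext => y; rewrite /F /= (mulrC (v xi)) mulrAC (mulrC xi).
have l1 x : L1 (fun xi => F (x, xi)).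
  by rewrite e1; apply: L1Z; apply: L1_expi => //; exact: meas_linM.
have l2 xi : L1 (fun x => F (x, xi)).
  by rewrite e2; apply: L1Z; apply: L1_expi => //; exact: meas_linM.
have [|||||_ L E] := @CI_fubini _ F (fun y => integR (fun x => cmod (u x)) * cmod (v y)).
- apply: Cmeas2M; first apply: Cmeas2M.
  + by apply: Cmeas2_fst; exact: L1_meas.
  + by apply: Cmeas2_snd; exact: L1_meas.
  apply: Cmeas2_expi; apply: measurableT_comp => //.
  by apply: measurable_funM; [exact: measurable_fst|exact: measurable_snd].
- exact: l1.
- exact: l2.
- by apply: integrableR_Z; exact: L1_cmod.
- move=> y; rewrite mulrC -integR_Z; last exact: L1_cmod.
  rewrite le_eqVlt; apply/orP; left; apply/eqP; congr integR; apply/funext => x.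
  by rewrite /F !cmodM cmode mulr1 mulrC.
have e3 : (fun y => Cintegral (fun x => F (x, y))) = (fun xi => fourier1 u xi * v xi).
  apply/funext => y; rewrite e2 [LHS]CI_Z; first exact: mulrC.
  exact: L1_expi (meas_linM y) lu.
have e4 : (fun x => Cintegral (fun y => F (x, y))) = (fun x => u x * fourier1 v x).
  apply/funext => x; rewrite e1 [LHS]CI_Z; first by [].
  exact: L1_expi (meas_linM x) lv.
by rewrite e3 in L E; rewrite e4 in E.
Qed.

(** Fubini's theorem yields the measurability of the product with a positive
    continuous weight, which can be divided out. *)
Lemma Cmeas_fourier u : L1 u -> Cmeasurable (fourier1 u).
Proof.
move=> lu; have [L _] := fourier_fubini lu (L1_R (integrableR_abel_wt (@ltr01 R))).
have m1 : Cmeasurable (fun xi => ((abel_wt 1 xi)^-1)%:C%C : C).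
  apply: CmeasR; apply: continuous_measurable_fun => x.
  by apply: cvgV; [rewrite gt_eqF// abel_wt_gt0|exact: continuous_abel_wt].
have := CmeasM (L1_meas L) m1; apply: Cmeas_ext => x.
rewrite -mulrA -rmorphM /= mulfV ?mulr1//.
by rewrite gt_eqF// abel_wt_gt0.
Qed.

Lemma fourier_bounded u : L1 u -> exists M, forall xi, sqmod (fourier1 u xi) <= M.
Proof.
move=> lu; exists (2 * integR (fun x => cmod (u x)) ^+ 2) => xi.
apply: le_trans (CI_bound _) _; first by apply: L1_expi => //; exact: meas_linM.
rewrite le_eqVlt; apply/orP; left; apply/eqP; congr (2 * integR _ ^+ 2).
by apply/funext => x; rewrite cmodM cmode mulr1.
Qed.

(** Abel means of the inversion integral are Poisson integrals. *)
Lemma abel_mean u d x : L1 u -> 0 < d ->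
  Cintegral (fun xi => fourier1 u xi * ((abel_wt d xi)%:C%C * cexpi (x * xi))) =
  Cintegral (fun y => u y * (poisson d (y - x))%:C%C).
Proof.
move=> lu d0.
have [_ ->] := fourier_fubini lu (L1_expi (meas_linP x) (L1_R (integrableR_abel_wt d0))).
congr Cintegral; apply/funext => y; congr (_ * _).
rewrite -(fourier_abel_wt _ d0); congr Cintegral; apply/funext => xi.
rewrite -mulrA -cexpiD; congr (_ * cexpi _); ring.
Qed.

Lemma meas2_poisson (d : R) : 0 < d -> meas2 (fun z => poisson d (z.2 - z.1)).
Proof.
move=> d0; apply: measurableT_comp; first exact: meas_poisson.
by apply: measurable_funB; [exact: measurable_snd|exact: measurable_fst].
Qed.

Lemma meas_poissonB (d x : R) : 0 < d -> meas (fun y => poisson d (y - x)).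
Proof.
move=> d0; apply: measurableT_comp; first exact: meas_poisson.
by apply: measurable_funB; [exact: measurable_id|exact: measurable_cst].
Qed.

Lemma integrableR_poissonM (d x : R) (f : R -> R) : 0 < d -> integrableR f -> integrableR (fun y => f y * poisson d (y - x)).
Proof.
move=> d0; apply: (@integrableR_bounded _ (2 / d)); first exact: meas_poissonB.
by move=> y; rewrite ger0_norm ?poisson_ge0// poisson_le.
Qed.

(** Fubini's theorem, as the kernel has mass 2 pi in each variable. *)
Lemma integR_conv_poisson (d : R) (f : R -> R) : 0 < d -> integrableR f -> (forall x, 0 <= f x) ->
  integrableR (fun x => integR (fun y => f y * poisson d (y - x))) /\
  integR (fun x => integR (fun y => f y * poisson d (y - x))) = 2 * pi * integR f.
Proof.
move=> d0 If f0.
have ip y : integrableR (fun x => f y * poisson d (y - x)) by apply: integrableR_Z; case: (integR_poisson y d0).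
have ep y : integR (fun x => f y * poisson d (y - x)) = 2 * pi * f y.
  by have [i e] := integR_poisson y d0; rewrite integR_Z// e mulrC.
have [|||||i1 _ e] := @integR_fubini _ (fun z => f z.2 * poisson d (z.2 - z.1)) (fun y => 2 * pi * f y).
- apply: measurable_funM; last exact: meas2_poisson.
  by apply: (measurableT_comp (integrableR_meas If)); exact: measurable_snd.
- by move=> x; exact: integrableR_poissonM.
- exact: ip.
- exact: integrableR_Z.
- move=> y; rewrite -ep le_eqVlt; apply/orP; left; apply/eqP; congr integR.
  by apply/funext => x /=; rewrite ger0_norm// mulr_ge0// poisson_ge0.
split; first exact: i1.
rewrite [LHS]e -(integR_Z _ If); congr integR; apply/funext => y; exact: ep.
Qed.

Lemma Re_mulJ_le (z w : C) : cRe (z * conjc w) <= 2^-1 * (sqmod z + sqmod w).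
Proof.
rewrite /sqmod !cReImE mulrN opprK.
have := sqr_ge0 (cRe z - cRe w); have := sqr_ge0 (cIm z - cIm w); nra.
Qed.

(** By the multiplication formula the weighted energy of the transform is the
    integral of [u] against the Poisson integral of its conjugate.  That integral
    is at most 2 pi times the energy, by
    |u(x) u(y)| <= (|u(x)|^2 + |u(y)|^2) / 2 and the mass of the kernel. *)
Lemma fourier_energy_abel_wt u d : L1 u -> L2 u -> 0 < d ->
  integrableR (fun xi => sqmod (fourier1 u xi) * abel_wt d xi) /\
  integR (fun xi => sqmod (fourier1 u xi) * abel_wt d xi) <= 2 * pi * energy u.
Proof.
move=> lu l2 d0; have Iw := integrableR_abel_wt d0; have mhat := Cmeas_fourier lu.
have [M bM] := fourier_bounded lu.
have Iu := l2.2.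
have lwJ : L1 (fun xi => (abel_wt d xi)%:C%C * conjc (fourier1 u xi)).
  apply: (@L1_bM _ M); [exact: CmeasJ|by move=> xi; rewrite sqmodJ|exact: L1_R].
have [L E] := fourier_fubini lu lwJ.
have e0 : (fun xi => sqmod (fourier1 u xi) * abel_wt d xi) =
    (fun xi => cRe (fourier1 u xi * ((abel_wt d xi)%:C%C * conjc (fourier1 u xi)))).
  by apply/funext => xi; rewrite /sqmod !cReImE; ring.
split; first by rewrite e0; case: L.
rewrite e0 -Re_CI E Re_CI.
pose B x := Cintegral (fun y => u y * (poisson d (y - x))%:C%C).
have lB x : L1 (fun y => u y * (poisson d (y - x))%:C%C).
  apply: (@L1_bM _ ((2 / d) ^+ 2)) => //; first by apply: CmeasR; exact: meas_poissonB.
  move=> y; rewrite sqmodR ler_pXn2r ?nnegrE ?poisson_ge0 ?poisson_le//.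
  by rewrite divr_ge0// ltW.
have eB x : fourier1 (fun xi => (abel_wt d xi)%:C%C * conjc (fourier1 u xi)) x = conjc (B x).
  rewrite /B -(abel_mean x lu d0) -CI_J; last first.
    have lw : L1 (fun xi => (abel_wt d xi)%:C%C * cexpi (x * xi)).
      by apply: L1_expi; [exact: meas_linP|exact: L1_R].
    have := @L1_bM _ M _ _ mhat bM lw.
    by congr L1; apply/funext => xi; rewrite mulrC.
  congr Cintegral; apply/funext => xi; rewrite cexpiN.
  by move: (fourier1 u xi) => z; apply: complex_ext; rewrite !cReImE; ring.
have [Ic Ec] := integR_conv_poisson d0 Iu (fun x => sqmod_ge0 (u x)).
have le x : cRe (u x * fourier1 (fun xi => (abel_wt d xi)%:C%C * conjc (fourier1 u xi)) x) <=
    2^-1 * (2 * pi * sqmod (u x) + integR (fun y => sqmod (u y) * poisson d (y - x))).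
  rewrite eB /B -CI_J// -CI_Z; last exact: L1J.
  rewrite Re_CI.
  have [ip ep] := integR_poisson x d0.
  have ip' : integrableR (fun y => poisson d (y - x)).
    by move: ip; congr integrableR; apply/funext => y; rewrite -poissonN opprB.
  have ep' : integR (fun y => poisson d (y - x)) = 2 * pi.
    by rewrite -ep; congr integR; apply/funext => y; rewrite -poissonN opprB.
  rewrite -ep' mulrC [_ * sqmod _]mulrC -(integR_Z _ ip') -integR_D; [|exact: integrableR_Z|exact: integrableR_poissonM].
  rewrite mulrC -integR_Z; last by apply: integrableR_D; [exact: integrableR_Z|exact: integrableR_poissonM].
  apply: integR_le.
  - by have [] := L1Z (u x) (L1J (lB x)).
  - by apply: integrableR_Z; apply: integrableR_D; [exact: integrableR_Z|exact: integrableR_poissonM].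
  move=> y; rewrite -mulrDl mulrA.
  apply: le_trans (ler_wpM2r (poisson_ge0 (y - x) d0) (Re_mulJ_le (u x) (u y))).
  by rewrite !cReImE le_eqVlt; apply/orP; left; apply/eqP; ring.
have [Iuh _] : L1 (fun x => u x * fourier1 (fun xi => (abel_wt d xi)%:C%C * conjc (fourier1 u xi)) x).
  have [M' bM'] := fourier_bounded lwJ.
  by apply: L1_bM bM' lu; exact: Cmeas_fourier.
apply: le_trans (integR_le Iuh _ le) _.
  by apply: integrableR_Z; apply: integrableR_D => //; exact: integrableR_Z.
rewrite integR_Z; last by apply: integrableR_D => //; exact: integrableR_Z.
rewrite integR_D ?Ec ?integR_Z//; last exact: integrableR_Z.
by rewrite /energy le_eqVlt; apply/orP; left; apply/eqP; field.
Qed.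

(** The sequence of parameters along which the Abel weight tends to 1. *)
Definition dn (n : nat) : R := (n.+1%:R)^-1.
Lemma dn_gt0 n : 0 < dn n. Proof. by rewrite invr_gt0 ltr0n. Qed.
Lemma cvg_dn : dn @ \oo --> (0 : R).
Proof. exact: cvg_harmonic. Qed.

Lemma cvg_abel_wt x : (fun n => abel_wt (dn n) x) @ \oo --> (1 : R).
Proof.
rewrite -expR0; apply: continuous_cvg; first exact: continuous_expR.
rewrite -oppr0; apply: cvgN; rewrite -(mul0r `|x|).
by apply: cvgM; [exact: cvg_dn|exact: cvg_cst].
Qed.

(** Fatou's lemma removes the weight from [fourier_energy_abel_wt]. *)
Lemma fourier_energy_le u : L1 u -> L2 u ->
  L2 (fourier1 u) /\ energy (fourier1 u) <= 2 * pi * energy u.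
Proof.
move=> lu l2; have mhat := Cmeas_fourier lu.
have h n := fourier_energy_abel_wt lu l2 (dn_gt0 n).
have [||||||I E] := @integR_fatou _ (fun n xi => sqmod (fourier1 u xi) * abel_wt (dn n) xi)
  (fun xi => sqmod (fourier1 u xi)) (2 * pi * energy u).
- by move=> n; case: (h n).
- by move=> n x; rewrite mulr_ge0 ?sqmod_ge0 ?expR_ge0.
- exact: meas_sqmod.
- apply/nearW => x; rewrite -[X in _ --> X]mulr1.
  by apply: cvgM; [exact: cvg_cst|exact: cvg_abel_wt].
- by move=> x; exact: sqmod_ge0.
- by exists 0%N => n _; case: (h n).
by split.
Qed.

End Plancherel_le.

(** * Density in L^2 *)
Section Density.
Context {R : realType}.
Local Notation C := R[i].
Local Notation mu := (@lebesgue_measure R).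
Local Notation meas f := (measurable_fun [set: R] f).
Implicit Types (V : (R -> C) -> Prop) (u v f g : R -> C).

(** A property of functions that defines a closed subspace of L^2 holds on all
    of L^2 once it holds for enough indicators. *)
Record closed_subspace V : Prop := ClosedSubspace {
  cs_L2 : forall f, V f -> L2 f;
  cs0 : V (fun=> 0);
  csD : forall f g, V f -> V g -> V (fun x => f x + g x);
  csZ : forall z f, V f -> V (fun x => z * f x);
  cs_closed : forall f, L2 f ->
    (forall e : R, 0 < e -> exists2 v, V v & energy (fun x => f x - v x) < e) -> V f }.

Lemma cs_sum V (I : Type) (s : seq I) (F : I -> R -> C) : closed_subspace V ->
  (forall i, V (F i)) -> V (fun x => \sum_(i <- s) F i x).
Proof.
move=> cV VF; elim: s => [|i s IH].
  by under eq_fun do rewrite big_nil; exact: cs0.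
by under eq_fun do rewrite big_cons; apply: csD.
Qed.

Lemma csB V f g : closed_subspace V -> V f -> V g -> V (fun x => f x - g x).
Proof.
move=> cV Vf Vg; apply: csD => //.
by have := csZ cV (-1) Vg; congr V; apply/funext => x; rewrite mulN1r.
Qed.

Lemma cs_cvg V (u : nat -> R -> C) f : closed_subspace V -> (forall n, V (u n)) ->
  L2 f -> (fun n => energy (fun x => u n x - f x)) @ \oo --> (0 : R) -> V f.
Proof.
move=> cV Vu lf cu; apply: cs_closed => // e e0.
have [N _ /(_ N (leqnn N)) h] := cvgr_lt _ cu _ e0.
by exists (u N) => //; rewrite energyBC.
Qed.

Lemma cs_ae V f g : closed_subspace V -> L2 f -> V g ->
  {ae mu, forall x, f x = g x} -> V f.
Proof.
move=> cV lf Vg fg; apply: cs_closed => // e e0; exists g => //.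
have [_ ->] : L2 (fun x => f x - g x) /\ energy (fun x => f x - g x) = energy (fun=> 0 : C).
  apply: energy_ae; [|exact: L2_0|].
  - by apply: CmeasD; [case: lf|apply: CmeasN; case: (cs_L2 cV Vg)].
  - by apply: (ae_imply _ fg) => x ->; rewrite subrr.
by rewrite energy0.
Qed.

Import HBNNSimple.

(** The approximating simple functions increase to [phi], and their level sets
    over positive values have finite measure by Chebyshev's inequality. *)
Lemma cs_ge0 V (D : set R) (phi : R -> R) : closed_subspace V ->
  (forall B : set R, measurable B -> B `<=` D -> (mu B < +oo)%E -> V (cind B)) ->
  (forall x, 0 <= phi x) -> (forall x, ~ D x -> phi x = 0) ->
  L2 (fun x => (phi x)%:C%C) -> V (fun x => (phi x)%:C%C).
Proof.
move=> cV VB phi0 phiD [[mphi _] iphi].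
have mphiE := meas_EFin mphi.
pose a := nnsfun_approx (@measurableT _ (measurableTypeR R)) mphiE.
have ca x : (fun n => a n x) @ \oo --> phi x.
  have := @cvg_nnsfun_approx _ _ _ _ (@measurableT _ (measurableTypeR R)) _ mphiE
    (fun x _ => ltac:(by rewrite /= lee_fin)) x I.
  by move=> /fine_cvgP[_].
have a_le n x : a n x <= phi x.
  have nd := nd_nnsfun_approx (@measurableT _ (measurableTypeR R)) mphiE.
  have h : nondecreasing_seq (fun n => a n x) by move=> m k mk; exact/lefP/nd.
  have := nondecreasing_cvgn_le h (cvgP _ (ca x)) n.
  by rewrite (cvg_lim _ (ca x)).
have isq : integrableR (fun x => phi x ^+ 2) by move: iphi; under eq_fun do rewrite sqmodR.
have Va n : V (fun x => (a n x)%:C%C).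
  pose Y := finmap.enum_fset (fset_set (range (a n))).
  have -> : (fun x => (a n x)%:C%C : C) =
      (fun x => \sum_(y <- Y) (y%:C)%C * cind (a n @^-1` [set y]) x).
    apply/funext => x; rewrite {1}fimfunE fsbig_finite//= rmorph_sum /=.
    by apply: eq_bigr => y _; rewrite rmorphM.
  apply: cs_sum => // y.
  have [y0|y0] := leP y 0.
    rewrite (_ : (fun x => _) = fun=> 0); first exact: cs0.
    apply/funext => x; rewrite /cind indicE; case: (boolP (x \in _)) => [|_]; last by rewrite mulr0.
    rewrite inE /= => xy; have : 0 <= a n x by [].
    by rewrite xy => y1; rewrite (_ : y = 0) ?mul0r//; apply/eqP; rewrite eq_le y0.
  apply: csZ => //.
  have mB : measurable (a n @^-1` [set y]) by exact: measurable_sfunP.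
  apply: VB => //.
  - move=> x /= xy; apply: contrapT => nD.
    by have := a_le n x; rewrite xy phiD// leNgt y0.
  - have /integrableP[_] := isq; apply: contraTT; rewrite -!leNgt !leye_eq => /eqP muy.
    rewrite -leye_eq.
    have : ((y ^+ 2)%:E * mu (a n @^-1` [set y]) <= \int[mu]_x `|(phi x ^+ 2)%:E|)%E.
      have -> : ((y ^+ 2)%:E * mu (a n @^-1` [set y]) =
          \int[mu]_x (y ^+ 2 * \1_(a n @^-1` [set y]) x)%:E)%E.
        under eq_integral do rewrite EFinM.
        rewrite ge0_integralZl//; last by rewrite lee_fin sqr_ge0.
          by rewrite integral_indic// setIT.
        exact: meas_EFin (meas_indic mB).
      apply: ge0_le_integral => //.
      + by move=> x _; rewrite lee_fin mulr_ge0 ?sqr_ge0.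
      + apply: meas_EFin; apply: measurable_funM; [exact: measurable_cst|].
        exact: meas_indic.
      + by apply: measurableT_comp => //; apply: meas_EFin; exact: integrableR_meas.
      + move=> x _; rewrite lee_fin indicE; case: (boolP (x \in _)) => [|_].
          rewrite inE /= => xy; rewrite mulr1 (le_trans _ (ler_norm _))//.
          by rewrite -xy ler_pXn2r ?nnegrE// a_le.
        by rewrite mulr0.
    rewrite muy gt0_muley//; rewrite lte_fin exprn_gt0//.
apply: (cs_cvg cV Va); first by split=> //; split=> //; exact: measurable_cst.
apply: (@energy_dominated _ _ _ (fun x => phi x ^+ 2)) => //.
- by move=> n; have [] := cs_L2 cV (Va n).
- apply/nearW => x; rewrite (_ : (fun n => _) = fun n => (a n x - phi x) * (a n x - phi x)).
    have c0 : (fun n => a n x - phi x) @ \oo --> (0 : R).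
      by rewrite -[X in _ --> X](subrr (phi x)); apply: cvgB; [exact: ca|exact: cvg_cst].
    by rewrite -[X in _ --> X](mulr0 0); apply: cvgM.
  by apply/funext => n; rewrite -rmorphB /= sqmodR expr2.
- move=> n x; rewrite -rmorphB /= sqmodR -sqrrN opprB ler_pXn2r ?nnegrE ?subr_ge0//.
  by rewrite gerBl.
Qed.

(** Positive and negative parts of the real and imaginary parts. *)
Lemma cs_dense V (D : set R) f : closed_subspace V ->
  (forall B : set R, measurable B -> B `<=` D -> (mu B < +oo)%E -> V (cind B)) ->
  L2 f -> (forall x, ~ D x -> f x = 0) -> V f.
Proof.
move=> cV VB lf fD; have [[m1 m2] If] := lf.
have real (h : R -> R) : meas h -> (forall x, h x ^+ 2 <= sqmod (f x)) ->
    (forall x, ~ D x -> h x = 0) -> V (fun x => (h x)%:C%C).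
  move=> mh hf hD.
  have L (k : R -> R) : meas k -> (forall x, `|k x| <= `|h x|) -> L2 (fun x => (k x)%:C%C).
    move=> mk kh; split; first exact: CmeasR.
    apply: integrableR_le If; first by apply: meas_sqmod; exact: CmeasR.
    move=> x; rewrite ger0_norm ?sqmod_ge0// sqmodR (le_trans _ (hf x))//.
    by rewrite -[leLHS]real_normK ?num_real// -[leRHS]real_normK ?num_real// ler_pXn2r ?nnegrE.
  have -> : (fun x => (h x)%:C%C : C) =
      (fun x => (Num.max (h x) 0)%:C%C - (Num.max (- h x) 0)%:C%C).
    apply/funext => x; rewrite -rmorphB /=; congr (_%:C)%C.
    by case: (lerP (h x) 0) => hx; case: (lerP (- h x) 0) => hx'; lra.
  apply: csB => //; apply: (@cs_ge0 _ D) => //.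
  - by move=> x; rewrite le_max lexx orbT.
  - by move=> x /hD ->; rewrite maxxx.
  - apply: L; first by apply: measurable_maxr => //; exact: measurable_cst.
    move=> x; rewrite ger0_norm ?le_max ?lexx ?orbT// ge_max ler_norm normr_ge0//.
  - by move=> x; rewrite le_max lexx orbT.
  - by move=> x /hD ->; rewrite oppr0 maxxx.
  - apply: L; first by apply: measurable_maxr; [exact: measurableT_comp|exact: measurable_cst].
    by move=> x; rewrite ger0_norm ?le_max ?lexx ?orbT// ge_max -normrN ler_norm normr_ge0.
have -> : f = (fun x => (cRe (f x))%:C%C + Complex 0 1 * (cIm (f x))%:C%C).
  by apply/funext => x; move: (f x) => [p q]; apply: complex_ext => /=; ring.
apply: csD => //; last apply: csZ => //; apply: real => // x.
- exact: sqmod_Re.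
- by move=> /fD ->.
- exact: sqmod_Im.
- by move=> /fD ->.
Qed.

End Density.

(** * Fourier inversion by Abel means *)
Section Inversion.
Context {R : realType}.
Local Notation C := R[i].
Local Notation mu := (@lebesgue_measure R).
Local Notation meas f := (measurable_fun [set: R] f).
Implicit Types (u v f g h : R -> C).

Lemma fourierD u v : L1 u -> L1 v ->
  fourier1 (fun x => u x + v x) = (fun xi => fourier1 u xi + fourier1 v xi).
Proof.
move=> lu lv; apply/funext => xi; rewrite /fourier1 -CI_D.
- by congr Cintegral; apply/funext => x; rewrite mulrDl.
- exact: L1_expi (meas_linM xi) lu.
- exact: L1_expi (meas_linM xi) lv.
Qed.

Lemma fourierZ z u : L1 u ->
  fourier1 (fun x => z * u x) = (fun xi => z * fourier1 u xi).
Proof.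
move=> lu; apply/funext => xi; rewrite /fourier1 -CI_Z.
- by congr Cintegral; apply/funext => x; rewrite mulrA.
- exact: L1_expi (meas_linM xi) lu.
Qed.

Lemma fourierB u v : L1 u -> L1 v ->
  fourier1 (fun x => u x - v x) = (fun xi => fourier1 u xi - fourier1 v xi).
Proof.
move=> lu lv.
have -> : (fun x => u x - v x) = (fun x => u x + (-1) * v x).
  by apply/funext => x; rewrite mulN1r.
rewrite fourierD//; last exact: L1Z.
by rewrite fourierZ//; apply/funext => xi; rewrite mulN1r.
Qed.

Lemma cvgn_ext (u v : nat -> R) (l : R) : u =1 v -> u @ \oo --> l -> v @ \oo --> l.
Proof. by move=> /funext ->. Qed.

Definition inv_fourier g (x : R) : C := ((2 * pi)^-1)%:C%C * fourier1 g (- x).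

Lemma inv_fourierD u v : L1 u -> L1 v ->
  inv_fourier (fun x => u x + v x) = (fun x => inv_fourier u x + inv_fourier v x).
Proof. by move=> lu lv; apply/funext => x; rewrite /inv_fourier fourierD// mulrDr. Qed.

Lemma inv_fourierB u v : L1 u -> L1 v ->
  inv_fourier (fun x => u x - v x) = (fun x => inv_fourier u x - inv_fourier v x).
Proof. by move=> lu lv; apply/funext => x; rewrite /inv_fourier fourierB// mulrBr. Qed.

Lemma inv_fourierZ z u : L1 u -> inv_fourier (fun x => z * u x) = (fun x => z * inv_fourier u x).
Proof. by move=> lu; apply/funext => x; rewrite /inv_fourier fourierZ// mulrCA. Qed.

Let m1 : (-1 : R) != 0. Proof. by rewrite oppr_eq0 oner_eq0. Qed.
Let affineN (x : R) : affine (-1) 0 x = - x. Proof. by rewrite /affine mulN1r addr0. Qed.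

Lemma Cmeas_inv_fourier g : L1 g -> Cmeasurable (inv_fourier g).
Proof.
move=> lg; apply: CmeasM; first exact: Cmeas_cst.
have [a b] := Cmeas_fourier lg.
have mN : meas (fun x => - x) by exact: measurableT_comp.
by split; [exact: (measurableT_comp a mN)|exact: (measurableT_comp b mN)].
Qed.

Lemma inv_fourier_L2 g : L1 g -> L2 g ->
  L2 (inv_fourier g) /\ energy (inv_fourier g) = (2 * pi)^-2 * energy (fourier1 g).
Proof.
move=> lg l2; have [[mg ig] _] := fourier_energy_le lg l2.
have [i e] := integrableR_affine 0 m1 ig.
have E : (fun x => sqmod (inv_fourier g x)) =
    (fun x => (2 * pi)^-2 * sqmod (fourier1 g (affine (-1) 0 x))).
  by apply/funext => x; rewrite sqmodM sqmodR affineN exprVn.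
split; first by split; [exact: Cmeas_inv_fourier|rewrite E; exact: integrableR_Z].
by rewrite /energy E (integR_Z _ i) e normrN normr1 invr1 mul1r.
Qed.

Lemma inv_fourier_bounded g : L1 g -> exists M, forall x, sqmod (inv_fourier g x) <= M.
Proof.
move=> lg; have [M bM] := fourier_bounded lg.
exists ((2 * pi)^-1 ^+ 2 * M) => x.
by rewrite sqmodM sqmodR ler_wpM2l ?sqr_ge0.
Qed.

(** The inverse transform of [g] need not be integrable; its Abel means are, and
    they approximate it in L^2 ([abel_cvg_inv_fourier]). *)
Definition abel g n (x : R) : C := inv_fourier g x * (abel_wt (dn n) x)%:C%C.

Lemma abel_L1 g n : L1 g -> L1 (abel g n).
Proof.
move=> lg; have [M bM] := inv_fourier_bounded lg.
have := L1_bM (Cmeas_inv_fourier lg) bM (L1_R (integrableR_abel_wt (dn_gt0 n))).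
by congr L1; apply/funext => x; rewrite /abel mulrC.
Qed.

Lemma sqmod_abel_wt_le1 d (x : R) : 0 < d -> sqmod ((abel_wt d x)%:C%C) <= 1.
Proof.
move=> d0; rewrite sqmodR -[leRHS](expr1n _ 2) ler_pXn2r ?nnegrE ?abel_wt_le1//.
by rewrite ltW// abel_wt_gt0.
Qed.

Lemma abel_L2 g n : L1 g -> L2 g -> L2 (abel g n) /\ energy (abel g n) <= energy (inv_fourier g).
Proof.
move=> lg l2; have [lf _] := inv_fourier_L2 lg l2.
have E : abel g n = (fun x => (abel_wt (dn n) x)%:C%C * inv_fourier g x).
  by apply/funext => x; rewrite /abel mulrC.
have mw : Cmeasurable (fun x => (abel_wt (dn n) x)%:C%C : C) by apply: CmeasR; exact: meas_abel_wt.
have w1 x := sqmod_abel_wt_le1 x (dn_gt0 n).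
rewrite E; split; first exact: L2_bM mw w1 lf.
by rewrite -[leRHS]mul1r; exact: energy_bM mw w1 lf.
Qed.

(** This is [abel_mean] after a reflection: transforming the Abel means of the
    inverse transform gives Poisson integrals of [g]. *)
Lemma fourier_abel g n xi : L1 g ->
  fourier1 (abel g n) xi =
  ((2 * pi)^-1)%:C%C * Cintegral (fun y => g y * (poisson (dn n) (y - xi))%:C%C).
Proof.
move=> lg; have d0 := @dn_gt0 R n.
rewrite -(abel_mean xi lg d0).
have lh : L1 (fun x => fourier1 g x * ((abel_wt (dn n) x)%:C%C * cexpi (xi * x))).
  have [] := fourier_fubini lg (L1_expi (meas_linP xi) (L1_R (integrableR_abel_wt d0))); by [].
have [i e] := L1_affine 0 m1 lh.
move: e; rewrite normrN normr1 invr1 rmorph1 mul1r => <-.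
rewrite -CI_Z//; congr Cintegral; apply/funext => x.
rewrite affineN abel_wtN mulrN /abel /inv_fourier; ring.
Qed.

Lemma abel_cvg_inv_fourier g : L1 g -> L2 g ->
  (fun n => energy (fun x => abel g n x - inv_fourier g x)) @ \oo --> (0 : R).
Proof.
move=> lg l2; have [lf _] := inv_fourier_L2 lg l2.
have E n x : sqmod (abel g n x - inv_fourier g x) = sqmod (inv_fourier g x) * (1 - abel_wt (dn n) x) ^+ 2.
  rewrite (_ : _ - _ = inv_fourier g x * (abel_wt (dn n) x - 1)%:C%C).
    by rewrite sqmodM sqmodR -sqrrN opprB.
  by rewrite /abel rmorphB rmorph1 mulrBr mulr1.
apply: (energy_dominated (G := fun x => sqmod (inv_fourier g x))).
- by move=> n; exact: L1_meas (abel_L1 n lg).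
- by case: lf.
- apply/nearW => x; apply: (cvgn_ext (fun n => esym (E n x))).
  have c0 : (fun n => 1 - abel_wt (dn n) x) @ \oo --> (0 : R).
    by rewrite -(subrr 1); apply: cvgB; [exact: cvg_cst|exact: cvg_abel_wt].
  rewrite -[X in _ --> X](mulr0 (sqmod (inv_fourier g x))); apply: cvgM; first exact: cvg_cst.
  by rewrite -[X in _ --> X](mulr0 0); exact: (cvgM c0 c0).
- by case: lf.
- move=> n x; rewrite E ler_piMr ?sqmod_ge0//.
  have d0 := @dn_gt0 R n; have := abel_wt_le1 x d0; have := abel_wt_gt0 (dn n) x.
  by move=> a b; rewrite -[leRHS](expr1n _ 2) ler_pXn2r ?nnegrE ?subr_ge0 ?lerBlDr ?lerDl ?(ltW a).
Qed.

(** A form of [is_fourier] (see [is_fourierP]) with approximation to any given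
    precision in place of a sequence, which suits closure properties. *)
Definition fourier_pair f g := [/\ L2 f, L2 g & forall e : R, 0 < e ->
  exists u, [/\ L1 u, L2 u, energy (fun x => u x - f x) < e &
     energy (fun x => fourier1 u x - g x) < e]].

Definition Ccvg (z : nat -> C) (w : C) :=
  ((fun n => cRe (z n)) @ \oo --> cRe w) /\ ((fun n => cIm (z n)) @ \oo --> cIm w).

Lemma Ccvg_sqmod z w a : Ccvg z w -> (fun n => sqmod (a - z n)) @ \oo --> sqmod (a - w).
Proof.
move=> [c1 c2]; rewrite /sqmod; apply: cvgD.
- rewrite cReD cReN expr2.
  under eq_fun do rewrite cReD cReN expr2.
  by apply: cvgM; (apply: cvgB; [exact: cvg_cst|exact: c1]).
- rewrite cImD cImN expr2.
  under eq_fun do rewrite cImD cImN expr2.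
  by apply: cvgM; (apply: cvgB; [exact: cvg_cst|exact: c2]).
Qed.

(** Plancherel's identity and the inversion formula at [g], which the density
    argument carries together. *)
Definition plancherel_inv g := energy (fourier1 g) = 2 * pi * energy g /\ fourier_pair (inv_fourier g) g.

Let pi2 : 0 < 2 * pi :> R. Proof. by rewrite mulr_gt0// pi_gt0. Qed.

(** If the Poisson integrals of [g] recover it almost everywhere, then Fatou's
    lemma and [fourier_energy_le] for the Abel means give
    |g|^2 <= 2 pi |inv_fourier g|^2 = (2 pi)^-1 |fourier1 g|^2, the inequality
    opposite to [fourier_energy_le].  The same reasoning on differences of Abel
    means shows that their transforms approach [g]. *)
Lemma abel_plancherel_inv g : L1 g -> L2 g ->
  {ae mu, forall xi, Ccvg (fun n => fourier1 (abel g n) xi) (g xi)} -> plancherel_inv g.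
Proof.
move=> lg l2 cv; have [lf ef] := inv_fourier_L2 lg l2.
have [lgh le] := fourier_energy_le lg l2.
have la n := abel_L1 n lg; have la2 n := (abel_L2 n lg l2).1.
have lah n := fourier_energy_le (la n) (la2 n).
have bnd : energy g <= 2 * pi * energy (inv_fourier g).
  have [||||||_ ->//] := @integR_fatou _ (fun n x => sqmod (fourier1 (abel g n) x))
    (fun x => sqmod (g x)) (2 * pi * energy (inv_fourier g)).
  - by move=> n; case: (lah n) => -[].
  - by move=> n x; exact: sqmod_ge0.
  - by apply: meas_sqmod; case: l2.
  - apply: (ae_imply _ cv) => x /(@Ccvg_sqmod _ _ 0); rewrite sub0r sqmodN.
    by apply: cvgn_ext => n; rewrite sub0r sqmodN.
  - by move=> x; exact: sqmod_ge0.
  - exists 0%N => n _; apply: le_trans (lah n).2 _.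
    by rewrite ler_wpM2l ?(ltW pi2)//; case: (abel_L2 n lg l2).
split.
  apply/eqP; rewrite eq_le le /=.
  move: bnd; rewrite ef.
  rewrite (_ : 2 * pi * _ = (2 * pi)^-1 * energy (fourier1 g)); last first.
    have h (p e : R) : p != 0 -> 2 * p * ((2 * p) ^- 2 * e) = (2 * p)^-1 * e.
      by move=> p0; field.
    by rewrite h// gt_eqF// pi_gt0.
  by rewrite -ler_pdivrMl ?invrK ?invr_gt0.
split=> // e e0.
(* [e'] is such that both [e'] and [2 * pi * (2 * e' + 2 * e')] are below [e] *)
pose e' := e / (8 * pi + 2).
have e'0 : 0 < e' by rewrite divr_gt0// ltr_wpDl// mulr_ge0// ltW// pi_gt0.
have ee' : 2 * pi * (2 * e' + 2 * e') < e.
  rewrite (_ : _ * _ = 8 * pi * e'); last by ring.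
  rewrite /e' mulrA ltr_pdivrMr; last by rewrite ltr_wpDl// mulr_ge0// ltW// pi_gt0.
  by have := pi_gt0 R; nra.
have ee'' : e' < e.
  rewrite /e' ltr_pdivrMr; last by rewrite ltr_wpDl// mulr_ge0// ltW// pi_gt0.
  by have := pi_gt0 R; nra.
have [N _ hN] := cvgr_lt _ (abel_cvg_inv_fourier lg l2) _ e'0.
exists (abel g N); split => //.
  by apply: lt_trans ee''; apply: hN => /=.
apply: le_lt_trans ee'.
have [||||||_ //] := @integR_fatou _
  (fun m x => sqmod (fourier1 (abel g N) x - fourier1 (abel g m) x))
  (fun x => sqmod (fourier1 (abel g N) x - g x)) (2 * pi * (2 * e' + 2 * e')).
- by move=> m; have [] := L2B (lah N).1 (lah m).1.
- by move=> n x; exact: sqmod_ge0.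
- by apply: meas_sqmod; apply: CmeasD; [case: (lah N) => -[]|apply: CmeasN; case: l2].
- by apply: (ae_imply _ cv) => x; exact: Ccvg_sqmod.
- by move=> x; exact: sqmod_ge0.
- exists N => m Nm.
  have lB := L1B (la N) (la m); have lB2 := L2B (la2 N) (la2 m).
  have [_] := fourier_energy_le lB lB2; rewrite fourierB// => h.
  apply: le_trans h _; rewrite ler_wpM2l ?(ltW pi2)//.
  apply: le_trans (energyB_tri (la2 N) lf (la2 m)) _.
  apply: lerD; rewrite ler_wpM2l//; first by apply: ltW; apply: hN => /=.
  by rewrite energyBC; apply: ltW; apply: hN.
Qed.

Lemma cvg_atan_pos c : 0 < c -> (fun n => atan (c / dn n)) @ \oo --> (pi / 2 : R).
Proof.
move=> c0.
suff h : (fun n => c * (dn n)^-1) @ \oo --> +oo by exact: (cvg_comp _ _ h (@cvgy_atan R)).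
apply/cvgryPge => A.
have [N _ hN] := (cvgryPge _).1 (@cvgr_idn R) (A / c).
exists N => // n Nn /=; rewrite invrK mulrC -ler_pdivrMr//.
by apply: le_trans (hN n Nn) _; rewrite ler_nat.
Qed.

Lemma cvg_atan_neg c : c < 0 -> (fun n => atan (c / dn n)) @ \oo --> (- (pi / 2) : R).
Proof.
move=> c0; have c1 : 0 < - c by rewrite oppr_gt0.
apply: (cvgn_ext _ (cvgN (cvg_atan_pos c1))) => n /=.
by rewrite fctE mulNr atanN opprK.
Qed.

(** The Poisson integral of an interval is a difference of arctangents; it
    converges to the indicator away from the end points. *)
Lemma plancherel_inv_itv a b : a < b -> plancherel_inv (cind `[a, b]).
Proof.
move=> ab.
have mI : measurable (`[a, b] : set R) by [].
have fI : (mu `[a, b] < +oo)%E by rewrite lebesgue_measure_itv /= lte_fin ab -EFinB ltry.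
have l2 : L2 (cind `[a, b]) := L2_ind mI fI.
have l1 : L1 (cind `[a, b]).
  by apply: L2_supp_L1 mI fI _ l2 => x nx; rewrite /cind indicE memNset.
apply: abel_plancherel_inv => //.
have E n xi : fourier1 (abel (cind `[a, b]) n) xi =
    (pi^-1 * (atan ((b - xi) / dn n) - atan ((a - xi) / dn n)))%:C%C.
  rewrite fourier_abel//; have d0 := @dn_gt0 R n.
  rewrite (_ : (fun y => _) = (fun y => ((\1_`[a, b] y * poisson (dn n) (y - xi)))%:C%C)); last first.
    by apply/funext => y; apply: complex_ext; rewrite /cind !cReImE; ring.
  rewrite (_ : Cintegral _ = (integR (fun y => \1_`[a, b] y * poisson (dn n) (y - xi)))%:C%C); last first.
    apply: complex_ext; rewrite !cReImE//.
    by rewrite /integR Rintegral_cst// mul0r.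
  rewrite integR_poisson_itv// -rmorphM; congr (_%:C)%C.
  have h (p e : R) : p != 0 -> (2 * p)^-1 * (2 * e) = p^-1 * e by move=> p0; field.
  by rewrite h// gt_eqF// pi_gt0.
have nab : {ae mu, forall xi, xi != a /\ xi != b}.
  apply: ae_and.
    exists [set a]; split => //; first exact: lebesgue_measure_set1.
    by move=> x /= /negP; rewrite negbK => /eqP.
  exists [set b]; split => //; first exact: lebesgue_measure_set1.
  by move=> x /= /negP; rewrite negbK => /eqP.
apply: (ae_imply _ nab) => xi [xa xb]; split; last first.
  by apply: (@cvgn_ext (fun=> 0)); [move=> n; rewrite E|exact: cvg_cst].
rewrite cReC; apply: (cvgn_ext (fun n => esym (congr1 cRe (E n xi)))).
have pi0 : pi != 0 :> R by rewrite gt_eqF// pi_gt0.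
have lim (p q : R) : (fun n => atan ((b - xi) / dn n)) @ \oo --> p ->
    (fun n => atan ((a - xi) / dn n)) @ \oo --> q ->
    (fun n => pi^-1 * (atan ((b - xi) / dn n) - atan ((a - xi) / dn n))) @ \oo --> pi^-1 * (p - q).
  by move=> hp hq; apply: cvgM; [exact: cvg_cst|exact: cvgB].
rewrite indicE; case: (ltgtP xi a) xa => // xa _.
  rewrite memNset; last by rewrite /= in_itv /= leNgt xa.
  have := lim _ _ (cvg_atan_pos (ltac:(lra) : 0 < b - xi)) (cvg_atan_pos (ltac:(lra) : 0 < a - xi)).
  by rewrite subrr mulr0.
case: (ltgtP xi b) xb => // xb _.
  rewrite mem_set; last by rewrite /= in_itv /= !ltW.
  have := lim _ _ (cvg_atan_pos (ltac:(lra) : 0 < b - xi)) (cvg_atan_neg (ltac:(lra) : a - xi < 0)).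
  by have -> : pi^-1 * (pi / 2 - - (pi / 2)) = 1 :> R by rewrite opprK -splitr mulVf.
rewrite memNset; last by rewrite /= in_itv /= => /andP[_]; rewrite leNgt xb.
have := lim _ _ (cvg_atan_neg (ltac:(lra) : b - xi < 0)) (cvg_atan_neg (ltac:(lra) : a - xi < 0)).
by rewrite subrr mulr0.
Qed.

End Inversion.

(** * Indicators of preimages of Borel sets *)
Section DynkinDensity.
Context {R : realType}.
Local Notation C := R[i].
Local Notation mu := (@lebesgue_measure R).
Local Notation meas f := (measurable_fun [set: R] f).

Lemma cindI (A B : set R) x : cind (A `&` B) x = cind A x * cind B x :> C.
Proof. by rewrite /cind indicI /= rmorphM. Qed.

Lemma cind_in (A : set R) x : A x -> cind A x = 1 :> C.
Proof. by move=> Ax; rewrite /cind indicE mem_set. Qed.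
Lemma cind_out (A : set R) x : ~ A x -> cind A x = 0 :> C.
Proof. by move=> Ax; rewrite /cind indicE memNset. Qed.

Lemma cind_eq (A B : set R) x : (A x <-> B x) -> cind A x = cind B x :> C.
Proof.
move=> AB; have [Bx|nB] := pselect (B x); first by rewrite !cind_in//; apply/AB.
by rewrite !cind_out//; apply: contra_not nB => /AB.
Qed.

(** Dynkin's lemma: the rays are stable under intersection and generate the
    Borel sets, while complements and disjoint unions become differences and
    dominated limits of indicators. *)
Lemma cs_preimage V (A : set R) (tau : R -> R) : closed_subspace V ->
  measurable A -> (mu A < +oo)%E -> meas tau -> V (cind A) ->
  (forall a, V (cind (A `&` tau @^-1` `]a, +oo[))) ->
  forall B, measurable B -> V (cind (A `&` tau @^-1` B)).
Proof.
move=> cV mA fA mtau VA Vray B mB.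
have mpre (S : set R) : measurable S -> measurable (A `&` tau @^-1` S).
  move=> mS; apply: measurableI => //; rewrite -[X in measurable X]setTI.
  exact: mtau.
have fpre (S : set R) : measurable S -> (mu (A `&` tau @^-1` S) < +oo)%E.
  move=> mS; apply: le_lt_trans fA; apply: le_measure; rewrite ?inE//.
  exact: mpre.
pose P (S : set R) := V (cind (A `&` tau @^-1` S)).
have sB : <<s @RGenOInfty.G R >> B
  by rewrite -[<<s _ >>]/((@RGenOInfty.G R).-sigma.-measurable) -RGenOInfty.measurableE.
refine (@dynkin_induction _ (measurableTypeR R) (@RGenOInfty.G R) P _ _ _ _ _ _ B sB).
- exact: RGenOInfty.measurableE.
- move=> _ _ [x ->] [y ->]; exists (Num.max x y).
  apply/seteqP; split => z /=; rewrite !in_itv /= !andbT gt_max.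
    by move=> [-> ->].
  by move=> /andP.
- by rewrite /P preimage_setT setIT.
- by move=> _ [a ->]; exact: Vray.
- move=> S mS PS; rewrite /P.
  rewrite (_ : cind _ = fun x => cind A x - cind (A `&` tau @^-1` S) x).
    exact: csB.
  apply/funext => x; have [Ax|nA] := pselect (A x); last first.
    by rewrite !cind_out ?subrr// => -[].
  have [Sx|nS] := pselect (S (tau x)).
    by rewrite (cind_in Ax) (@cind_in (A `&` tau @^-1` S))// subrr cind_out// => -[].
  by rewrite (cind_in Ax) (@cind_out (A `&` tau @^-1` S)) ?subr0 ?cind_in// => -[].
- move=> F mF tF PF; rewrite /P.
  pose W n := [set x | exists2 k, (k < n)%N & F k x].
  have PW n : P (W n).
    elim: n => [|n IH].
      rewrite /P (_ : cind _ = fun=> 0); first exact: cs0.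
      by apply/funext => x; rewrite cind_out// => -[_ []].
    rewrite /P (_ : cind _ = fun x => cind (A `&` tau @^-1` W n) x +
        cind (A `&` tau @^-1` F n) x); first by apply: csD => //; exact: PF.
    apply/funext => x; have [Ax|nA] := pselect (A x); last first.
      by rewrite !cind_out ?addr0// => -[].
    have [Wx|nW] := pselect (W n (tau x)).
      rewrite (@cind_in (A `&` tau @^-1` W n.+1)); last first.
        by split=> //; case: Wx => k kn Fk; exists k => //; rewrite ltnS ltnW.
      rewrite cind_in// cind_out ?addr0// => -[_ /= Fn]; case: Wx => k kn Fk.
      have := tF k n I I; rewrite (_ : (_ !=set0) = True); last first.
        by apply/propext; split=> // _; exists (tau x).
      by move=> /(_ I) e; move: kn; rewrite e ltnn.
    rewrite (@cind_out (A `&` tau @^-1` W n)) ?add0r; last by move=> [].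
    have [Fx|nF] := pselect (F n (tau x)).
      by rewrite !cind_in//; split=> //; exists n.
    rewrite !cind_out//; first by move=> [].
    move=> [_ [k]]; rewrite ltnS leq_eqVlt => /predU1P[->//|kn] Fk.
    by apply: nW; exists k.
  have mU : measurable (\bigcup_k F k) by exact: bigcupT_measurable.
  apply: (cs_cvg cV PW); first by apply: L2_ind; [exact: mpre|exact: fpre].
  apply: (energy_dominated (G := (\1_A : R -> R))).
  + by move=> n; case: (cs_L2 cV (PW n)).
  + by apply: Cmeas_ind; exact: mpre.
  + apply/nearW => x.
    have [Ux|nU] := pselect ((\bigcup_k F k) (tau x)); last first.
      apply: (@cvgn_ext _ (fun=> 0)); last exact: cvg_cst.
      move=> n; rewrite !cind_out ?subrr ?sqmod0//; first by move=> [].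
      by move=> [_ [k _ Fk]]; apply: nU; exists k.
    case: Ux => k _ Fk; apply: cvg_near_cst; exists k.+1 => // n /= kn.
    have [Ax|nA] := pselect (A x); last by rewrite !cind_out ?subrr ?sqmod0// => -[].
    by rewrite !cind_in ?subrr ?sqmod0//; split=> //; exists k.
  + exact: integrableR_indic.
  + move=> n x; have [Ax|nA] := pselect (A x); last first.
      by rewrite !cind_out ?subrr ?sqmod0// => -[].
    rewrite indicE mem_set// /cind -rmorphB sqmodR !indicE.
    by case: (_ \in _); case: (_ \in _); rewrite ?subrr ?subr0 ?sub0r ?sqrrN ?expr1n ?expr0n.
Qed.

End DynkinDensity.

(** * Plancherel's theorem and inversion for compactly supported functions *)
Section Plancherel.
Context {R : realType}.
Local Notation C := R[i].
Local Notation mu := (@lebesgue_measure R).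
Local Notation meas f := (measurable_fun [set: R] f).
Implicit Types (u v f g h : R -> C).

Let pi2 : 0 < 2 * pi :> R. Proof. by rewrite mulr_gt0// pi_gt0. Qed.

Lemma fourier_pairD f g f' g' : fourier_pair f g -> fourier_pair f' g' ->
  fourier_pair (fun x => f x + f' x) (fun x => g x + g' x).
Proof.
move=> [l1 l2 h] [l1' l2' h']; split; [exact: L2D|exact: L2D|move=> e e0].
have e4 : 0 < e / 4 by rewrite divr_gt0.
have [u [a b c d]] := h _ e4; have [u' [a' b' c' d']] := h' _ e4.
exists (fun x => u x + u' x); split; [exact: L1D|exact: L2D| |].
- rewrite (_ : (fun x => _) = (fun x => (u x - f x) + (u' x - f' x))); last first.
    by apply/funext => x; ring.
  apply: le_lt_trans (energyD (L2B b l1) (L2B b' l1')) _; lra.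
- have lu := (fourier_energy_le a b).1; have lu' := (fourier_energy_le a' b').1.
  rewrite fourierD// (_ : (fun x => _) =
    (fun x => (fourier1 u x - g x) + (fourier1 u' x - g' x))); last first.
    by apply/funext => x; ring.
  apply: le_lt_trans (energyD (L2B lu l2) (L2B lu' l2')) _; lra.
Qed.

Lemma fourier_pairZ z f g : fourier_pair f g ->
  fourier_pair (fun x => z * f x) (fun x => z * g x).
Proof.
move=> [l1 l2 h]; split; [exact: L2Z|exact: L2Z|move=> e e0].
have z0 : 0 < sqmod z + 1 by rewrite ltr_wpDl ?sqmod_ge0.
have [u [a b c d]] := h (e / (sqmod z + 1)) (divr_gt0 e0 z0).
have fin (r : R) : 0 <= r -> r < e / (sqmod z + 1) -> sqmod z * r < e.
  move=> r0; rewrite ltr_pdivlMr//; apply: le_lt_trans; nra.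
exists (fun x => z * u x); split; [exact: L1Z|exact: L2Z| |].
- under eq_fun do rewrite -mulrBr.
  by rewrite energyZ; [apply: fin => //; exact: energy_ge0|exact: L2B].
- rewrite fourierZ//; under eq_fun do rewrite -mulrBr.
  rewrite energyZ; [apply: fin => //; exact: energy_ge0|].
  exact: (L2B (fourier_energy_le a b).1 l2).
Qed.

Lemma fourier_pair_closed f g : L2 f -> L2 g ->
  (forall e : R, 0 < e -> exists f' g', [/\ fourier_pair f' g',
     energy (fun x => f' x - f x) < e & energy (fun x => g' x - g x) < e]) ->
  fourier_pair f g.
Proof.
move=> l1 l2 H; split=> // e e0.
have e4 : 0 < e / 4 by rewrite divr_gt0.
have [f' [g' [[l1' l2' h] ef eg]]] := H _ e4; have [u [a b c d]] := h _ e4.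
exists u; split=> //.
- by apply: le_lt_trans (energyB_tri b l1' l1) _; lra.
- apply: le_lt_trans (energyB_tri (fourier_energy_le a b).1 l2' l2) _; lra.
Qed.

(* the defect in Plancherel's identity, a quadratic form by the parallelogram
   law; being nonnegative and bounded by the energy, it vanishes on a closed
   subspace *)
Let Q u := 2 * pi * energy u - energy (fourier1 u).

Let Q_ge0 u : L1 u -> L2 u -> 0 <= Q u.
Proof. by move=> a b; rewrite subr_ge0; case: (fourier_energy_le a b). Qed.

Let Q_le u : Q u <= 2 * pi * energy u.
Proof. by rewrite gerBl energy_ge0. Qed.

Let QD u v : L1 u -> L2 u -> L1 v -> L2 v ->
  Q (fun x => u x + v x) <= 2 * Q u + 2 * Q v.
Proof.
move=> a b a' b'.
have := Q_ge0 (L1B a a') (L2B b b').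
have p1 := energy_parallelogram b b'.
have := energy_parallelogram (fourier_energy_le a b).1 (fourier_energy_le a' b').1.
rewrite /Q (fourierD a a') (fourierB a a').
move: (energy _) (energy _) (energy _) (energy _) (energy _) (energy _) (energy _) (energy _) p1 => *; nra.
Qed.

Lemma plancherel_closed u : L1 u -> L2 u ->
  (forall e : R, 0 < e -> exists v, [/\ L1 v, L2 v,
     energy (fourier1 v) = 2 * pi * energy v & energy (fun x => u x - v x) < e]) ->
  energy (fourier1 u) = 2 * pi * energy u.
Proof.
move=> a b H; apply/eqP; rewrite eq_sym -subr_eq0 -/(Q u) eq_le Q_ge0// andbT.
apply/ler_addgt0Pr => e e0; rewrite add0r.
have [v [a' b' ev hv]] := H (e / (4 * pi)) ltac:(by rewrite divr_gt0// mulr_gt0// pi_gt0).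
have := QD (L1B a a') (L2B b b') a' b'.
rewrite (_ : (fun x => _) = u); last by apply/funext => x; rewrite subrK.
rewrite {3}/Q ev subrr mulr0 addr0 => h; apply: le_trans h _.
have := Q_le (fun x => u x - v x); rewrite ltr_pdivlMr in hv; last by rewrite mulr_gt0// pi_gt0.
by move=> h; lra.
Qed.

(** Plancherel's identity is additive because [Q (u + v) <= 2 * Q u + 2 * Q v]
    bounds a nonnegative quantity by zero. *)
Lemma plancherel_invD u v : L1 u -> L2 u -> L1 v -> L2 v -> plancherel_inv u -> plancherel_inv v ->
  plancherel_inv (fun x => u x + v x).
Proof.
move=> a b a' b' [e1 f1] [e2 f2]; split; last by rewrite inv_fourierD//; exact: fourier_pairD.
have := QD a b a' b'; have := Q_ge0 (L1D a a') (L2D b b').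
rewrite {3 4}/Q e1 e2 !subrr !mulr0 addr0 => h1 h2.
by apply/eqP; rewrite eq_sym -subr_eq0 eq_le h1 h2.
Qed.

Lemma plancherel_invZ z u : L1 u -> L2 u -> plancherel_inv u -> plancherel_inv (fun x => z * u x).
Proof.
move=> a b [e1 f1]; split; last by rewrite inv_fourierZ//; exact: fourier_pairZ.
by rewrite fourierZ// !energyZ//; [rewrite e1; ring|case: (fourier_energy_le a b)].
Qed.

Lemma plancherel_inv_closed u : L1 u -> L2 u ->
  (forall e : R, 0 < e -> exists v, [/\ L1 v, L2 v, plancherel_inv v & energy (fun x => u x - v x) < e]) ->
  plancherel_inv u.
Proof.
move=> a b H; split.
  apply: plancherel_closed => // e e0; have [v [a' b' [ev _] hv]] := H e e0.
  by exists v.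
have [lf _] := inv_fourier_L2 a b.
apply: fourier_pair_closed => // e e0.
have [v [a' b' [ev fv] hv]] := H (Num.min e (2 * pi * e))
  ltac:(by rewrite lt_min e0 mulr_gt0).
move: hv; rewrite lt_min => /andP[h1 h2].
exists (inv_fourier v), v; split=> //; last by rewrite energyBC.
rewrite energyBC -inv_fourierB//; have [_ ->] := inv_fourier_L2 (L1B a a') (L2B b b').
have [_] := fourier_energy_le (L1B a a') (L2B b b').
move=> h; rewrite mulrC ltr_pdivrMr ?exprn_gt0//.
apply: le_lt_trans h _.
rewrite (_ : e * _ = 2 * pi * (2 * pi * e)); last by ring.
by rewrite ltr_pM2l.
Qed.

Lemma plancherel_inv0 : plancherel_inv (fun=> 0 : C).
Proof.
have l1 : L1 (fun=> 0 : C) by split; exact: integrableR_0.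
apply: (@abel_plancherel_inv R); [exact: l1|exact: L2_0|].
apply/nearW => xi.
rewrite (_ : (fun n => fourier1 (abel (fun=> 0) n) xi) = (fun=> 0 : C)).
  by split; exact: cvg_cst.
apply/funext => n; rewrite fourier_abel//.
rewrite (_ : (fun y => _) = (fun=> 0 : C)).
  by apply: complex_ext; rewrite !cReImE /integR Rintegral_cst//; ring.
by apply/funext => y; rewrite mul0r.
Qed.

Section compact.
Variable M : R.
Hypothesis M0 : 0 < M.
Let A : set R := `[- M, M]%classic.

Let mA : measurable A. Proof. exact: measurable_itv. Qed.
Let NM : - M < M. Proof. by move: M0 => ?; lra. Qed.
Let fA : (mu A < +oo)%E.
Proof. by rewrite lebesgue_measure_itv /= lte_fin NM -EFinB ltry. Qed.
Let cut g : L2 g -> L2 (fun x => cind A x * g x).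
Proof. by apply: (@L2_bM _ 1); [exact: Cmeas_ind|exact: sqmod_cind]. Qed.
Let cut1 g : L2 g -> L1 (fun x => cind A x * g x).
Proof.
move=> lg; apply: (L2_supp_L1 mA fA _ (cut lg)) => x nA.
by rewrite cind_out// mul0r.
Qed.

(* Truncation to [A] makes every square-integrable function integrable, so that
   [V] is a closed subspace of the whole of L^2. *)
Let V g := L2 g /\ plancherel_inv (fun x => cind A x * g x).

Let cV : closed_subspace V.
Proof.
split.
- by move=> f [].
- split; first exact: L2_0.
  by rewrite (_ : (fun x => _) = fun=> 0); [exact: plancherel_inv0|apply/funext => x; rewrite mulr0].
- move=> f g [a b] [a' b']; split; first exact: L2D.
  rewrite (_ : (fun x => _) = fun x => cind A x * f x + cind A x * g x).
    by apply: plancherel_invD => //; [exact: cut1|exact: cut|exact: cut1|exact: cut].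
  by apply/funext => x; rewrite mulrDr.
- move=> z f [a b]; split; first exact: L2Z.
  rewrite (_ : (fun x => _) = fun x => z * (cind A x * f x)).
    by apply: plancherel_invZ => //; [exact: cut1|exact: cut].
  by apply/funext => x; rewrite mulrCA.
- move=> f lf H; split=> //; apply: plancherel_inv_closed; [exact: cut1|exact: cut|].
  move=> e e0; have [v [a b] h] := H e e0.
  exists (fun x => cind A x * v x); split=> //; [exact: cut1|exact: cut|].
  apply: le_lt_trans h.
  rewrite (_ : (fun x => _) = fun x => cind A x * (f x - v x)).
    rewrite -[leRHS]mul1r; apply: energy_bM; [exact: Cmeas_ind|exact: sqmod_cind|exact: L2B].
  by apply/funext => x; rewrite mulrBr.
Qed.

Let Vitv a : - M <= a -> a < M -> V (cind `[a, M]).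
Proof.
move=> Ma aM; split.
  apply: L2_ind; first exact: measurable_itv.
  by rewrite lebesgue_measure_itv /= lte_fin aM -EFinB ltry.
rewrite (_ : (fun x => _) = cind `[a, M]); first exact: plancherel_inv_itv.
apply/funext => x; rewrite -cindI; apply: cind_eq.
rewrite /A /= !in_itv /=; split; first by case.
by move=> /andP[y1 y2]; rewrite y1 (le_trans Ma y1) y2.
Qed.

Let Vray a : V (cind (A `&` (fun x => x) @^-1` `]a, +oo[)).
Proof.
have [Ma|aM] := lerP M a.
  rewrite (_ : cind _ = fun=> 0); first exact: (cs0 cV).
  apply/funext => x; rewrite cind_out// => -[]; rewrite /A /= !in_itv /= andbT.
  by move=> /andP[_ x1] x2; have := le_lt_trans Ma x2; rewrite ltNge x1.
have [Na|Na] := ltrP a (- M).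
  rewrite (_ : _ `&` _ = A); first exact: Vitv.
  apply/seteqP; split => x; first by case.
  by rewrite /A /= !in_itv /= => /andP[x1 x2]; rewrite x1 x2 (lt_le_trans Na x1).
have mI : measurable (A `&` (fun x : R => x) @^-1` `]a, +oo[).
  by apply: measurableI => //; rewrite preimage_id; exact: measurable_itv.
apply: (cs_ae cV _ (Vitv Na aM)).
  by apply: L2_ind => //; apply: le_lt_trans fA; apply: le_measure; rewrite ?inE.
exists [set a]; split => //; first exact: lebesgue_measure_set1.
move=> x /= h; apply: contrapT => xa; apply: h; apply: cind_eq.
rewrite /A /= !in_itv /= andbT; split; first by move=> [/andP[_ ->] /ltW ->].
move=> /andP[x1 x2]; rewrite x2 (le_trans Na x1); split=> //.
by rewrite lt_neqAle x1 andbT; apply/eqP => ax; apply: xa.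
Qed.

(** Intervals lie in [V], hence all Borel subsets of [A] by [cs_preimage], hence
    all square-integrable functions on [A] by [cs_dense]. *)
Lemma plancherel_inv_compact g : L2 g -> (forall x, ~ A x -> g x = 0) -> plancherel_inv g.
Proof.
move=> lg sg.
have VA : V (cind A) by by apply: Vitv.
have : V g.
  apply: (cs_dense cV (D := A)) => // B mB BA _.
  have := cs_preimage cV mA fA (@measurable_id _ _ _) VA Vray mB.
  by rewrite preimage_id setIidr.
move=> [_]; rewrite (_ : (fun x => _) = g)//; apply/funext => x.
have [Ax|nA] := pselect (A x); first by rewrite cind_in// mul1r.
by rewrite sg// mulr0.
Qed.
End compact.

Lemma truncate_cvg u : L2 u ->
  (fun n : nat => energy (fun x => cind `[- n.+1%:R, n.+1%:R] x * u x - u x)) @ \oo --> (0 : R).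
Proof.
move=> lu; apply: (energy_dominated (G := fun x => sqmod (u x))).
- move=> n; apply: CmeasM; last by case: lu.
  by apply: Cmeas_ind; exact: measurable_itv.
- by case: lu.
- apply/nearW => x; apply: cvg_near_cst.
  have [N _ hN] := (cvgryPge _).1 (@cvgr_idn R) `|x|.
  exists N => // n Nn /=; rewrite cind_in ?mul1r ?subrr ?sqmod0//= in_itv /= -ler_norml.
  by apply: le_trans (hN n Nn) _; rewrite ler_nat.
- by case: lu.
- move=> n x; have [h|h] := pselect ((`[- n.+1%:R, n.+1%:R]%classic : set R) x).
    by rewrite cind_in// mul1r subrr sqmod0 sqmod_ge0.
  by rewrite cind_out// mul0r sub0r sqmodN.
Qed.

(** The truncations of [u] converge to it in L^2, and for them the identity is
    part of [plancherel_inv_compact]. *)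
Lemma plancherel_L1L2 u : L1 u -> L2 u -> energy (fourier1 u) = 2 * pi * energy u.
Proof.
move=> l1 l2; apply: plancherel_closed => // e e0.
have [N _ /(_ N (leqnn N)) /= h] := cvgr_lt _ (truncate_cvg l2) _ e0.
have N0 : 0 < N.+1%:R :> R by [].
have mI : Cmeasurable (cind `[- N.+1%:R, N.+1%:R] : R -> C).
  by apply: Cmeas_ind; exact: measurable_itv.
exists (fun x => cind `[- N.+1%:R, N.+1%:R] x * u x).
have l2' : L2 (fun x => cind `[- N.+1%:R, N.+1%:R] x * u x).
  by apply: (@L2_bM _ 1) => //; exact: sqmod_cind.
split=> //.
- have := L1_bM mI (sqmod_cind _) l1.
  by congr L1; apply/funext => x; rewrite mulrC.
- have [] // := plancherel_inv_compact N0 l2' _ => x nx.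
  by rewrite cind_out// mul0r.
- by rewrite energyBC.
Qed.

(** The cross term in |w + (z - w)|^2 is split by the inequality
    2 |a b| <= eta a^2 + eta^-1 b^2. *)
Lemma sqmod_diff (z w : C) (eta : R) : 0 < eta ->
  `|sqmod z - sqmod w| <= eta * sqmod w + (1 + eta^-1) * sqmod (z - w).
Proof.
move=> eta0.
have key (a b c : R) : 0 <= c -> a ^+ 2 <= 4 * b * c -> 0 <= b -> `|a| <= eta * b + eta^-1 * c.
  move=> c0 h b0.
  have p0 : 0 <= eta * b + eta^-1 * c.
    by rewrite addr_ge0// mulr_ge0// ?invr_ge0 ltW.
  rewrite -[leRHS]ger0_norm// -ler_sqr ?nnegrE// !real_normK ?num_real//.
  apply: le_trans h _.
  have e1 : eta * b * (eta^-1 * c) = b * c by field; rewrite gt_eqF.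
  have := sqr_ge0 (eta * b - eta^-1 * c).
  move: (eta * b) (eta^-1 * c) e1 => p q e1 h2.
  have -> : 4 * b * c = 4 * (p * q) by rewrite e1 mulrA.
  by move: h2; rewrite sqrrB sqrrD; lra.
have e : sqmod z - sqmod w = 2 * cRe (w * conjc (z - w)) + sqmod (z - w).
  rewrite /sqmod !cReImE; ring.
rewrite e; apply: le_trans (ler_normD _ _) _; rewrite (ger0_norm (sqmod_ge0 (z - w))).
have k : `|2 * cRe (w * conjc (z - w))| <= eta * sqmod w + eta^-1 * sqmod (z - w).
  apply: key; [exact: sqmod_ge0| |exact: sqmod_ge0].
  by have := sqmod_Re (w * conjc (z - w)); rewrite sqmodM sqmodJ exprMn; lra.
by move: k; move: (sqmod (z - w)) (`|_|) (sqmod w) => p q r; rewrite [(1 + _) * p]mulrDl mul1r; lra.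
Qed.

(** Integrating [sqmod_diff] gives a bound by [eta * energy f] up to a term that
    tends to 0; [eta] makes the former less than e / 2. *)
Lemma energy_cvg (u : nat -> R -> C) f : (forall n, L2 (u n)) -> L2 f ->
  (fun n => energy (fun x => u n x - f x)) @ \oo --> (0 : R) -> (fun n => energy (u n)) @ \oo --> energy f.
Proof.
move=> lu lf cu; apply/cvgrPdist_lt => e e0.
pose eta := e / (2 * (energy f + 1)).
have ef : 0 < energy f + 1 by rewrite ltr_wpDl ?energy_ge0.
have eta0 : 0 < eta by rewrite divr_gt0// mulr_gt0.
have c0 : 0 < 1 + eta^-1 by rewrite addr_gt0// invr_gt0.
have d0 : 0 < e / 2 / (1 + eta^-1) by rewrite !divr_gt0.
have [N _ hN] := cvgr_lt _ cu _ d0; exists N => // n Nn /=.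
have h := hN n Nn; rewrite /= ltr_pdivlMr// in h.
have I1 := (lu n).2; have I2 := lf.2; have I3 := (L2B (lu n) lf).2.
rewrite distrC -(integR_B I1 I2).
apply: le_lt_trans (integR_abs_le (integrableR_B I1 I2) _ (fun x => sqmod_diff (u n x) (f x) eta0)) _.
  by apply: integrableR_D; exact: integrableR_Z.
rewrite integR_D; [|exact: integrableR_Z|exact: integrableR_Z].
rewrite (integR_Z _ I2) (integR_Z _ I3) -/(energy f) -/(energy _).
have : eta * energy f < e / 2.
  rewrite /eta; move: (energy f) ef => a a0.
  have -> : e / (2 * (a + 1)) * a = e / 2 * (a / (a + 1)) by field; rewrite gt_eqF.
  by rewrite gtr_pMr ?divr_gt0// ltr_pdivrMr// mul1r ltrDl.
rewrite [_ * energy _]mulrC in h *; lra.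
Qed.

Lemma is_fourierP f g : is_fourier f g <-> fourier_pair f g.
Proof.
split=> [[/CLp2P lf /CLp2P lg [u [lu cf cg]]]|[lf lg H]].
  have lu1 n : L1 (u n) by apply/CLp1P; case: (lu n).
  have lu2 n : L2 (u n) by apply/CLp2P; case: (lu n).
  have luh n := (fourier_energy_le (lu1 n) (lu2 n)).1.
  have {}cf := (CL2cvgP (fun n => L2B (lu2 n) lf)).1 cf.
  have {}cg := (CL2cvgP (fun n => L2B (luh n) lg)).1 cg.
  split=> // e e0.
  have [N _ hN] := cvgr_lt _ cf _ e0; have [N' _ hN'] := cvgr_lt _ cg _ e0.
  exists (u (maxn N N')); split=> //.
  - by apply: hN => /=; rewrite leq_maxl.
  - by apply: hN' => /=; rewrite leq_maxr.
split; [exact/CLp2P|exact/CLp2P|].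
have [u hu] := choice (fun n => H _ (@dn_gt0 R n)).
have cv0 (v : nat -> R) : (forall n, 0 <= v n) -> (forall n, v n < dn n) -> v @ \oo --> (0 : R).
  move=> v0 vd; apply: (@squeeze_cvgr _ _ _ _ (fun=> 0) (@dn R)); [|exact: cvg_cst|exact: cvg_dn].
  by apply: nearW => n; rewrite v0 ltW.
exists u; split.
- by move=> n; have [/CLp1P a /CLp2P b _ _] := hu n.
- apply/CL2cvgP.
    by move=> n; have [_ b _ _] := hu n; exact: L2B.
  by apply: cv0 => n; [exact: energy_ge0|have [] := hu n].
- apply/CL2cvgP.
    by move=> n; have [a b _ _] := hu n; exact: (L2B (fourier_energy_le a b).1).
  by apply: cv0 => n; [exact: energy_ge0|have [] := hu n].
Qed.

Lemma plancherel f g : is_fourier f g -> energy g = 2 * pi * energy f.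
Proof.
move=> [/CLp2P lf /CLp2P lg [u [lu cf cg]]].
have lu1 n : L1 (u n) by apply/CLp1P; case: (lu n).
have lu2 n : L2 (u n) by apply/CLp2P; case: (lu n).
have luh n := (fourier_energy_le (lu1 n) (lu2 n)).1.
have {}cf := (CL2cvgP (fun n => L2B (lu2 n) lf)).1 cf.
have {}cg := (CL2cvgP (fun n => L2B (luh n) lg)).1 cg.
have h1 := energy_cvg luh lg cg.
have h2 : (fun n => 2 * pi * energy (u n)) @ \oo --> 2 * pi * energy f.
  by apply: cvgM; [exact: cvg_cst|exact: energy_cvg].
have E : (fun n => energy (fourier1 (u n))) = (fun n => 2 * pi * energy (u n)).
  by apply/funext => n; exact: plancherel_L1L2.
by rewrite E in h1; exact: (cvg_unique _ h1 h2).
Qed.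

Lemma is_fourierD f g f' g' : is_fourier f g -> is_fourier f' g' ->
  is_fourier (fun x => f x + f' x) (fun x => g x + g' x).
Proof. by move=> /is_fourierP a /is_fourierP b; apply/is_fourierP; exact: fourier_pairD. Qed.

Lemma is_fourierZ z f g : is_fourier f g ->
  is_fourier (fun x => z * f x) (fun x => z * g x).
Proof. by move=> /is_fourierP a; apply/is_fourierP; exact: fourier_pairZ. Qed.

Lemma is_fourierB f g f' g' : is_fourier f g -> is_fourier f' g' ->
  is_fourier (fun x => f x - f' x) (fun x => g x - g' x).
Proof.
move=> a /(is_fourierZ (-1)) b.
have := is_fourierD a b.
by congr is_fourier; apply/funext => x; rewrite mulN1r.
Qed.

Lemma is_fourier0 : is_fourier (fun=> 0 : C) (fun=> 0).
Proof.
apply/is_fourierP; split; [exact: L2_0|exact: L2_0|move=> e e0].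
have l1 : L1 (fun=> 0 : C) by split; exact: integrableR_0.
exists (fun=> 0); split=> //; first exact: L2_0.
  by under eq_fun do rewrite subrr; rewrite energy0.
rewrite (_ : (fun x => _) = fun=> 0); first by rewrite energy0.
apply/funext => x; rewrite subr0; apply: complex_ext; rewrite /fourier1 !cReImE.
  under eq_fun do rewrite mul0r; by rewrite /integR Rintegral_cst// mul0r.
under eq_fun do rewrite mul0r; by rewrite /integR Rintegral_cst// mul0r.
Qed.

Lemma is_fourier_sum (I : Type) (s : seq I) (F G : I -> R -> C) :
  (forall i, is_fourier (F i) (G i)) ->
  is_fourier (fun x => \sum_(i <- s) F i x) (fun x => \sum_(i <- s) G i x).
Proof.
move=> H; elim: s => [|i s IH].
  rewrite (_ : (fun x => _) = fun=> 0); last by apply/funext => x; rewrite big_nil.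
  rewrite (_ : (fun x => \sum_(i <- _) G i x) = fun=> 0); last by apply/funext => x; rewrite big_nil.
  exact: is_fourier0.
have := is_fourierD (H i) IH.
by congr is_fourier; apply/funext => x; rewrite big_cons.
Qed.

(** Polarisation of [plancherel]; the imaginary part comes from rotating [f'] by
    the imaginary unit. *)
Lemma parseval f g f' g' : is_fourier f g -> is_fourier f' g' ->
  Cinner g g' = (2 * pi)%:C%C * Cinner f f'.
Proof.
have pol (u v : R -> C) : L2 u -> L2 v ->
    4 * cRe (Cinner u v) = energy (fun x => u x + v x) - energy (fun x => u x - v x).
  move=> lu lv; have [L _] := L2M_L1 lu (L2J lv).
  rewrite /Cinner Re_CI -(integR_Z _ L) -integR_B; [|exact: (L2D lu lv).2|exact: (L2B lu lv).2].
  congr integR; apply/funext => x; rewrite /sqmod !cReImE; ring.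
have rot (u v : R -> C) : L2 u -> L2 v ->
    cIm (Cinner u v) = cRe (Cinner u (fun x => Complex 0 1 * v x)).
  move=> lu lv; rewrite /Cinner Re_CI Im_CI; congr integR; apply/funext => x.
  by case: (u x) (v x) => [a b] [c d] /=; ring.
move=> F F'; have iF' := is_fourierZ (Complex 0 1) F'.
have lf : L2 f by apply/CLp2P; case: F.
have lg : L2 g by apply/CLp2P; case: F.
have lf' : L2 f' by apply/CLp2P; case: F'.
have lg' : L2 g' by apply/CLp2P; case: F'.
have re f2 g2 : is_fourier f2 g2 -> cRe (Cinner g g2) = 2 * pi * cRe (Cinner f f2).
  move=> F2.
  have l1 : L2 f2 by apply/CLp2P; case: F2.
  have l2 : L2 g2 by apply/CLp2P; case: F2.
  have := pol _ _ lg l2.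
  rewrite (plancherel (is_fourierD F F2)) (plancherel (is_fourierB F F2)) -mulrBr -pol//.
  by rewrite mulrCA => /(mulfI (_ : 4 != 0)); apply.
have c1 := re _ _ F'.
have c2 := re _ _ iF'; rewrite -!rot// in c2.
apply: complex_ext; [rewrite c1 cReM|rewrite c2 cImM];
  rewrite (cReC (2 * pi)) (cImC (2 * pi)); ring.
Qed.

Lemma is_fourier_inv_fourier M g : 0 < M -> L2 g ->
  (forall x, ~ (`[- M, M]%classic : set R) x -> g x = 0) -> is_fourier (inv_fourier g) g.
Proof. by move=> M0 lg sg; apply/is_fourierP; have [] := plancherel_inv_compact M0 lg sg. Qed.

End Plancherel.

(** * Completeness of the exponentials *)
Section ClosedSpan.
Context {R : realType}.
Local Notation C := R[i].
Local Notation mu := (@lebesgue_measure R).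
Implicit Types (V : (R -> C) -> Prop) (f g : R -> C).

Section span.
Variables (I : Type) (e : I -> R -> C).
Hypothesis le : forall i, L2 (e i).

Definition lincomb (l : seq (I * C)) (x : R) : C := \sum_(p <- l) p.2 * e p.1 x.

Definition closed_span f := L2 f /\
  forall d : R, 0 < d -> exists l, energy (fun x => f x - lincomb l x) < d.

Lemma lincomb_L2 l : L2 (lincomb l).
Proof. by apply: L2_sum => p; exact: L2Z. Qed.

Lemma lincombZ z l x : lincomb [seq (p.1, z * p.2) | p <- l] x = z * lincomb l x.
Proof.
by rewrite /lincomb big_map mulr_sumr; apply: eq_bigr => p _; rewrite mulrA.
Qed.

Lemma lincomb_cat l l' x : lincomb (l ++ l') x = lincomb l x + lincomb l' x.
Proof. by rewrite /lincomb big_cat. Qed.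

Lemma closed_span_cs : closed_subspace closed_span.
Proof.
split.
- by move=> f [].
- split; first exact: L2_0.
  move=> d d0; exists [::]; rewrite (_ : (fun x => _) = fun=> 0) ?energy0//.
  by apply/funext => x; rewrite /lincomb big_nil subr0.
- move=> f g [lf hf] [lg hg]; split; first exact: L2D.
  move=> d d0; have d4 : 0 < d / 4 by rewrite divr_gt0.
  have [l hl] := hf _ d4; have [l' hl'] := hg _ d4; exists (l ++ l').
  rewrite (_ : (fun x => _) = (fun x => (f x - lincomb l x) + (g x - lincomb l' x))).
    apply: le_lt_trans (energyD (L2B lf (lincomb_L2 l)) (L2B lg (lincomb_L2 l'))) _.
    by lra.
  by apply/funext => x; rewrite lincomb_cat; ring.
- move=> z f [lf hf]; split; first exact: L2Z.
  move=> d d0; have z0 : 0 < sqmod z + 1 by rewrite ltr_wpDl ?sqmod_ge0.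
  have [l hl] := hf _ (divr_gt0 d0 z0); exists [seq (p.1, z * p.2) | p <- l].
  rewrite (_ : (fun x => _) = (fun x => z * (f x - lincomb l x))); last first.
    by apply/funext => x; rewrite lincombZ mulrBr.
  rewrite energyZ; last by apply: L2B => //; exact: lincomb_L2.
  move: hl; rewrite ltr_pdivlMr//; apply: le_lt_trans.
  by rewrite mulrC ler_wpM2l ?energy_ge0// lerDl.
- move=> f lf H; split=> // d d0; have d4 : 0 < d / 4 by rewrite divr_gt0.
  have [v [lv hv] fv] := H _ d4; have [l hl] := hv _ d4; exists l.
  by apply: le_lt_trans (energyB_tri lf lv (lincomb_L2 l)) _; lra.
Qed.

Lemma closed_span_mem i : closed_span (e i).
Proof.
split=> // d d0; exists [:: (i, 1)].
rewrite (_ : (fun x => _) = fun=> 0) ?energy0//; apply/funext => x.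
by rewrite /lincomb big_seq1 mul1r subrr.
Qed.

Lemma closed_span_sub V f : closed_subspace V -> (forall i, V (e i)) ->
  closed_span f -> V f.
Proof.
move=> cV Ve [lf hf]; apply: (cs_closed cV lf) => d d0; have [l hl] := hf d d0.
by exists (lincomb l) => //; apply: cs_sum => // p; exact: (csZ cV).
Qed.

End span.

Section Multipliers.
Variable V : (R -> C) -> Prop.
Hypothesis cV : closed_subspace V.

(** The bounded multipliers of [V] form an algebra closed under bounded
    pointwise limits.  Unlike [V] it always contains the constants, and for the
    span of the exponentials on a set it contains the exponentials on the line. *)
Definition multiplier (m : R -> C) := [/\ Cmeasurable m,
  exists M : R, forall x, sqmod (m x) <= M & forall f, V f -> V (fun x => m x * f x)].

Lemma multiplier_cst z : multiplier (fun=> z).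
Proof.
split; [exact: Cmeas_cst|by exists (sqmod z)|by move=> f Vf; exact: (csZ cV)].
Qed.

Lemma multiplierD m n : multiplier m -> multiplier n -> multiplier (fun x => m x + n x).
Proof.
move=> [a [M bM] h] [a' [M' bM'] h']; split; first exact: CmeasD.
- exists (2 * M + 2 * M') => x; apply: le_trans (sqmodD _ _) _.
  by have := bM x; have := bM' x; lra.
- move=> f Vf; have := csD cV (h f Vf) (h' f Vf).
  by congr V; apply/funext => x; rewrite mulrDl.
Qed.

Lemma multiplierM m n : multiplier m -> multiplier n -> multiplier (fun x => m x * n x).
Proof.
move=> [a [M bM] h] [a' [M' bM'] h']; split; first exact: CmeasM.
- exists (M * M') => x; rewrite sqmodM; apply: ler_pM => //; exact: sqmod_ge0.
- move=> f Vf; have := h _ (h' f Vf).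
  by congr V; apply/funext => x; rewrite mulrA.
Qed.

(** Dominated convergence, as [V] is closed. *)
Lemma multiplier_lim (m : nat -> R -> R) (l : R -> R) :
  (forall n, multiplier (fun x => (m n x)%:C%C)) -> measurable_fun setT l ->
  (forall n x, `|m n x| <= 1) -> (forall x, `|l x| <= 1) ->
  (forall x, (fun n => m n x) @ \oo --> l x) -> multiplier (fun x => (l x)%:C%C).
Proof.
move=> hm ml m1 l1 cv.
have sq1 (a : R) : `|a| <= 1 -> a ^+ 2 <= 1.
  by move=> h; rewrite -real_normK ?num_real// expr_le1.
split; first exact: CmeasR.
  by exists 1 => x; rewrite sqmodR sq1.
move=> f Vf; have lf := cs_L2 cV Vf; have [mf If] := lf.
have lm n : L2 (fun x => (m n x)%:C%C * f x) by have [_ _ /(_ f Vf)/(cs_L2 cV)] := hm n.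
have ll : L2 (fun x => (l x)%:C%C * f x).
  by apply: (@L2_bM _ 1) lf; [exact: CmeasR|move=> x; rewrite sqmodR sq1].
apply: (cs_cvg (u := fun n x => (m n x)%:C%C * f x) cV _ ll).
  by move=> n; have [_ _] := hm n; apply.
apply: (energy_dominated (G := fun x => 4 * sqmod (f x))).
- by move=> n; case: (lm n).
- by case: ll.
- apply/nearW => x.
  apply: (@cvgn_ext _ (fun n => (m n x - l x) * (m n x - l x) * sqmod (f x))).
    by move=> n; rewrite -mulrBl -rmorphB sqmodM sqmodR expr2.
  have c0 : (fun n => m n x - l x) @ \oo --> (0 : R).
    by rewrite -[X in _ --> X](subrr (l x)); apply: cvgB; [exact: cv|exact: cvg_cst].
  have c1 : (fun n => (m n x - l x) * (m n x - l x)) @ \oo --> (0 : R).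
    by rewrite -[X in _ --> X](mulr0 0); exact: (cvgM c0 c0).
  by rewrite -[X in _ --> X](mul0r (sqmod (f x))); apply: cvgM; [exact: c1|exact: cvg_cst].
- exact: integrableR_Z.
- move=> n x; rewrite -mulrBl -rmorphB sqmodM sqmodR ler_wpM2r ?sqmod_ge0//.
  have := m1 n x; have := l1 x; rewrite !ler_norml => /andP[p1 p2] /andP[p3 p4].
  by nra.
Qed.

(** Newton's iteration for the sign: an odd polynomial that preserves [[-1, 1]]
    and drives nonzero points to 1 or -1.  Polynomials in a multiplier are
    multipliers. *)
Fixpoint sgn_iter (n : nat) (x : R) : R :=
  if n is n'.+1 then (3 * sgn_iter n' x - sgn_iter n' x ^+ 3) / 2 else x.

Lemma sgn_iterN n x : sgn_iter n (- x) = - sgn_iter n x.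
Proof. by elim: n => //= n ->; field. Qed.

Lemma sgn_iter_pos n x : 0 <= x <= 1 ->
  [/\ x <= sgn_iter n x, sgn_iter n x <= 1 & 1 - sgn_iter n x <= (1 - x / 2) ^+ n].
Proof.
move=> /andP[x0 x1]; elim: n => [|n [h1 h2 h3]] /=.
  by split=> //; rewrite expr0; lra.
set s := sgn_iter n x in h1 h2 h3 *.
have s0 : 0 <= s by exact: le_trans h1.
have e1 : 1 - (3 * s - s ^+ 3) / 2 = (1 - s) * (1 - (s + s ^+ 2) / 2) by field.
have e2 : (3 * s - s ^+ 3) / 2 - s = s * (1 - s ^+ 2) / 2 by field.
have s2 : s ^+ 2 <= 1 by rewrite expr_le1.
split.
- by apply: le_trans h1 _; rewrite -subr_ge0 e2 divr_ge0// mulr_ge0// subr_ge0.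
- by rewrite -subr_ge0 e1 mulr_ge0//; nra.
- rewrite e1 [leRHS]exprSr; apply: ler_pM; [by rewrite subr_ge0|by nra|exact: h3|].
  by have := sqr_ge0 s; lra.
Qed.

Lemma sgn_iter_cvg x : `|x| <= 1 -> (fun n => sgn_iter n x) @ \oo --> Num.sg x.
Proof.
have pos (y : R) : 0 < y -> y <= 1 -> (fun n => sgn_iter n y) @ \oo --> (1 : R).
  move=> y0 y1.
  have g0 : (fun n => (1 - y / 2) ^+ n) @ \oo --> (0 : R).
    by apply: cvg_expr; rewrite ger0_norm; lra.
  apply: (@squeeze_cvgr _ _ _ _ (fun n => 1 - (1 - y / 2) ^+ n) (fun=> 1)).
  - apply: nearW => n; have [|_ h2 h3] := @sgn_iter_pos n y; first by rewrite ltW.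
    by rewrite h2 andbT; lra.
  - rewrite -[X in _ --> X](subr0 1); apply: cvgB => //; exact: cvg_cst.
  - exact: cvg_cst.
rewrite ler_norml => /andP[h1 h2]; have [x0|x0|->] := ltgtP x 0.
- rewrite ltr0_sg//.
  apply: (@cvgn_ext _ (fun n => - sgn_iter n (- x))).
    by move=> n; rewrite sgn_iterN opprK.
  by apply: cvgN; apply: pos; lra.
- by rewrite gtr0_sg//; exact: pos.
- rewrite sgr0; apply: (@cvgn_ext _ (fun=> 0)); last exact: cvg_cst.
  elim => //= n <-; by field.
Qed.

Lemma sgn_iter_le1 n x : `|x| <= 1 -> `|sgn_iter n x| <= 1.
Proof.
have pos (y : R) : 0 <= y -> y <= 1 -> `|sgn_iter n y| <= 1.
  move=> y0 y1; have [|a b _] := @sgn_iter_pos n y; first by rewrite y0.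
  by rewrite ger0_norm// (le_trans y0).
rewrite ler_norml => /andP[h1 h2]; have [x0|x0] := lerP 0 x; first exact: pos.
by rewrite -normrN -sgn_iterN; apply: pos; lra.
Qed.

(** The indicator is [(s + s ^+ 2) / 2], where [s] is the sign of [phi]. *)
Lemma multiplier_pos (phi : R -> R) : multiplier (fun x => (phi x)%:C%C) ->
  (forall x, `|phi x| <= 1) -> multiplier (cind [set x | 0 < phi x]).
Proof.
move=> hp p1.
have mphi : measurable_fun [set: R] phi by case: hp => -[].
have ms n : multiplier (fun x => (sgn_iter n (phi x))%:C%C).
  elim: n => [|n IH] /=; first exact: hp.
  have := multiplierD (multiplierM (multiplier_cst ((3 / 2)%:C)%C) IH)
    (multiplierM (multiplier_cst ((- 2^-1)%:C)%C) (multiplierM IH (multiplierM IH IH))).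
  congr multiplier; apply/funext => x; apply: complex_ext; rewrite !cReImE; by field.
have msg : multiplier (fun x => (Num.sg (phi x))%:C%C).
  apply: (multiplier_lim ms).
  - apply: (@measurable_fun_cvg _ _ _ _ (fun n x => sgn_iter n (phi x))).
      by move=> n; case: (ms n) => -[].
    by move=> x _; exact: sgn_iter_cvg.
  - by move=> n x; exact: sgn_iter_le1.
  - by move=> x; rewrite normr_sg; case: (_ != _).
  - by move=> x; exact: sgn_iter_cvg.
have := multiplierM (multiplier_cst ((2^-1)%:C)%C) (multiplierD msg (multiplierM msg msg)).
congr multiplier; apply/funext => x; rewrite /cind indicE; apply: complex_ext; rewrite !cReImE; last by ring.
have [x0|x0|x0] := ltgtP 0 (phi x).
- by rewrite mem_set//= gtr0_sg//; field.
- by rewrite memNset/= ?ltr0_sg//; [field|apply/negP; rewrite -leNgt ltW].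
- by rewrite memNset/= -?x0 ?sgr0 ?ltxx//; field.
Qed.

End Multipliers.

Section exponentials.
Variables (s : R) (D : set R) (tau : R -> R).
Hypotheses (mD : measurable D) (fD : (mu D < +oo)%E).
Hypothesis mtau : measurable_fun [set: R] tau.
(* on [D], [tau] is the residue of [s * x] modulo the period [2 * pi] *)
Hypothesis tauD : forall x, D x -> 0 <= tau x < 2 * pi /\
  cexpi (s * x) = cexpi (tau x) :> C.

Definition exp_on (k : int) (x : R) : C := cexpi (- (k%:~R * (s * x))) * cind D x.

Lemma exp_on_L2 k : L2 (exp_on k).
Proof.
apply: (@L2_bM _ 1).
- by apply: Cmeas_expi; apply: measurableT_comp => //; apply: measurable_funM => //; exact: meas_linP.
- by move=> x; rewrite sqmode.
- exact: L2_ind.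
Qed.

Let V := closed_span exp_on.
Let cV : closed_subspace V. Proof. exact: closed_span_cs exp_on_L2. Qed.

Let multiplier_exp (n : int) : multiplier V (fun x => cexpi (n%:~R * (s * x))).
Proof.
have me : Cmeasurable (fun x => cexpi (n%:~R * (s * x)) : C).
  by apply: Cmeas_expi; apply: measurable_funM => //; exact: meas_linP.
have ce x : sqmod (cexpi (n%:~R * (s * x)) : C) <= 1 by rewrite sqmode.
split; [exact: me|by exists 1|].
move=> f [lf hf]; split; first exact: L2_bM me ce lf.
move=> d d0; have [l hl] := hf d d0.
exists [seq (p.1 - n, p.2) | p <- l].
rewrite (_ : (fun x => _) = fun x => cexpi (n%:~R * (s * x)) * (f x - lincomb exp_on l x)).
  apply: le_lt_trans hl; rewrite -[leRHS]mul1r; apply: energy_bM => //.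
  by apply: L2B => //; apply: lincomb_L2; exact: exp_on_L2.
apply/funext => x; rewrite mulrBr; congr (_ - _); rewrite /lincomb big_map mulr_sumr.
apply: eq_bigr => p _ /=; rewrite /exp_on.
have -> : - ((p.1 - n)%:~R * (s * x)) = n%:~R * (s * x) + - (p.1%:~R * (s * x)).
  by rewrite rmorphB /=; ring.
by rewrite cexpiD; ring.
Qed.

(* On [D] this is [sin (tau x / 2) * sin ((tau x - a) / 2)], which is positive
   exactly for [tau x > a]; in the form below it is a trigonometric polynomial
   in [s * x]. *)
Let phi (a x : R) := (cos (a / 2) - cos (s * x - a / 2)) / 2.

Let multiplier_phi a : multiplier V (fun x => (phi a x)%:C%C).
Proof.
have h1 := multiplierM (multiplier_cst cV (cexpi (- (a / 2)))) (multiplier_exp 1).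
have h2 := multiplierM (multiplier_cst cV (cexpi (a / 2))) (multiplier_exp (-1)).
have := multiplierM (multiplier_cst cV ((- 4^-1)%:C)%C) (multiplierD cV h1 h2).
move=> /(multiplierD cV (multiplier_cst cV ((cos (a / 2) / 2)%:C)%C)).
congr multiplier; apply/funext => x; rewrite -!cexpiD /phi.
rewrite (_ : - (a / 2) + 1%:~R * (s * x) = s * x - a / 2); last by rewrite mul1r addrC.
rewrite (_ : a / 2 + (-1)%:~R * (s * x) = - (s * x - a / 2)); last by rewrite rmorphN mulN1r opprB.
apply: complex_ext; rewrite !cReImE ?cosN ?sinN; by field.
Qed.

Let Vray a : V (cind (D `&` tau @^-1` `]a, +oo[)).
Proof.
have VD : V (cind D).
  have := closed_span_mem exp_on_L2 0; congr closed_span; apply/funext => x.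
  by rewrite /exp_on mul0r oppr0 cexpi0 mul1r.
have [a0|a0] := ltrP a 0.
  rewrite (_ : D `&` _ = D)//; apply/seteqP; split => x; first by case.
  move=> Dx; split => //=; rewrite in_itv /= andbT.
  by have [/andP[t0 _] _] := tauD Dx; exact: lt_le_trans t0.
have [a2|a2] := lerP (2 * pi) a.
  rewrite (_ : cind _ = fun=> 0); first exact: (cs0 cV).
  apply/funext => x; rewrite cind_out// => -[Dx] /=; rewrite in_itv /= andbT.
  by have [/andP[_ t0] _] := tauD Dx; rewrite ltNge (ltW (lt_le_trans t0 a2)).
have p1 x : `|phi a x| <= 1.
  have := cos_le1 (a / 2); have := cos_geN1 (a / 2).
  have := cos_le1 (s * x - a / 2); have := cos_geN1 (s * x - a / 2).
  by move=> *; rewrite ler_norml /phi; lra.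
have [_ _ /(_ _ VD)] := multiplier_pos cV (multiplier_phi a) p1.
congr V; apply/funext => x; rewrite -cindI.
apply: cind_eq; rewrite /= in_itv /= andbT.
have E : D x -> phi a x = sin (tau x / 2) * sin (tau x / 2 - a / 2).
  move=> Dx; have [_ te] := tauD Dx; rewrite /phi.
  have c1 : cos (s * x) = cos (tau x) by exact: (congr1 cRe te).
  have c2 : sin (s * x) = sin (tau x) by exact: (congr1 cIm te).
  have -> : cos (s * x - a / 2) = cos (tau x / 2 + (tau x / 2 - a / 2)).
    by rewrite addrA -splitr !cosB c1 c2.
  have -> : cos (a / 2) = cos (tau x / 2 - (tau x / 2 - a / 2)).
    by congr cos; ring.
  by move: (tau x / 2) (tau x / 2 - a / 2) => p q; rewrite cosB cosD; field.
split=> -[].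
  rewrite /= => p0 Dx; split=> //; have [/andP[t0 t2] _] := tauD Dx.
  rewrite ltNge; apply/negP => ta; move: p0; rewrite E// ltNge => /negP; apply.
  rewrite mulr_ge0_le0//; first by apply: sin_ge0_pi; apply/andP; split; lra.
  by rewrite -oppr_ge0 -sinN; apply: sin_ge0_pi; apply/andP; split; lra.
move=> Dx ax; split=> //=; have [/andP[t0 t2] _] := tauD Dx.
by rewrite E// mulr_gt0//; apply: sin_gt0_pi; apply/andP; split; lra.
Qed.

(** For rays []a, oo[] this is [multiplier_pos] for [phi a]; Dynkin's lemma does
    the rest. *)
Lemma exp_span_dense (B : set R) : measurable B ->
  closed_span exp_on (cind (D `&` tau @^-1` B)).
Proof.
apply: (cs_preimage cV mD fD mtau _ Vray) => //.
have := closed_span_mem exp_on_L2 0; congr closed_span; apply/funext => x.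
by rewrite /exp_on mul0r oppr0 cexpi0 mul1r.
Qed.

End exponentials.
End ClosedSpan.

(** * A tiling criterion for wavelet sets *)
Section Criterion.
Context {R : realType}.
Local Notation C := R[i].
Local Notation mu := (@lebesgue_measure R).

(** A list of weighted indices may repeat an index; the weights are collected. *)
Lemma sum_regroup (I : eqType) (l : seq (I * C)) (F : I -> C) :
  \sum_(i <- undup [seq w.1 | w <- l]) (\sum_(w <- l | w.1 == i) w.2) * F i =
  \sum_(w <- l) w.2 * F w.1.
Proof.
rewrite (eq_bigr (fun i => \sum_(w <- l | w.1 == i) w.2 * F w.1)); last first.
  by move=> i _; rewrite mulr_suml; apply: eq_bigr => w /eqP ->.
rewrite (exchange_big_dep xpredT)//= [LHS]big_seq [RHS]big_seq; apply: eq_bigr => w wl.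
rewrite -big_filter (eq_filter (a2 := pred1 w.1)); last first.
  by move=> i; rewrite /= eq_sym.
rewrite filter_pred1_uniq ?undup_uniq ?big_seq1//.
by rewrite mem_undup; apply: map_f.
Qed.

Lemma cexpi_2pi (m : int) : cexpi (2 * pi * m%:~R) = 1 :> C.
Proof.
have nat (n : nat) : cexpi (2 * pi * n%:R) = 1 :> C.
  elim: n => [|n IH]; first by rewrite mulr0 cexpi0.
  rewrite -[n.+1]addn1 natrD mulrDr mulr1 cexpiD IH mul1r.
  by apply: complex_ext; rewrite !cReImE mulr_natl ?cos2pi ?sin2pi.
case: m => n; first exact: nat.
have := nat n.+1; rewrite NegzE rmorphN /= mulrN cexpiN -[n.+1%:~R]/(n.+1%:R) => ->.
by apply: complex_ext => /=; rewrite ?oppr0.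
Qed.

Lemma itv_fin (a b : R) : (mu `[a, b]%classic < +oo)%E.
Proof. by rewrite lebesgue_measure_itv /=; case: ifP => _; rewrite ?ltry// -EFinB ltry. Qed.

Lemma int_period (n : int) :
  Cintegral (fun x => cexpi (- (n%:~R * x)) * cind (`[0, 2 * pi[%classic : set R) x) =
  (2 * pi * (n == 0)%:R)%:C%C.
Proof.
have pi2 : 0 < 2 * pi :> R by rewrite mulr_gt0// pi_gt0.
have lI : L1 (fun x => cexpi (- (n%:~R * x)) * cind (`[0, 2 * pi]%classic : set R) x : C).
  have fI := itv_fin 0 (2 * pi).
  have l2 : L2 (cind (`[0, 2 * pi]%classic : set R)) := L2_ind (measurable_itv _) fI.
  apply: (L2_supp_L1 (measurable_itv (`[0, 2 * pi] : interval R)) fI).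
    by move=> x nx; rewrite cind_out// mulr0.
  apply: (@L2_bM _ 1) l2; last by move=> x; rewrite sqmode.
  by apply: Cmeas_expi; exact: meas_linM.
have mI : Cmeasurable (fun x => cexpi (- (n%:~R * x)) * cind (`[0, 2 * pi[%classic : set R) x).
  apply: CmeasM; first by apply: Cmeas_expi; exact: meas_linM.
  by apply: Cmeas_ind; exact: measurable_itv.
have [|_ ->] := L1_ae mI lI.
  exists [set 2 * pi]; split; [exact: measurable_set1|exact: lebesgue_measure_set1|].
  move=> x /= h; apply: contrapT => xn; apply: h; congr (_ * _); apply: cind_eq.
  rewrite /= !in_itv /=; split; first by move=> /andP[-> /ltW].
  by move=> /andP[-> x2]; rewrite lt_neqAle x2 andbT; apply/eqP.
have [->|n0] := eqVneq n 0.
  rewrite (_ : (fun x => _) = fun x => (\1_`[0, 2 * pi] x * 1)%:C%C); last first.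
    by apply/funext => x; rewrite mul0r oppr0 cexpi0 mul1r mulr1.
  rewrite (_ : Cintegral _ = (integR (fun x => \1_`[0, 2 * pi] x * 1))%:C%C); last first.
    by apply: complex_ext; rewrite !cReImE// /integR Rintegral_cst// mul0r.
  rewrite (@integR_itv_derive _ (fun=> 1) id) ?mulr1 ?subr0//.
  by move=> x; exact: cvg_cst.
have n0' : n%:~R != 0 :> R by rewrite intr_eq0.
have cn : cexpi (2 * pi * (- n)%:~R) = cexpi (- (n%:~R * (2 * pi))) :> C.
  by rewrite rmorphN /= mulrN mulrC.
have := cexpi_2pi (- n); rewrite cn => e2.
have c2 : cos (n%:~R * (2 * pi)) = 1 :> R by have := congr1 cRe e2; rewrite !cReImE cosN.
have s2 : sin (n%:~R * (2 * pi)) = 0 :> R.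
  by have := congr1 cIm e2; rewrite !cReImE sinN => /eqP; rewrite oppr_eq0 => /eqP.
have cM (g : R -> R) : continuous g -> continuous (fun x : R => g (n%:~R * x)).
  move=> cg x; apply: (@continuous_comp _ _ _ (fun x : R => n%:~R * x) g); last exact: cg.
  by apply: cvgM; [exact: cvg_cst|exact: cvg_id].
rewrite mulr0; apply: complex_ext; rewrite !cReImE.
- rewrite (_ : (fun x => _) = fun x => \1_`[0, 2 * pi] x * cos (n%:~R * x)); last first.
    by apply/funext => x; rewrite /cind !cReImE cosN; ring.
  have ds (x : R) : is_derive x 1 (fun x => sin (n%:~R * x) / n%:~R) (cos (n%:~R * x)).
    have dl : is_derive x 1 (fun x : R => n%:~R * x) n%:~R.
      by apply: is_derive_eq; rewrite /GRing.scale /=; ring.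
    have d0 := is_derive1_comp (is_derive_sin (n%:~R * x)) dl.
    have d1 : is_derive x 1 (fun x => sin (n%:~R * x)) (cos (n%:~R * x) * n%:~R) by exact: d0.
    by apply: is_derive_eq; rewrite /GRing.scale /=; field.
  rewrite (integR_itv_derive pi2 (cM _ (@continuous_cos R)) ds).
  by rewrite s2 mulr0 sin0 !mul0r subrr.
- rewrite (_ : (fun x => _) = fun x => \1_`[0, 2 * pi] x * - sin (n%:~R * x)); last first.
    by apply/funext => x; rewrite /cind !cReImE sinN; ring.
  have ds (x : R) : is_derive x 1 (fun x => cos (n%:~R * x) / n%:~R) (- sin (n%:~R * x)).
    have dl : is_derive x 1 (fun x : R => n%:~R * x) n%:~R.
      by apply: is_derive_eq; rewrite /GRing.scale /=; ring.
    have d0 := is_derive1_comp (is_derive_cos (n%:~R * x)) dl.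
    have d1 : is_derive x 1 (fun x => cos (n%:~R * x)) (- sin (n%:~R * x) * n%:~R) by exact: d0.
    by apply: is_derive_eq; rewrite /GRing.scale /=; field.
  have cs : continuous (fun x : R => - sin (n%:~R * x)).
    by move=> x; apply: cvgN; exact: (cM _ (@continuous_sin R)).
  by rewrite (integR_itv_derive pi2 cs ds) c2 mulr0 cos0 subrr.
Qed.

(* [K] is congruent to [[0, 2 * pi[] modulo [2 * pi] by [AB], [disj] and [KE]:
   the piece [A] stays in place, the piece [B] moves by [c].  By [Kdil] and
   [Kuniq] its dilates by powers of 2 partition the positive half-line. *)
Section tiling.
Variables (K A B : set R) (m : int).
Hypotheses (mA : measurable A) (mB : measurable B).
Hypothesis AB : forall x, A x \/ B x <-> 0 <= x < 2 * pi.
Hypothesis disj : forall x, A x -> B x -> False.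
Hypothesis m1 : (1 <= m)%R.
Let c : R := 2 * pi * m%:~R.
Hypothesis KE : forall x, K x <-> A x \/ B (x - c).
Hypothesis Kpos : forall x, K x -> 0 < x.
Hypothesis Kdil : forall x, 0 < x -> exists j : int, K ((2 ^ j)^-1 * x).
Hypothesis Kuniq : forall x (i j : int), K ((2 ^ i)^-1 * x) -> K ((2 ^ j)^-1 * x) -> i = j.

Let pi2 : 0 < 2 * pi :> R. Proof. by rewrite mulr_gt0// pi_gt0. Qed.
Let c2 : 2 * pi <= c.
Proof. by rewrite /c ler_peMr ?(ltW pi2)// (_ : 1 = 1%:~R)// ler_int. Qed.

Let measBc : measurable [set x | B (x - c)].
Proof.
rewrite (_ : [set x | _] = (fun x => x - c) @^-1` B)// -[X in measurable X]setTI.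
apply: (_ : measurable_fun setT (fun x : R => x - c)) => //.
by apply: measurable_funB.
Qed.

Let mK : measurable K.
Proof.
rewrite (_ : K = A `|` [set x | B (x - c)]); first exact: measurableU.
by apply/seteqP; split => x /KE.
Qed.

Let Kle x : K x -> 0 < x <= c + 2 * pi.
Proof.
move=> Kx; rewrite Kpos//=; move: Kx => /KE[Ax|Bx].
  have /andP[_ h] : 0 <= x < 2 * pi by apply/AB; left.
  by rewrite ler_wpDl ?(ltW h)// (le_trans (ltW pi2) c2).
have /andP[_ h] : 0 <= x - c < 2 * pi by apply/AB; right.
by move: h; lra.
Qed.

Let p (j : int) : R := 2 ^ j.
Let p0 j : 0 < p j. Proof. by rewrite exprz_gt0. Qed.
Let s j : R := (p j)^-1.
Let s0 j : 0 < s j. Proof. by rewrite invr_gt0. Qed.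
Let D j : set R := (fun x => s j * x) @^-1` K.

Let mD j : measurable (D j).
Proof. by rewrite -[X in measurable X]setTI; exact: meas_linP. Qed.

Let bound j : R := p j * (c + 2 * pi).
Let bound0 j : 0 < bound j.
Proof. by rewrite mulr_gt0// ltr_wpDl// (le_trans (ltW pi2)). Qed.

Let Dle j x : D j x -> 0 < x <= bound j.
Proof.
move=> /Kle/andP[h1 h2]; apply/andP; split; first by rewrite pmulr_rgt0 in h1.
by move: h2; rewrite /s -ler_pdivlMl ?invr_gt0// invrK.
Qed.

Let fD j : (mu (D j) < +oo)%E.
Proof.
apply: (@le_lt_trans _ _ (mu (`[0, bound j]%classic : set R))).
  apply: le_measure; rewrite ?inE//; first exact: mD.
  by move=> x /Dle/andP[h1 h2]; rewrite /= in_itv /= h2 ltW.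
by rewrite lebesgue_measure_itv /= lte_fin bound0 -EFinB ltry.
Qed.

Let q (j : int) : R := 2 `^ (j%:~R / 2).
Let q0 j : 0 < q j. Proof. exact: powR_gt0. Qed.
Let qq j : q j * q j = p j.
Proof.
rewrite /q -powRD; last by apply/implyP => _; rewrite pnatr_eq0.
by rewrite -splitr powR_intmul.
Qed.

Let z j : C := ((q j)^-1)%:C%C.
Let zz j : z j * conjc (z j) * (p j)%:C%C = 1.
Proof.
rewrite /z -qq; move: (q j) (q0 j) => a a0.
by apply: complex_ext => /=; field; rewrite gt_eqF.
Qed.

(* the Fourier transform of the wavelet with indices [jk] ([wavelet_fourier]) *)
Let ghat (jk : int * int) (x : R) : C := z jk.1 * exp_on (s jk.1) (D jk.1) jk.2 x.
Let psi : R -> C := inv_fourier (cind K).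

Let ghat_L2 jk : L2 (ghat jk).
Proof. by apply: L2Z; apply: exp_on_L2. Qed.

Let ghat_supp jk x : ~ (`[- bound jk.1, bound jk.1]%classic : set R) x -> ghat jk x = 0.
Proof.
move=> nx; rewrite /ghat /exp_on cind_out ?mulr0// => /Dle/andP[h1 h2].
apply: nx; rewrite /= in_itv /= h2 andbT (le_trans _ (ltW h1))//.
by rewrite oppr_le0 ltW.
Qed.

Let ghat_neg jk x : x <= 0 -> ghat jk x = 0.
Proof.
move=> nx; rewrite /ghat /exp_on cind_out ?mulr0// => /Dle/andP[h1 h2].
by rewrite leNgt h1 in nx.
Qed.

Let fK : (mu K < +oo)%E.
Proof.
have := fD 0; congr (mu _ < _)%E; rewrite /D /s /p expr0z invr1.
by apply/seteqP; split => x /=; rewrite mul1r.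
Qed.

Let lK : L1 (cind K).
Proof.
by apply: (L2_supp_L1 mK fK _ (L2_ind mK fK)) => x nK; rewrite cind_out.
Qed.

Let expK (h : R -> R) : measurable_fun [set: R] h -> L1 (fun x => cexpi (h x) * cind K x).
Proof.
by move=> mh; have := L1_expi mh lK; congr L1; apply/funext => x; rewrite mulrC.
Qed.

(** Dilation and translation of the inverse transform, as an affine change of
    variable in the defining integral. *)
Lemma wavelet_systemE jk : wavelet_system psi jk = inv_fourier (ghat jk).
Proof.
case: jk => j k; apply/funext => x.
rewrite /wavelet_system /psi /inv_fourier /=.
pose h y : C := cexpi ((p j * x - k%:~R) * y) * cind K y.
have lh : L1 h by apply: expK; exact: meas_linP.
have sn0 : s j != 0 by rewrite gt_eqF.
have [li ei] := L1_affine 0 sn0 lh.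
rewrite (_ : fourier1 (cind K) _ = Cintegral h); last first.
  by congr Cintegral; apply/funext => y; rewrite mulrC /h mulNr opprK.
rewrite (_ : fourier1 (ghat (j, k)) _ = z j * Cintegral (fun y => h (affine (s j) 0 y))); last first.
  rewrite -CI_Z//; congr Cintegral; apply/funext => y.
  rewrite /ghat /exp_on /h /= /affine addr0 -mulrA; congr (_ * _).
  have -> : (p j * x - k%:~R) * (s j * y) = - (k%:~R * (s j * y)) + - (- x * y).
    have : p j * s j = 1 by rewrite /s mulfV// gt_eqF.
    by move: (p j) (s j) => a b ab; rewrite mulrBl mulrACA ab; ring.
  rewrite cexpiD (_ : cind (D j) y = cind K (s j * y)); first by ring.
  by rewrite /cind !indicE.
rewrite ei gtr0_norm// /s invrK mulrCA; congr (_ * _); rewrite mulrA -/(q j); congr (_ * _).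
by rewrite /z -rmorphM /= -qq mulrA mulVf ?mul1r// gt_eqF.
Qed.

Lemma wavelet_fourier jk : is_fourier (wavelet_system psi jk) (ghat jk).
Proof.
rewrite wavelet_systemE; apply: (is_fourier_inv_fourier (bound0 jk.1) (ghat_L2 jk)).
exact: ghat_supp.
Qed.

Lemma psi_fourier : is_fourier psi (cind K).
Proof.
apply: (is_fourier_inv_fourier (bound0 0) (L2_ind mK fK)) => x nx; rewrite cind_out// => Kx.
apply: nx; have /andP[h1 h2] : 0 < x <= bound 0.
  by apply: Dle; rewrite /D /= /s /p expr0z invr1 mul1r.
by rewrite /= in_itv /= h2 andbT (le_trans _ (ltW h1))// oppr_le0 ltW.
Qed.

Lemma wavelet_hardy jk : hardy2 (wavelet_system psi jk).
Proof.
have F := wavelet_fourier jk; split; first by case: F.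
by exists (ghat jk) => //; apply/nearW => x; exact: ghat_neg.
Qed.

Lemma psi_hardy : hardy2 psi.
Proof.
have F := psi_fourier; split; first by case: F.
exists (cind K) => //; apply/nearW => x x0; rewrite cind_out// => /Kpos.
by rewrite ltNge x0.
Qed.

(** The integrand has period [2 * pi], so [B] may be moved back by [c], which
    turns [K] into [[0, 2 * pi[]. *)
Lemma int_K (n : int) : Cintegral (fun x => cexpi (- (n%:~R * x)) * cind K x) =
  (2 * pi * (n == 0)%:R)%:C%C.
Proof.
have mS (S : set R) (SP : forall x, S x -> 0 <= x < 2 * pi) : measurable S ->
    L1 (fun x => cexpi (- (n%:~R * x)) * cind S x : C).
  move=> mS; have fS : (mu S < +oo)%E.
    apply: (@le_lt_trans _ _ (mu (`[0, 2 * pi[%classic : set R))).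
      apply: le_measure; rewrite ?inE//.
    by rewrite lebesgue_measure_itv /= lte_fin pi2 -EFinB ltry.
  apply: (L2_supp_L1 mS fS) => [x nx|]; first by rewrite cind_out// mulr0.
  apply: (@L2_bM _ 1) (L2_ind mS fS); last by move=> x; rewrite sqmode.
  by apply: Cmeas_expi; exact: meas_linM.
have lA := mS A (fun x h => (AB x).1 (or_introl h)) mA.
have lB := mS B (fun x h => (AB x).1 (or_intror h)) mB.
have [lB' eB] := L1_affine (- c) (oner_neq0 R) lB.
rewrite -int_period.
transitivity (Cintegral (fun x => cexpi (- (n%:~R * x)) * cind A x +
    cexpi (- (n%:~R * affine 1 (- c) x)) * cind B (affine 1 (- c) x))).
  congr Cintegral; apply/funext => x.
  have -> : cexpi (- (n%:~R * affine 1 (- c) x)) = cexpi (- (n%:~R * x)) :> C.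
    rewrite /affine mul1r mulrBr opprB addrC cexpiD.
    rewrite (_ : n%:~R * c = 2 * pi * (n * m)%:~R); last by rewrite /c rmorphM /=; ring.
    by rewrite cexpi_2pi mulr1.
  rewrite -mulrDr /affine mul1r; congr (_ * _).
  have [Ax|nA] := pselect (A x).
    rewrite (cind_in Ax) cind_in; last by apply/KE; left.
    rewrite cind_out ?addr0// => Bx.
    have /andP[_ h] := (AB x).1 (or_introl Ax).
    have /andP[h' _] := (AB (x - c)).1 (or_intror Bx).
    by move: h h' c2; lra.
  rewrite (cind_out nA) add0r; have [Bx|nB] := pselect (B (x - c)).
    by rewrite !cind_in//; apply/KE; right.
  by rewrite !cind_out// => /KE[].
rewrite CI_D// eB normr1 invr1 rmorph1 mul1r -CI_D//.
congr Cintegral; apply/funext => x; rewrite -mulrDr; congr (_ * _).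
have [Ax|nA] := pselect (A x).
  rewrite (cind_in Ax) cind_out ?addr0; last exact: disj.
  by rewrite cind_in//= in_itv /=; apply/AB; left.
rewrite (cind_out nA) add0r; apply: cind_eq; rewrite /= in_itv /= -AB.
by split=> [|[]]//; right.
Qed.

(** By [parseval] the inner products are computed on the Fourier side: different
    scales have disjoint supports, and one scale is a dilate of [int_K]. *)
Lemma wavelet_orthonormal jk jk' :
  Cinner (wavelet_system psi jk) (wavelet_system psi jk') = (jk == jk')%:R.
Proof.
have pi0 : (2 * pi)%:C%C != 0 :> C.
  by apply/eqP => /(congr1 cRe) /=; apply/eqP; rewrite gt_eqF.
apply: (mulfI pi0); rewrite -(parseval (wavelet_fourier jk) (wavelet_fourier jk')).
case: jk jk' => [j k] [j' k']; rewrite /Cinner.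
have [jj|jj] := eqVneq j j'; last first.
  rewrite (_ : (fun x => _) = fun=> 0); last first.
    apply/funext => x.
    have [Dx|nD] := pselect (D j x); last by rewrite /ghat /exp_on (cind_out nD) !(mulr0, mul0r).
    have [Dx'|nD'] := pselect (D j' x).
      by case/negP: jj; apply/eqP; exact: Kuniq Dx Dx'.
    rewrite (_ : ghat (j', k') x = 0) ?conjc0 ?mulr0//.
    by rewrite /ghat /exp_on (cind_out nD') !mulr0.
  rewrite (_ : (_ == _) = false); last first.
    by apply/negbTE; apply: contra jj => /eqP[->].
  by rewrite mulr0; apply: complex_ext; rewrite !cReImE /integR Rintegral_cst// mul0r.
subst j'.
pose h x : C := cexpi (- ((k - k')%:~R * x)) * cind K x.
have lh : L1 h by apply: expK; exact: meas_linM.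
have sn0 : s j != 0 by rewrite gt_eqF.
have [li ei] := L1_affine 0 sn0 lh.
rewrite (_ : (fun x => _) = fun x => (z j * conjc (z j)) * h (affine (s j) 0 x)); last first.
  apply/funext => x; rewrite /affine addr0 /h.
  have gE i : ghat (j, i) x = z j * (cexpi (- (i%:~R * (s j * x))) * cind K (s j * x)).
    by rewrite /ghat /exp_on /= /cind !indicE.
  rewrite !gE.
  have -> : - ((k - k')%:~R * (s j * x)) = - (k%:~R * (s j * x)) + k'%:~R * (s j * x).
    by rewrite rmorphB /=; ring.
  have conjM (a b : C) : conjc (a * b) = conjc a * conjc b by exact: rmorphM.
  rewrite cexpiD 2!conjM -(cexpiN (- _)) opprK.
  have [Kx|nK] := pselect (K (s j * x)).
    by rewrite (cind_in Kx) conjc1; ring.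
  by rewrite (cind_out nK) conjc0; ring.
rewrite CI_Z// ei int_K gtr0_norm// /s invrK mulrA zz mul1r rmorphM.
congr (_ * _); rewrite xpair_eqE eqxx /= subr_eq0.
by case: (k == k').
Qed.

Let W := closed_span ghat.
Let cW : closed_subspace W. Proof. exact: closed_span_cs ghat_L2. Qed.

Let exp_on_W j k : W (exp_on (s j) (D j) k).
Proof.
have := csZ cW ((q j)%:C)%C (closed_span_mem ghat_L2 (j, k)).
congr W; apply/funext => x; rewrite /ghat mulrA /z -rmorphM mulfV ?gt_eqF//.
by rewrite rmorph1 mul1r.
Qed.

(* on [D j], the residue modulo [2 * pi] of the rescaled variable *)
Let tau j x : R := s j * x - c * \1_(`[2 * pi, +oo[%classic : set R) (s j * x).

Let mtau j : measurable_fun setT (tau j).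
Proof.
apply: measurable_funB; first exact: meas_linP.
apply: measurable_funM => //; apply: measurableT_comp; last exact: meas_linP.
by apply: measurable_indic; exact: measurable_itv.
Qed.

Let tauA j x : A (s j * x) -> tau j x = s j * x.
Proof.
move=> Ax; rewrite /tau indicE memNset ?mulr0 ?subr0//= in_itv /= andbT.
have /andP[_ h] := (AB _).1 (or_introl Ax).
by apply/negP; rewrite -ltNge.
Qed.

Let tauB j x : B (s j * x - c) -> tau j x = s j * x - c.
Proof.
move=> Bx; rewrite /tau indicE mem_set ?mulr1//= in_itv /= andbT.
have /andP[h _] := (AB _).1 (or_intror Bx).
by move: h c2; lra.
Qed.

Let tauD j x : D j x -> 0 <= tau j x < 2 * pi /\ cexpi (s j * x) = cexpi (tau j x) :> C.
Proof.
move=> /KE[Ax|Bx].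
  by rewrite tauA//; split=> //; apply/AB; left.
rewrite tauB//; split; first by apply/AB; right.
by rewrite -[in LHS](subrK c (s j * x)) cexpiD cexpi_2pi mulr1.
Qed.

(* A Borel subset of [D j] is the preimage under [tau j] of the union of its
   parts over [A] and over [B], both moved into [[0, 2 * pi[]; that preimage is
   covered by [exp_span_dense]. *)
Let W_piece j (X : set R) : measurable X -> W (cind (D j `&` X)).
Proof.
move=> mX; have pK y : p j * (s j * y) = y.
  by rewrite /s mulrA mulfV ?mul1r// gt_eqF.
pose Y := (A `&` (fun y => p j * y) @^-1` X) `|`
  (B `&` (fun y => p j * (y + c)) @^-1` X).
have mY : measurable Y.
  apply: measurableU; apply: measurableI => //; rewrite -[X in measurable X]setTI.
    exact: meas_linP.
  have mf : measurable_fun [set: R] (fun y => p j * (y + c)).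
    by apply: measurable_funM => //; apply: measurable_funD.
  exact: mf.
have -> : D j `&` X = D j `&` tau j @^-1` Y.
  apply/seteqP; split=> x [Dx xX]; split => //; move/KE: (Dx) => [Ax|Bx].
  - by left; rewrite tauA//; split=> //=; rewrite pK.
  - by right; rewrite tauB//; split=> //=; rewrite subrK pK.
  - move: xX; rewrite /= tauA// => -[[_]|[Bx _]] /=; first by rewrite pK.
    by case: (disj Ax Bx).
  - move: xX; rewrite /= tauB// => -[[Ax _]|[_]] /=; last by rewrite subrK pK.
    by case: (disj Ax Bx).
apply: (closed_span_sub cW (@exp_on_W j)).
exact: (exp_span_dense (mD j) (fD j) (@mtau j) (@tauD j) mY).
Qed.

(* The sets [D j] are taken in the order of an enumeration [e] of the integers,
   which may have repetitions: [U n] collects those met before [n], and each step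
   adds only the part of [D (e n)] outside [U n]. *)
Let W_pos (B0 : set R) : measurable B0 -> B0 `<=` `]0, +oo[ -> (mu B0 < +oo)%E ->
  W (cind B0).
Proof.
move=> mB0 B0pos fB0; pose e n : int := odflt 0 (unpickle n).
pose U n := \big[setU/set0]_(i < n) D (e i).
have mU n : measurable (U n) by apply: bigsetU_measurable => i _; exact: mD.
have WU n : W (cind (U n `&` B0)).
  elim: n => [|n IH].
    rewrite (_ : cind _ = fun=> 0); first exact: (cs0 cW).
    by apply/funext => x; rewrite cind_out// /U big_ord0 => -[].
  have := csD cW IH (W_piece (e n) (measurableD mB0 (mU n))).
  congr W; apply/funext => x; rewrite /U big_ord_recr /= -/(U n).
  have [Bx|nB] := pselect (B0 x); last first.
    by rewrite !cind_out ?addr0// => -[]// _ [].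
  have [Ux|nU] := pselect (U n x).
    rewrite (@cind_in _ (U n `&` B0))// (@cind_in _ (_ `&` B0)); last by split=> //; left.
    by rewrite cind_out ?addr0// => -[_ []].
  rewrite cind_out ?add0r; last by case.
  by apply: cind_eq; split=> -[]; [move=> Dx _; split=> //; right|case].
have lB0 := L2_ind mB0 fB0.
apply: (cs_cvg cW WU lB0); apply: (energy_dominated (G := \1_B0)).
- by move=> n; apply: Cmeas_ind; exact: measurableI.
- by case: lB0.
- apply/nearW => x; have [Bx|nB] := pselect (B0 x); last first.
    apply: (@cvgn_ext _ (fun=> 0)); last exact: cvg_cst.
    by move=> n; rewrite !cind_out ?subr0 ?sqmod0// => -[].
  have [j Kj] : exists j : int, D j x.
    by apply: Kdil; have := B0pos _ Bx; rewrite /= in_itv /= andbT.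
  apply: (cvg_near_cst); exists (pickle j).+1 => // n /= jn; apply/eqP.
  rewrite !cind_in ?subrr ?sqmod0//; split=> //.
  rewrite /U -(bigcup_mkord n (fun i => D (e i))).
  by exists (pickle j) => //=; rewrite /e pickleK.
- exact: integrableR_indic.
- move=> n x; rewrite indicE; have [Bx|nB] := pselect (B0 x).
    rewrite mem_set// (cind_in Bx); have [Ux|nU] := pselect (U n x).
      by rewrite cind_in// subrr sqmod0 ler01.
    by rewrite cind_out ?sub0r ?sqmodN ?sqmodR ?expr1n//; case.
  by rewrite memNset// !cind_out// ?subr0 ?sqmod0//; case.
Qed.

Let W_all g : L2 g -> {ae mu, forall x, x <= 0 -> g x = 0} -> W g.
Proof.
move=> lg g0; have mP : measurable (`]0, +oo[%classic : set R) by exact: measurable_itv.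
have lg0 : L2 (fun x => cind (`]0, +oo[%classic : set R) x * g x).
  by apply: (@L2_bM _ 1) lg; [exact: Cmeas_ind|exact: sqmod_cind].
apply: (cs_ae cW lg (g := fun x => cind (`]0, +oo[%classic : set R) x * g x)).
  by apply: (cs_dense cW W_pos lg0) => x nx; rewrite cind_out ?mul0r.
apply: ae_imply g0 => x g0; have [x0|x0] := lerP x 0.
  by rewrite g0// mulr0.
by rewrite cind_in ?mul1r//= in_itv /= x0.
Qed.

(** Plancherel's theorem transfers the density of the span of the transforms,
    [W_all], to the wavelets. *)
Lemma wavelet_complete f : hardy2 f -> forall d : R, 0 < d ->
  exists (l : seq (int * int)) (a : int * int -> C),
    (CLnorm 2%:E (fun x => f x - \sum_(i <- l) a i * wavelet_system psi i x)%R < d%:E)%E.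
Proof.
move=> [_ [g fg g0]] d d0; have lg : L2 g by case: fg => _ /CLp2P.
have d2 : 0 < 2 * pi * d ^+ 2 by rewrite mulr_gt0// exprn_gt0.
have [_ /(_ _ d2)[l hl]] := W_all lg g0.
pose a i := \sum_(w <- l | w.1 == i) w.2.
exists (undup [seq w.1 | w <- l]), a.
rewrite (_ : (fun x => _) = fun x => f x - \sum_(w <- l) w.2 * wavelet_system psi w.1 x).
  have F := is_fourierB fg (is_fourier_sum l
    (fun w => is_fourierZ w.2 (wavelet_fourier w.1))).
  have lF : L2 (fun x => f x - \sum_(w <- l) w.2 * wavelet_system psi w.1 x).
    by case: F => /CLp2P.
  have {}hl : 2 * pi * energy (fun x => f x - \sum_(w <- l) w.2 * wavelet_system psi w.1 x) <
      2 * pi * d ^+ 2 by rewrite -(plancherel F).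
  rewrite (CLnorm2_energy lF) lte_fin -[ltRHS]ger0_norm ?(ltW d0)// -sqrtr_sqr.
  by rewrite ltr_sqrt ?exprn_gt0// -(ltr_pM2l pi2).
apply/funext => x; congr (_ - _).
exact: sum_regroup.
Qed.

(** The indicator matters only up to null sets, so the wavelet is built from a
    Borel set with an exact tiling and serves for [K0] as well. *)
Lemma tiling_hardy2_wavelet_set (K0 : set R) : completed_algebra_gen mu K0 ->
  K0 `<=` [set x | 0 < x] -> {ae mu, forall x, K0 x <-> K x} ->
  hardy2_wavelet_set K0.
Proof.
move=> mK0 pK0 KK; split=> //; exists psi.
  split; first exact: psi_hardy.
  by split; [exact: wavelet_hardy|exact: wavelet_orthonormal|exact: wavelet_complete].
exists (cind K); first exact: psi_fourier.
apply: ae_imply KK => x KK; have [Kx|nK] := pselect (K x).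
  by rewrite (cind_in Kx) indicE mem_set ?cmodR ?normr1//; apply/KK.
by rewrite (cind_out nK) indicE memNset ?cmodR ?normr0// => /KK.
Qed.

End tiling.
End Criterion.

(** * The set K_{r,eps} *)
Section Octaves.
Context {R : realType}.

Lemma octave_exists (a x : R) : 0 < a -> 0 < x ->
  exists k : int, a <= (2 ^ k)^-1 * x < 2 * a.
Proof.
move=> a0 x0; pose L := ln (x / a) / ln 2.
have l2 : 0 < ln 2 :> R by rewrite ln_gt0// ltr1n.
have xa : 0 < x / a by rewrite divr_gt0.
have LE : 2 `^ L = x / a by rewrite /powR pnatr_eq0 /= mulfVK ?lnK ?gt_eqF.
have /andP[h1 h2] := floor_itv L; exists (Num.floor L).
have p0 : 0 < (2 : R) ^ Num.floor L by rewrite exprz_gt0.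
have : (2 : R) ^ Num.floor L <= x / a < 2 ^ (Num.floor L + 1).
  rewrite -LE -!powR_intmul// ler_powR ?ler1n//=.
  by rewrite /powR pnatr_eq0 /= ltr_expR ltr_pM2r.
move=> /andP[]; rewrite ler_pdivlMr// ltr_pdivrMr// exprzDr ?expr1z ?unitfE ?pnatr_eq0// => u v.
rewrite mulrC ler_pdivlMr// ltr_pdivrMr// mulrC u /=.
by move: v; rewrite mulrC (mulrC _ 2) mulrA (mulrC a).
Qed.

Lemma octave_unique (a y : R) (j k : int) : 0 < a -> a <= y < 2 * a ->
  a * 2 ^ k <= 2 ^ j * y < 2 * a * 2 ^ k -> j = k.
Proof.
move=> a0 /andP[y1 y2] /andP[h1 h2].
have p0 (i : int) : 0 < (2 : R) ^ i by rewrite exprz_gt0.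
have two (i : int) : (2 : R) * 2 ^ i = 2 ^ (i + 1)
  by rewrite exprzDr ?expr1z ?unitfE ?pnatr_eq0// mulrC.
have lt12 : 1 < 2 :> R by rewrite ltr1n.
have kj : k < j + 1.
  rewrite -(ltr_eXz2l lt12) -two -(ltr_pM2l a0); apply: le_lt_trans h1 _.
  by rewrite mulrC (mulrA a) (mulrC a) ltr_pM2r.
have jk : j < k + 1.
  rewrite -(ltr_eXz2l lt12) -two -(ltr_pM2l a0) (mulrA a) (mulrC a 2).
  by apply: le_lt_trans h2; rewrite mulrC ler_pM2l.
by apply/eqP; rewrite eq_le -!ltzD1 jk kj.
Qed.

Lemma affine_image_itv (k d a b : R) : 0 < k ->
  affine_image k d (`[a, b]%classic : set R) = `[k * a + d, k * b + d]%classic.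
Proof.
move=> k0; apply/seteqP; split=> x /=; rewrite in_itv /=.
  by move=> [y]; rewrite /= in_itv /= => /andP[h1 h2] <-; rewrite !lerD2r !ler_pM2l// h1.
move=> /andP[h1 h2]; exists ((x - d) / k); last by rewrite mulrC divfK ?subrK ?gt_eqF.
by rewrite /= in_itv /= ler_pdivlMr// ler_pdivrMr// lerBrDr lerBlDr !(mulrC _ k) h1.
Qed.

End Octaves.

Section Iterates.
Context {R : realType}.
Variables (r : nat) (eps : R).
Hypothesis r1 : (1 <= r)%N.
Hypothesis epsP : 0 < eps < (2 ^+ r - 1) / (2 ^+ r.+1 - 1) * pi.

Let N : R := 2 ^+ r.+1.
Let T : R := t_ r.
Let c : R := N * pi.

Let N4 : 4 <= N.
Proof.
rewrite /N (_ : 4 = 2 ^+ 2); last by rewrite expr2 -natrM.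
by rewrite ler_weXn2l ?ler1n.
Qed.

(* the fixed point equation of [w |-> pi + w / N], the map that, up to a power
   of 2, takes the end points of one piece to those of the next ([endpointS]) *)
Let TE : T = pi + N^-1 * T.
Proof.
rewrite /T /t_ -/N; move: N4 (pi : R) => N4' P; field.
by rewrite subr_eq0 !gt_eqF//; lra.
Qed.

Let T_lt : pi < T < 2 * pi.
Proof.
have pi0 : 0 < pi :> R := pi_gt0 R.
have T0 : 0 < T by rewrite /T /t_ -/N mulr_gt0// divr_gt0//; move: N4; lra.
have h : N^-1 * T <= 4^-1 * T.
  by rewrite ler_pM2r// lef_pV2 ?posrE//; move: N4; lra.
have h0 : 0 < N^-1 * T by rewrite mulr_gt0// invr_gt0; move: N4; lra.
by move: TE; lra.
Qed.

Let eps0 : 0 < eps. Proof. by case/andP: epsP. Qed.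

Let eps_lt : T / 2 + eps < pi.
Proof.
have [_ h] := andP epsP; apply: lt_le_trans (ler_ltD (lexx _) h) _.
have NE : 2 ^+ r.+1 = 2 * 2 ^+ r :> R by rewrite exprS.
rewrite /T /t_ le_eqVlt; apply/orP; left; apply/eqP; rewrite NE.
have : 2 * 2 ^+ r - 1 != 0 :> R by rewrite -NE subr_eq0 gt_eqF//; move: N4; rewrite /N; lra.
by move: (2 ^+ r) (pi : R) => M P M0; field.
Qed.

(** The recursion on end points of intervals: [E_ r eps n] is the interval from
    [endpoint a n + c] to [endpoint b n + c], and [F_ r eps n] the one from
    [endpoint a n.+1] to [endpoint b n.+1], where [a] and [b] are the end points
    of [S1 r eps], which plays the part of an F with index -1. *)
Fixpoint endpoint (x : R) (n : nat) : R :=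
  if n is m.+1 then 2 ^- (m + r + 2) * (endpoint x m + 2 ^+ r.+1 * pi) else x.

Let p2 (n : nat) : 0 < 2 ^- n :> R. Proof. by rewrite invr_gt0 exprn_gt0. Qed.
Let N0 : 0 < N. Proof. by move: N4; lra. Qed.
Let pi0 : 0 < pi :> R := pi_gt0 R.

Let endpointS x m : endpoint x m.+1 = 2 ^- m.+1 * (pi + N^-1 * endpoint x m).
Proof.
rewrite /= (_ : m + r + 2 = m.+1 + r.+1)%N; last by rewrite addnAC addn2 addSnnS addnS addSn.
have : N != 0 by rewrite gt_eqF.
have : (2 : R) ^+ m.+1 != 0 by rewrite expf_neq0// pnatr_eq0.
rewrite exprD -/N; move: N (2 ^+ m.+1 : R) (endpoint x m) (pi : R) => n M g P M0 n0; field.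
by rewrite n0 M0.
Qed.

Let endpoint_range x n : 0 <= x <= T -> 0 <= endpoint x n <= T.
Proof.
move=> xT; elim: n => [//|n /andP[h1 h2]]; rewrite endpointS.
have h0 : 0 <= N^-1 * endpoint x n by rewrite mulr_ge0// invr_ge0 ltW.
have hT : N^-1 * endpoint x n <= N^-1 * T by rewrite ler_pM2l ?invr_gt0.
apply/andP; split; first by apply: mulr_ge0; [exact: ltW|apply: addr_ge0 => //; exact: ltW].
apply: (@le_trans _ _ (1 * (pi + N^-1 * endpoint x n))); last by rewrite mul1r; move: TE; lra.
rewrite ler_wpM2r//; first by move: pi0; lra.
by rewrite invf_le1 ?exprn_gt0// exprn_ege1// ler1n.
Qed.

(* places F_n in the interval [[pi, T]] dilated by [2 ^- n.+1], so that these
   sets lie in different octaves *)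
Let endpoint_octave x n : 0 <= x <= T -> 2 ^- n.+1 * pi <= endpoint x n.+1 <= 2 ^- n.+1 * T.
Proof.
move=> /endpoint_range - /(_ n)/andP[h1 h2]; rewrite endpointS !ler_pM2l//.
have h0 : 0 <= N^-1 * endpoint x n by rewrite mulr_ge0// invr_ge0 ltW.
have hT : N^-1 * endpoint x n <= N^-1 * T by rewrite ler_pM2l ?invr_gt0.
by apply/andP; split; move: TE; lra.
Qed.

Let a : R := T / 2 + eps / N.
Let b : R := T / 2 + eps.
(* Half-open versions of S_1 (for [n = 0]) and F_{n-1}; only with these are the
   partitions below exact. *)
Let I (n : nat) (w : R) := endpoint a n <= w < endpoint b n.

Let aT : 0 <= a <= T.
Proof.
have h : eps / N <= eps by rewrite ler_pdivrMr// ler_peMr ?ltW//; move: N4; lra.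
have h' : 0 < eps / N by rewrite divr_gt0.
by rewrite /a; move: T_lt eps_lt; lra.
Qed.
Let bT : 0 <= b <= T. Proof. by rewrite /b; move: T_lt eps_lt eps0; lra. Qed.

Let I0P w : I 0 w -> T / 2 < w < pi.
Proof.
have h' : 0 < eps / N by rewrite divr_gt0.
by rewrite /I /= /a /b; move: eps_lt; lra.
Qed.

Let ISP n w : I n.+1 w -> 2 ^- n.+1 * pi <= w < 2 ^- n.+1 * T.
Proof.
rewrite /I => /andP[h1 h2]; have /andP[h3 _] := endpoint_octave n aT.
have /andP[_ h4] := endpoint_octave n bT.
by rewrite (le_trans h3 h1) (lt_le_trans h2 h4).
Qed.

Let I_lt_pi n w : I n w -> 0 < w < pi.
Proof.
case: n => [/I0P|n /ISP/andP[h1 h2]]; first by move: T_lt; lra.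
rewrite (lt_le_trans _ h1) ?mulr_gt0//= (lt_le_trans h2)//.
apply: (@le_trans _ _ (2^-1 * T)); last by move: T_lt; lra.
rewrite ler_pM2r ?lef_pV2 ?posrE ?exprn_gt0//; last by move: T_lt; lra.
by rewrite exprS ler_peMr// exprn_ege1// ler1n.
Qed.

Let I_lt m n w : (m < n)%N -> I m w -> I n w -> False.
Proof.
case: n => // n; rewrite ltnS => mn Im /ISP/andP[_ h].
have hm : 2 ^- n.+1 * T <= 2 ^- m.+1 * T.
  rewrite ler_pM2r; last by move: T_lt; lra.
  by rewrite lef_pV2 ?posrE ?exprn_gt0// ler_weXn2l ?ler1n.
case: m mn Im hm => [|m] mn Im hm.
  by have := I0P Im; move: hm h; rewrite expr1; lra.
have /andP[h' _] := ISP Im.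
have uT : 2 ^- m.+1 * T < 2 ^- m.+1 * (2 * pi) by rewrite ltr_pM2l//; case/andP: T_lt.
have e2 : 2 ^- m.+2 * T = 2^-1 * (2 ^- m.+1 * T) by rewrite (exprS _ m.+1) invfM -mulrA.
by move: hm h h' uT; rewrite e2; lra.
Qed.

Let I_inj m n w : I m w -> I n w -> m = n.
Proof.
by move=> Im In; have [h|h|//] := ltngtP m n; [case: (I_lt h Im In)|case: (I_lt h In Im)].
Qed.

(* F_m is the dilate of E_m, which is F_{m-1} translated. *)
Let I_shift m y : I m.+1 (2 ^- m.+1 * y) <-> I m (N * (y - pi)).
Proof.
rewrite /I !endpointS ler_pM2l// ltr_pM2l// -lerBrDl -ltrBlDl.
by rewrite -(ler_pM2l N0) -(ltr_pM2l N0) !mulrA !mulfV ?gt_eqF// !mul1r.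
Qed.

Let U : set R := [set x | exists n, I n x].
Let A : set R := U `|` [set x | T + 2 * eps <= x < 2 * pi].
Let B : set R := [set x | 0 <= x < T + 2 * eps] `\` U.
Let K x := A x \/ B (x - c).

Let mI n : measurable [set x | I n x].
Proof.
rewrite (_ : [set x | _] = `[endpoint a n, endpoint b n[%classic); first exact: measurable_itv.
by apply/seteqP; split=> x; rewrite /= in_itv.
Qed.

Let mU : measurable U.
Proof.
rewrite (_ : U = \bigcup_n [set x | I n x]); first exact: bigcupT_measurable.
by apply/seteqP; split=> x [n]; [exists n|move=> _; exists n].
Qed.

Let mco (u v : R) : measurable [set x | u <= x < v].
Proof.
rewrite (_ : [set x | _] = `[u, v[%classic); first exact: measurable_itv.
by apply/seteqP; split=> x; rewrite /= in_itv.
Qed.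

Let mA : measurable A. Proof. exact: measurableU. Qed.
Let mB : measurable B. Proof. exact: measurableD. Qed.

Let UP x : U x -> 0 < x < pi. Proof. by case=> n /I_lt_pi. Qed.

Let AB x : A x \/ B x <-> 0 <= x < 2 * pi.
Proof.
split=> [[[/UP|/=]|[/= h _]]|h]; [|move: T_lt eps_lt eps0; lra..|].
  by move: pi0; lra.
have [Ux|nU] := pselect (U x); first by left; left.
have [hx|hx] := lerP (T + 2 * eps) x; first by left; right; rewrite /= hx; case/andP: h.
by right; split => //=; rewrite hx andbT; case/andP: h.
Qed.

Let disj x : A x -> B x -> False.
Proof. by case=> [Ux [_]|/= h [/= h' _]]; [exact|lra]. Qed.

Let Kpos x : K x -> 0 < x.
Proof.
have c0 : 0 < c by rewrite mulr_gt0.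
by case=> [[/UP/andP[]//|/=]|[/= h _]]; move: T_lt eps0 c0 pi0; lra.
Qed.

(* Where the dilates of the pieces of [K] lie in the octave [[pi, 2 * pi[].  The
   pieces are S_2, S_1, F_m, and the part of J_r and S_3 outside all the E_n; the
   four alternatives exclude each other. *)
Let Koctave y (j : int) : pi <= y < 2 * pi -> K (2 ^ j * y) ->
  [\/ j = 0 /\ T + 2 * eps <= y,
      j = - 1 /\ T + 2 * (eps / N) <= y < T + 2 * eps,
      exists2 m, j = - (m.+1)%:Z & I m (N * (y - pi)) |
      [/\ j = r.+1, 0 <= N * (y - pi) < T + 2 * eps & ~ U (N * (y - pi))]].
Proof.
move=> yP; have oct k := @octave_unique R pi y j k pi0 yP.
case=> [[[[|m] Im]|/= h]|[/= h nU]].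
- have j1 : j = -1.
    by apply: oct; rewrite exprN1; have := I0P Im; move: T_lt; lra.
  constructor 2; split=> //; move: Im; rewrite j1 exprN1 /I /= /a /b; lra.
- have jm : j = - m.+1%:Z.
    apply: oct; rewrite -exprnN; have := ISP Im; move: T_lt (p2 m.+1).
    by move: (2 ^- m.+1 : R) (2 ^ j * y) => u v; nra.
  by constructor 3; exists m => //; apply/I_shift; rewrite exprnN -jm.
- have j0 : j = 0.
    by apply: oct; rewrite expr0z; move: T_lt eps0; lra.
  by constructor 1; split=> //; move: h; rewrite j0 expr0z mul1r; lra.
- have cE : 2 * c = 2 * pi * N by rewrite /c; ring.
  have jr : j = r.+1.
    apply: oct; rewrite -exprnP -/N; move: h T_lt eps_lt N4 cE.
    have : 4 * pi <= c by rewrite /c ler_pM2r.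
    by rewrite /c (mulrC N); lra.
  have wE : N * (y - pi) = 2 ^ j * y - c by rewrite jr -exprnP -/N mulrBr.
  by constructor 4; rewrite wE.
Qed.

Let Kdil1 y : pi <= y < 2 * pi -> exists j : int, K (2 ^ j * y).
Proof.
move=> yP; have [h1|h1] := lerP (T + 2 * eps) y.
  by exists 0; left; right; rewrite /= expr0z mul1r h1; case/andP: yP.
have [h2|h2] := lerP (T + 2 * (eps / N)) y.
  exists (-1); left; left; exists 0; rewrite /I /= exprN1 /a /b; lra.
have w0 : 0 <= N * (y - pi).
  by apply: mulr_ge0; [exact: ltW|rewrite subr_ge0; case/andP: yP].
have wlt : N * (y - pi) < T + 2 * eps.
  have : N * (y - pi) < N * (T + 2 * (eps / N) - pi) by rewrite ltr_pM2l// ltrD2r.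
  congr (_ < _); rewrite {1}TE; have : N != 0 by rewrite gt_eqF.
  by move: N T eps (pi : R) => n t e P n0; field.
have [[m Im]|nU] := pselect (U (N * (y - pi))).
  by exists (- m.+1%:Z); left; left; exists m.+1; rewrite -exprnN; apply/I_shift.
exists r.+1; right; rewrite -exprnP -/N (_ : N * y - c = N * (y - pi)); last by rewrite mulrBr.
by split=> //=; rewrite w0.
Qed.

Let Kuniq1 y (i j : int) : pi <= y < 2 * pi -> K (2 ^ i * y) -> K (2 ^ j * y) -> i = j.
Proof.
have h' : 0 < eps / N by rewrite divr_gt0.
have wlt : N * (y - pi) < T + 2 * eps -> y < T + 2 * (eps / N).
  move=> h; rewrite -(ltr_pM2l N0) -[ltLHS](subrK c); move: h; rewrite mulrBr => h.
  rewrite (_ : N * (T + 2 * (eps / N)) = (T + 2 * eps) + c); first by rewrite ltrD2r.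
  have : N != 0 by rewrite gt_eqF.
  by rewrite /c mulrDr {1}TE; move: N T eps (pi : R) => n t e P n0; field.
have eN : eps / N <= eps by rewrite ler_pdivrMr// ler_peMr ?ltW//; move: N4; lra.
have Iw m : I m (N * (y - pi)) -> y < T + 2 * (eps / N).
  by move=> /I_lt_pi h; apply: wlt; move: h T_lt eps0; lra.
move=> yP /(Koctave yP) Ki /(Koctave yP).
case: Ki => [[-> hi]|[-> hi]|[m -> Hm]|[-> hi nU]];
  case=> [[-> hj]|[-> hj]|[m' -> Hm']|[-> hj nU']] //.
- by exfalso; lra.
- by exfalso; have := Iw _ Hm'; lra.
- by exfalso; have /andP[_ /wlt] := hj; lra.
- by exfalso; lra.
- by exfalso; have := Iw _ Hm'; lra.
- by exfalso; have /andP[_ /wlt] := hj; lra.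
- by exfalso; have := Iw _ Hm; lra.
- by exfalso; have := Iw _ Hm; lra.
- by rewrite (I_inj Hm Hm').
- by case: nU'; exists m.
- by exfalso; have /andP[_ /wlt] := hi; lra.
- by exfalso; have /andP[_ /wlt] := hi; lra.
- by case: nU; exists m'.
Qed.

Let Kdil x : 0 < x -> exists j : int, K ((2 ^ j)^-1 * x).
Proof.
move=> x0; have [k yP] := octave_exists pi0 x0; have [j Kj] := Kdil1 yP.
exists (k - j); rewrite invr_expz opprB exprzDr ?unitfE ?pnatr_eq0//.
by rewrite -invr_expz -mulrA.
Qed.

Let Kuniq x (i j : int) : K ((2 ^ i)^-1 * x) -> K ((2 ^ j)^-1 * x) -> i = j.
Proof.
have p0 (k : int) : 0 < (2 : R) ^ k by rewrite exprz_gt0.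
move=> Ki Kj; have x0 : 0 < x by have := Kpos Ki; rewrite pmulr_rgt0 ?invr_gt0.
have [k yP] := octave_exists pi0 x0.
have E l : (2 ^ l)^-1 * x = 2 ^ (k - l) * ((2 ^ k)^-1 * x).
  by rewrite exprzDr ?unitfE ?pnatr_eq0// -invr_expz mulrACA mulfV ?mul1r ?gt_eqF.
move: Ki Kj; rewrite (E i) (E j) => Ki Kj; have e := Kuniq1 yP Ki Kj.
by apply: oppr_inj; exact: (addrI k e).
Qed.

Let E_itv n : E_ r eps n = `[endpoint a n + c, endpoint b n + c]%classic.
Proof.
elim: n => [|n IH]; first by rewrite /= affine_image_itv// !mul1r.
by rewrite /= IH affine_image_itv// affine_image_itv// !mul1r !addr0.
Qed.

Let F_itv n : F_ r eps n = `[endpoint a n.+1, endpoint b n.+1]%classic.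
Proof. by rewrite /F_ E_itv affine_image_itv// !addr0. Qed.

Let S1E : S1 r eps = `[endpoint a 0, endpoint b 0]%classic. Proof. by []. Qed.

Let cT : 2 ^+ r.+1 * T = c + T.
Proof.
rewrite {1}TE /c -/N mulrDr mulrA mulfV ?mul1r ?gt_eqF//.
Qed.

Let mK0 : measurable (K_ r eps).
Proof.
apply: measurableU; last by apply: measurableU; [apply: measurableU|]; exact: measurable_itv.
apply: measurableU; last first.
  by apply: bigcupT_measurable => n; rewrite F_itv; exact: measurable_itv.
apply: measurableD; first exact: measurable_itv.
by apply: bigcupT_measurable => n; rewrite E_itv; exact: measurable_itv.
Qed.

(* the right end points, at which the closed intervals differ from the half-open ones *)
Let ends : set R := \bigcup_n [set endpoint b n; endpoint b n + c; 2 * pi; c + T + 2 * eps].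

Let ends_countable : countable ends.
Proof.
apply: bigcup_countable => // n _; apply: finite_set_countable.
by rewrite !finite_setU; do !split; exact: finite_set1.
Qed.

Let K0K x : ~ ends x -> K_ r eps x <-> K x.
Proof.
move=> nx.
have nb n : x <> endpoint b n by move=> e; apply: nx; exists n => //; do 3!left.
have nbc n : x <> endpoint b n + c by move=> e; apply: nx; exists n => //; do 2!left; right.
have n2 : x <> 2 * pi by move=> e; apply: nx; exists 0 => //; left; right.
have n3 : x <> c + T + 2 * eps by move=> e; apply: nx; exists 0 => //; right.
have cl n : endpoint a n <= x <= endpoint b n -> I n x.
  by move=> /andP[h1 h2]; rewrite /I h1 lt_neqAle h2 andbT; apply/eqP.
have J_E : (J_ r `\` \bigcup_n E_ r eps n) x <-> c <= x <= c + T /\ ~ U (x - c).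
  split=> [[]|[h nU]].
    rewrite /J_ /= in_itv /= -/N -/T cT => h nE; split=> // -[n /andP[h1 h2]].
    apply: nE; exists n => //; rewrite E_itv /= in_itv /=.
    by apply/andP; split; lra.
  split; first by rewrite /J_ /= in_itv /= -/N -/T cT.
  move=> [n _]; rewrite E_itv /= in_itv /= => /andP[h1 h2]; apply: nU; exists n.
  have : x != endpoint b n + c by apply/eqP.
  by rewrite neq_lt /I; lra.
have S3E : S3 r eps x <-> c + T <= x <= c + T + 2 * eps by rewrite /S3 /= in_itv /= -/T cT.
have S2E : S2 r eps x <-> T + 2 * eps <= x <= 2 * pi by rewrite /S2 /= in_itv.
split.
- move=> [[/J_E[h nU]|[n _]]|[[|/S2E/andP[h1 h2]]|/S3E/andP[h1 h2]]].
  + by right; split => //=; move: eps0 h; lra.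
  + by rewrite F_itv /= in_itv /= => h; left; left; exists n.+1; exact: cl.
  + by rewrite S1E /= in_itv /= => h; left; left; exists 0; exact: cl.
  + by left; right; rewrite /= h1 lt_neqAle h2 andbT; apply/eqP.
  + right; split => /=.
      have : x != c + T + 2 * eps by apply/eqP.
      by rewrite neq_lt; move: eps0 T_lt pi0; lra.
    by move=> /UP; move: T_lt; lra.
- case=> [[[[|n] /andP[h1 h2]]|/= /andP[h1 h2]]|[/= h nU]].
  + by right; left; left; rewrite S1E /= in_itv /= h1 ltW.
  + by left; right; exists n => //; rewrite F_itv /= in_itv /= h1 ltW.
  + by right; left; right; apply/S2E; rewrite h1 ltW.
  + have [hx|hx] := lerP x (c + T); first by left; left; apply/J_E; split=> //; lra.
    by right; right; apply/S3E; lra.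
Qed.

Let K0_pos : K_ r eps `<=` [set x | 0 < x].
Proof.
have c0 : 0 < c by rewrite mulr_gt0.
move=> x [[[+ _]|[n _]]|[[|]|]].
- by rewrite /J_ /= in_itv /= => /andP[h _]; exact: lt_le_trans h.
- rewrite F_itv /= in_itv /= => /andP[h _]; apply: lt_le_trans h.
  by have /andP[h _] := endpoint_octave n aT; apply: lt_le_trans h; rewrite mulr_gt0.
- rewrite S1E /= in_itv /= => /andP[h _]; apply: lt_le_trans h.
  by rewrite /a addr_gt0 ?divr_gt0//; move: T_lt pi0; lra.
- by rewrite /S2 /= in_itv /= -/T; move: T_lt pi0 eps0; lra.
- by rewrite /S3 /= in_itv /= -/T cT; move: T_lt pi0 eps0 c0; lra.
Qed.

Lemma K_wavelet_set : hardy2_wavelet_set (K_ r eps).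
Proof.
have cE : c = 2 * pi * ((2 ^ r)%N%:Z)%:~R :> R.
  by rewrite /c /N exprS -[_%:~R]/((2 ^ r)%:R : R) natrX; ring.
apply: (@tiling_hardy2_wavelet_set _ K A B (2 ^ r)%N%:Z mA mB AB disj).
- by rewrite lez_nat expn_gt0.
- by move=> x; rewrite -cE.
- exact: Kpos.
- exact: Kdil.
- exact: Kuniq.
- by exists (K_ r eps) => //; exists set0; [exact: negligible_set0|rewrite setU0].
- exact: K0_pos.
- exists ends; split.
  + by apply: countable_measurable ends_countable => t; exact: measurable_set1.
  + exact: (countable_lebesgue_measure0 ends_countable).
  + by move=> x /= h; apply: contrapT => nx; apply: h; exact: K0K.
Qed.

End Iterates.

Theorem theorem10 (R : realType) (r : nat) (eps : R) :
  (1 <= r)%N ->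
  0 < eps < (2 ^+ r - 1) / (2 ^+ r.+1 - 1) * pi ->
  hardy2_wavelet_set (K_ r eps).
Proof. exact: K_wavelet_set. Qed.
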